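(* Let $p$ be an odd prime. Let $f$ be a normalized new cuspidal modular eigenform of even weight $k\ge 2$, level $N$ and nebentypus $\epsilon$, with associated Galois module $A_f$ over $\mathcal{O}$. Let $F$ be a number field, let $L_\infty$ be a $\mathbb{Z}_p^2$-extension of $F$ which contains the cyclotomic $\mathbb{Z}_p$-extension $F^{\mathrm{cyc}}$, put $G=\mathrm{Gal}(L_\infty/F)$, and let $\Phi(L_\infty/F)$ be the set of all $\mathbb{Z}_p$-extensions of $F$ contained in $L_\infty$. Suppose that $Y(A_f/L_\infty)$ is pseudo-null over $\mathcal{O}[[G]]$. Then $Y(A_f/\mathcal{L})$ is a torsion $\mathcal{O}[[\mathrm{Gal}(\mathcal{L}/F)]]$-module for every $\mathcal{L}\in\Phi(L_\infty/F)$.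
   Context: Let $K_f$ be the number field generated over $\mathbb{Q}$ by the Fourier coefficients of $f$; fix a prime $\mathfrak{p}$ of $K_f$ above $p$, let $K_{f,\mathfrak{p}}$ be the completion and $\mathcal{O}$ its ring of integers. Let $V_f$ be the two-dimensional $K_{f,\mathfrak{p}}$-linear representation of $\mathrm{Gal}(\bar{\mathbb{Q}}/\mathbb{Q})$ attached to $f$ by Deligne, fix a Galois-stable $\mathcal{O}$-lattice $T_f\subset V_f$, and set $A_f=V_f/T_f$. Let $S$ be a finite set of primes of $F$ containing those dividing $pN$ and all infinite primes, and $F_S$ the maximal algebraic extension of $F$ unramified outside $S$. For a finite extension $L/F$ inside $F_S$ with $S(L)$ the primes of $L$ above $S$, $$R(A_f/L)=\ker\Big(H^1(\mathrm{Gal}(F_S/L),A_f)\to\bigoplus_{v\in S(L)}H^1(L_v,A_f)\Big).$$ For an infinite extension $\mathcal{L}/F$ inside $F_S$, $R(A_f/\mathcal{L})=\varinjlim_L R(A_f/L)$ over finite subextensions, and $Y(A_f/\mathcal{L})$ is its Pontryagin dual. A finitely generated module over a regular local ring is torsion if each element is killed by a nonzero ring element, and pseudo-null if its localization at every prime of height $\le 1$ is zero. *)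

(* Defs.v *)
From HB Require Import structures.
From mathcomp Require Import all_boot all_order all_algebra all_field.
From mathcomp Require Import all_classical all_reals all_analysis.
From mathcomp Require Import complex.

Set Implicit Arguments.
Unset Strict Implicit.
Unset Printing Implicit Defensive.

Import Order.TTheory GRing.Theory Num.Theory.
Import numFieldNormedType.Exports.

Local Open Scope classical_set_scope.
Local Open Scope ring_scope.

Section Subfields.
Variable C : fieldType.
Implicit Types (E F P : set C).

Definition is_subfield E :=
  [/\ E 1, (forall x y, E x -> E y -> E (x - y))
         & (forall x y, E x -> E y -> E (x / y))].

Definition gen_field (X : set C) : set C :=
  [set x | forall E, is_subfield E -> X `<=` E -> E x].

Definition rat_field : set C := gen_field set0.

Definition finite_ext F E :=
  [/\ is_subfield F, is_subfield E, F `<=` E &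
    exists s : seq C, forall x, E x ->
      exists2 a : nat -> C, (forall i, F (a i))
        & x = \sum_(i < size s) a i * s`_i].

Definition number_field F := finite_ext rat_field F.

Definition integers E : set C :=
  [set x | E x /\ integralOver (intr : int -> C) x].

(* Nonzero prime ideals of [integers E], i.e. the finite primes of [E]. *)
Definition finite_prime E P :=
  [/\ P `<=` integers E, ~ P 1 & exists2 x, P x & x != 0]
  /\ [/\ forall x y, P x -> P y -> P (x - y),
         forall x y, integers E x -> P y -> P (x * y)
       & forall x y, integers E x -> integers E y ->
           P (x * y) -> P x \/ P y].

End Subfields.

(* The value at 0 is irrelevant; [vge] below treats it as +oo. *)
Record discrete_valuation (K : fieldType) := DiscreteValuation {
  dval :> K -> int;
  dvalM : forall x y, x != 0 -> y != 0 -> dval (x * y) = dval x + dval y;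
  dvalD : forall x y, x != 0 -> y != 0 -> x + y != 0 ->
            Num.min (dval x) (dval y) <= dval (x + y);
  dval_onto : exists2 x, x != 0 & dval x = 1 }.

Section Valuations.
Variables (K : fieldType) (v : discrete_valuation K).

Definition vge (x : K) (n : int) : bool := (x == 0) || (n <= v x).

Definition vring : {pred K} := fun x => vge x 0.

Definition vcomplete :=
  forall u : nat -> K,
    (forall n : int, exists m : nat, forall i j : nat,
        (m <= i)%N -> (m <= j)%N -> vge (u i - u j) n) ->
    exists l, forall n : int, exists m : nat, forall i : nat,
        (m <= i)%N -> vge (u i - l) n.

Lemma dval1 : v 1 = 0.
Proof.
have := @dvalM _ v 1 1 (oner_neq0 _) (oner_neq0 _).
by rewrite mulr1 => /eqP; rewrite -subr_eq0 opprD addNKr oppr_eq0 => /eqP.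
Qed.

Lemma dvalN1 : v (- 1) = 0.
Proof.
have nz : (- 1 : K) != 0 by rewrite oppr_eq0 oner_neq0.
have := dvalM v nz nz; rewrite mulrNN mulr1 dval1 => /esym/eqP.
by rewrite -mulr2n mulrn_eq0 /= => /eqP.
Qed.

Lemma vring_subring : subring_closed vring.
Proof.
have vM x y : x \in vring -> y \in vring -> x * y \in vring.
  rewrite /in_mem /= /vring /vge mulf_eq0.
  have [//|x0] := eqVneq x 0; have [//|y0] := eqVneq y 0.
  by rewrite /= => hx hy; rewrite dvalM // addr_ge0.
split=> //; first by rewrite /in_mem /= /vring /vge dval1 lexx orbT.
move=> x y hx hy; have {hy} : - 1 * y \in vring.
  by apply: vM => //; rewrite /in_mem /= /vring /vge dvalN1 lexx orbT.
rewrite mulN1r; move: (- y) hx => {}y; rewrite /in_mem /= /vring /vge.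
have [->|x0] := eqVneq x 0; first by rewrite add0r.
have [->|y0] := eqVneq y 0; first by rewrite addr0 (negPf x0).
have [//|xy0] := eqVneq (x + y) 0; rewrite /= => hx hy.
by apply: le_trans (dvalD _ _ _ xy0) => //; rewrite le_min hx.
Qed.

HB.instance Definition _ := GRing.isSubringClosed.Build K vring vring_subring.

Definition vint := {x : K | x \in vring}.

HB.instance Definition _ := SubType.on vint.
HB.instance Definition _ := Choice.on vint.
HB.instance Definition _ := [SubChoice_isSubComNzRing of vint by <:].

(* The O-lattice in K^2 having the columns of the invertible matrix B as an
   O-basis. *)
Definition lattice (B : 'M[K]_2) : {pred 'cV[K]_2} :=
  fun x => invmx B *m x \is a mxOver vring.

Variable B : 'M[K]_2.

Lemma lattice_zmod : zmod_closed (lattice B).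
Proof.
split=> [|x y]; rewrite /in_mem /= /lattice; first by rewrite mulmx0 rpred0.
by rewrite mulmxBr => hx hy; rewrite rpredB.
Qed.

HB.instance Definition _ :=
  GRing.isZmodClosed.Build 'cV[K]_2 (lattice B) lattice_zmod.

Lemma latticeZ (a : vint) x : x \in lattice B -> val a *: x \in lattice B.
Proof.
rewrite /in_mem /= /lattice -scalemxAr => /mxOverP hx; apply/mxOverP => i j.
by rewrite mxE rpredM ?(valP a).
Qed.

(* The discrete module V/T, for V = K^2 and T = lattice B. *)

Definition quotVT := Quotient.quot (lattice B).

HB.instance Definition _ := GRing.Zmodule.on quotVT.

Definition toVT (x : 'cV[K]_2) : quotVT := (\pi_quotVT x)%qT.
Definition fromVT (x : quotVT) : 'cV[K]_2 := repr x.

Lemma fromVTK : cancel fromVT toVT.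
Proof. exact: reprK. Qed.

Lemma toVT_eq x y : x - y \in lattice B -> toVT x = toVT y.
Proof. by move=> h; apply/eqP; rewrite -Quotient.idealrBE. Qed.

Lemma fromVT_toVT x : fromVT (toVT x) - x \in lattice B.
Proof. by rewrite Quotient.idealrBE reprK eqxx. Qed.

Lemma toVTD x y : toVT (x + y) = toVT x + toVT y.
Proof. exact: raddfD. Qed.

Definition quotVT_scale (a : vint) (x : quotVT) : quotVT :=
  toVT (val a *: fromVT x).

Lemma quotVT_scaleE a x : quotVT_scale a (toVT x) = toVT (val a *: x).
Proof. by apply: toVT_eq; rewrite -scalerBr; apply/latticeZ/fromVT_toVT. Qed.

Lemma quotVT_scaleA a b x :
  quotVT_scale a (quotVT_scale b x) = quotVT_scale (a * b) x.
Proof. by rewrite -[quotVT_scale b x]/(toVT _) quotVT_scaleE scalerA. Qed.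

Lemma quotVT_scale1 : left_id 1 quotVT_scale.
Proof. by move=> x; rewrite /quotVT_scale scale1r fromVTK. Qed.

Lemma quotVT_scaleDr : right_distributive quotVT_scale +%R.
Proof.
move=> a x y; rewrite -{1}[x]fromVTK -{1}[y]fromVTK -toVTD quotVT_scaleE.
by rewrite scalerDr toVTD.
Qed.

Lemma quotVT_scaleDl x : {morph quotVT_scale^~ x : a b / a + b}.
Proof. by move=> a b; rewrite /quotVT_scale -toVTD -scalerDl. Qed.

HB.instance Definition _ := GRing.Zmodule_isLmodule.Build vint quotVT
  quotVT_scaleA quotVT_scale1 quotVT_scaleDr quotVT_scaleDl.

End Valuations.

(* The absolute Galois group of Q: [algC] is an algebraic closure of Q, and all
   its ring endomorphisms are automorphisms. *)

Definition absGal := {rmorphism algC -> algC}.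

HB.instance Definition _ := gen_eqMixin absGal.
HB.instance Definition _ := gen_choiceMixin absGal.

Definition gal_comp (s t : absGal) : absGal := s \o t.
Definition gal_id : absGal := idfun.
Definition gal_inv (s : absGal) : absGal := algC_invaut s.

(* The subgroup Gal(algC / E). *)
Definition gal_over (E : set algC) : set absGal :=
  [set s | forall x, E x -> s x = x].

(* Continuity on the group [H], with the Krull topology of its image in the
   automorphisms of the field [X], for functions to a discrete space. *)
Definition krull_continuous (X : set algC) (H : set absGal) (T : Type)
    (c : absGal -> T) :=
  forall s : absGal, H s -> exists r : seq algC,
    (forall x, x \in r -> X x)
    /\ (forall t : absGal, H t -> {in r, t =1 s} -> c t = c s).

Definition normal_ext (F E : set algC) :=
  [/\ is_subfield F, is_subfield E, F `<=` E &
      forall s x, gal_over F s -> E x -> E (s x)].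

(* Primes of algC are the finite primes P of [setT] (prime ideals of the ring
   of all algebraic integers) and the absolute values |s x| with s : absGal. *)

Definition decomposition (P : set algC) : set absGal :=
  [set s | forall x, P (s x) <-> P x].

Definition inertia (P : set algC) : set absGal :=
  [set s | forall x, integers setT x -> P (s x - x)].

Definition frobenius (P : set algC) (l : nat) : set absGal :=
  [set s | forall x, integers setT x -> P (s x - x ^+ l)].

Definition decomposition_inf (w : absGal) : set absGal :=
  [set s | forall x, `|w (s x)| = `|w x|].

(* [E] is an extension of [F] unramified outside [S] and infinity. *)
Definition unramified_outside (F : set algC) (S : set (set algC))
    (E : set algC) :=
  forall P, finite_prime setT P -> ~ S (P `&` F) ->
    inertia P `&` gal_over F `<=` gal_over E.

Definition max_unramified (F : set algC) (S : set (set algC)) : set algC :=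
  [set x | exists E, [/\ is_subfield E, F `<=` E, unramified_outside F S E
                       & E x]].

(* The p-adic integers, as the limit of the Z/p^n: an element is the sequence
   of its residues in [0, p^n[. *)
Record padic_int (p : nat) := PadicInt {
  residue :> nat -> nat;
  residueP : forall n, residue n = (residue n.+1 %% p ^ n)%N }.

(* [k] induces a continuous isomorphism from Gal(L/F) (a compact group) to
   Z_p^d. *)
Definition Zp_extension (p d : nat) (F L : set algC) :=
  normal_ext F L /\
  exists k : absGal -> 'I_d -> padic_int p,
    [/\ forall s t i n, gal_over F s -> gal_over F t ->
          k (gal_comp s t) i n = ((k s i n + k t i n) %% p ^ n)%N,
        forall i n, krull_continuous L (gal_over F) (fun s => k s i n),
        forall z : 'I_d -> padic_int p,
          exists2 s, gal_over F s & forall i n, k s i n = z i n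
      & forall s, gal_over F s ->
          (forall i n, k s i n = 0%N) <-> gal_over L s].

(* The unique Z_p-extension of F inside the field generated over F by all
   roots of unity of p-power order. *)
Definition cyclotomic_Zp_extension (p : nat) (F L : set algC) :=
  Zp_extension p 1 F L /\
  L `<=` gen_field (F `|` [set z | exists n, z ^+ (p ^ n) = 1]).

(* The index set of the limits below: finite subextensions of L/F. *)
Definition finite_sub (F L : set algC) :=
  {E : set algC | finite_ext F E /\ E `<=` L}.

Section Iwasawa.
Variables (O : comNzRingType) (F L : set algC).

Definition agree (E : finite_sub F L) (s t : absGal) :=
  forall x, sval E x -> s x = t x.

(* A set of representatives in Gal(algC/F) for the (finite) quotient group
   Gal(E/F); E/F is Galois when L/F is abelian. *)
Definition gal_reps (E : finite_sub F L) : set absGal :=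
  [set xget gal_id [set t | gal_over F t /\ agree E s t] | s in gal_over F].

(* O[[Gal(L/F)]], the inverse limit of the group rings O[Gal(E/F)]: lam E s is
   the coefficient in O[Gal(E/F)] of the restriction of s to E.  The value is
   set to 0 outside Gal(algC/F). *)
Definition iwasawa_algebra : set (finite_sub F L -> absGal -> O) :=
  [set lam |
    [/\ forall E s, ~ gal_over F s -> lam E s = 0,
        forall E s t, gal_over F s -> gal_over F t -> agree E s t ->
          lam E s = lam E t
      & forall (E E' : finite_sub F L) s, sval E `<=` sval E' ->
          gal_over F s ->
          lam E s = \sum_(t \in gal_reps E' `&` agree E s) lam E' t]].

Definition iwasawa_one : finite_sub F L -> absGal -> O :=
  fun E s => if `[< gal_over F s /\ agree E s gal_id >] then 1 else 0.

Definition iwasawa_mul (lam mu : finite_sub F L -> absGal -> O) :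
    finite_sub F L -> absGal -> O :=
  fun E s => if `[< gal_over F s >]
    then \sum_(t \in gal_reps E) lam E t * mu E (gal_comp (gal_inv t) s)
    else 0.

End Iwasawa.

(* A commutative ring is given by its underlying set [L] in an abelian group
   [X], with the addition of [X], and a module over it by its underlying set
   [M] in an abelian group [Y]. *)
Section Modules.
Variables (X : zmodType) (L : set X) (one : X) (mul : X -> X -> X).
Variables (Y : zmodType) (M : set Y) (scale : X -> Y -> Y).

Definition prime_ideal (P : set X) :=
  [/\ P `<=` L, P 0 & ~ P one]
  /\ [/\ forall x y, P x -> P y -> P (x - y),
         forall x y, L x -> P y -> P (mul x y)
       & forall x y, L x -> L y -> P (mul x y) -> P x \/ P y].

Definition height_le1 (P : set X) :=
  ~ exists P0 P1, [/\ prime_ideal P0, prime_ideal P1, P0 `<` P1 & P1 `<` P].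

(* Equality of the fractions m/s and n/t in the localization of M at P. *)
Definition frac_eq (P : set X) (m : Y) (s : X) (n : Y) (t : X) :=
  exists u, [/\ L u, ~ P u & scale u (scale t m - scale s n) = 0].

Definition localization_zero (P : set X) :=
  forall m s, M m -> L s -> ~ P s -> frac_eq P m s 0 one.

Definition pseudo_null :=
  forall P, prime_ideal P -> height_le1 P -> localization_zero P.

Definition torsion :=
  forall m, M m -> exists a, [/\ L a, a != 0 & scale a m = 0].

End Modules.

Section FineSelmer.
Variables (R : realType).
Variables (O : comNzRingType) (A : lmodType O) (act : absGal -> A -> A).
Variables (F : set algC) (S : set (set algC)).

(* 1-cocycles of Gal(F_S/E) with values in A, seen as functions on
   Gal(algC/E); continuity forces them to factor through Gal(F_S/E).
   The values outside Gal(algC/E) are irrelevant. *)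
Definition cocycle (E : set algC) : set (absGal -> A) :=
  [set c | krull_continuous (max_unramified F S) (gal_over E) c /\
    forall s t, gal_over E s -> gal_over E t ->
      c (gal_comp s t) = c s + act s (c t)].

(* [c] is the coboundary of some element of A on the group [H]. *)
Definition coboundary_on (H : set absGal) (c : absGal -> A) :=
  exists a, forall s, H s -> c s = act s a - a.

(* Cocycles whose class lies in R(A/E).  For a prime v of E, the decomposition
   group in Gal(algC/E) of a prime of algC above v is the absolute Galois
   group of the completion of E at v. *)
Definition fine_cocycle (E : set algC) : set (absGal -> A) :=
  [set c | [/\ cocycle E c,
    forall P, finite_prime setT P -> S (P `&` F) ->
      coboundary_on (gal_over E `&` decomposition P) c
    & forall w, coboundary_on (gal_over E `&` decomposition_inf w) c]].

Variable L : set algC.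

Definition integer_pred : {pred R} := fun x => x \is a Num.int.

Lemma integer_zmod : zmod_closed integer_pred.
Proof. by split=> [|x y]; [exact: rpred0 | exact: rpredB]. Qed.

HB.instance Definition _ :=
  GRing.isZmodClosed.Build R integer_pred integer_zmod.

(* The group R/Z, the target of Pontryagin duality. *)
Definition circle := Quotient.quot integer_pred.

HB.instance Definition _ := GRing.Zmodule.on circle.

(* Y(A/L), the group of characters of the (discrete) direct limit of the
   R(A/E): such a character phi sends the class of the fine cocycle c over E
   to phi E c, it respects cohomology classes and is compatible with the
   restriction maps from E to E'.  The values on other functions are set
   to 0. *)
Definition dual_fine_selmer : set (finite_sub F L -> (absGal -> A) -> circle) :=
  [set phi |
    [/\ forall E c, ~ fine_cocycle (sval E) c -> phi E c = 0,
        forall E c d, fine_cocycle (sval E) c -> fine_cocycle (sval E) d ->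
          phi E (c + d) = phi E c + phi E d,
        forall E c d, fine_cocycle (sval E) c -> fine_cocycle (sval E) d ->
          coboundary_on (gal_over (sval E)) (c - d) -> phi E c = phi E d
      & forall (E E' : finite_sub F L) c, sval E `<=` sval E' ->
          fine_cocycle (sval E) c -> phi E c = phi E' c]].

(* The action of O[[Gal(L/F)]] on Y(A/L), where s in Gal(L/F) acts by
   (s phi)(x) = phi (s^-1 x), and s^-1 sends the class of a cocycle c to
   that of t |-> s^-1 c(s t s^-1). *)
Definition dual_scale (lam : finite_sub F L -> absGal -> O)
    (phi : finite_sub F L -> (absGal -> A) -> circle) :
    finite_sub F L -> (absGal -> A) -> circle :=
  fun E c => if `[< fine_cocycle (sval E) c >] then
    phi E (fun t => \sum_(s \in gal_reps E) lam E s *: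
      act (gal_inv s) (c (gal_comp (gal_comp s t) (gal_inv s))))
    else 0.

Definition dual_pseudo_null :=
  pseudo_null (@iwasawa_algebra O F L) (@iwasawa_one O F L)
    (@iwasawa_mul O F L) dual_fine_selmer dual_scale.

Definition dual_torsion :=
  torsion (@iwasawa_algebra O F L) dual_fine_selmer dual_scale.

End FineSelmer.

Section ModularForms.
Variable R : realType.
Notation C := R[i].

Definition upper_half (t : C) := 0 < complex.Im t.

(* A Dirichlet character modulo N, extended by 0. *)
Definition dirichlet (N : nat) (e : int -> C) :=
  [/\ e 1 = 1, forall x y, e (x * y) = e x * e y,
      forall x, e (x + N%:Z) = e x
    & forall x, (e x != 0) = coprimez x N].

Definition SL2Z : set 'M[int]_2 := [set g | \det g = 1].
Definition Gamma0 (N : nat) : set 'M[int]_2 :=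
  [set g | SL2Z g /\ (N%:Z %| (g 1 0)%R)%Z].

Definition slash (k : nat) (g : 'M[int]_2) (f : C -> C) (t : C) : C :=
  ((g 1 0)%:~R * t + (g 1 1)%:~R) ^- k *
  f (((g 0 0)%:~R * t + (g 0 1)%:~R) / ((g 1 0)%:~R * t + (g 1 1)%:~R)).

Definition cusp_form (k N : nat) (e : int -> C) (f : C -> C) :=
  [/\ forall t, upper_half t -> derivable (f : C^o -> C^o) t 1,
      forall g t, Gamma0 N g -> upper_half t ->
        slash k g f t = e (g 1 1) * f t
    & forall g, SL2Z g -> forall eps : R, 0 < eps ->
        exists b : R, forall t, upper_half t -> b < complex.Im t ->
          `|slash k g f t| < eps%:C%C].

(* exp (2 i pi t) *)
Definition nome (t : C) : C :=
  (expR (- (2 * pi * complex.Im t)))%:C%C *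
  (cos (2 * pi * complex.Re t) +i* sin (2 * pi * complex.Re t))%C.

Definition fourier_coefficients (f : C -> C) (a : nat -> C) :=
  forall t, upper_half t ->
    (series (fun n => a n * nome t ^+ n) : nat -> C^o) @ \oo --> (f t : C^o).

(* T_l for a prime l (usually denoted U_l when l divides the level). *)
Definition hecke (k : nat) (e : int -> C) (l : nat) (f : C -> C) (t : C) : C :=
  l%:R^-1 * (\sum_(j < l) f ((t + j%:R) / l%:R))
  + e l * l%:R ^+ k.-1 * f (l%:R * t).

(* A list of representatives of the right cosets Gamma0(N) g of SL2(Z). *)
Definition coset_reps (N : nat) (s : seq 'M[int]_2) :=
  [/\ uniq s, (forall g, g \in s -> SL2Z g)
    & forall g, SL2Z g ->
        exists! d, d \in s /\ (N%:Z %| ((g *m invmx d) 1 0)%R)%Z].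

Definition fundamental_domain : set (R * R) :=
  [set z | [/\ `|z.1| <= 2^-1, 1 <= z.1 ^+ 2 + z.2 ^+ 2 & 0 < z.2]].

Definition complex_integral (D : set (R * R)) (h : R * R -> C) : C :=
  (Rintegral (lebesgue_measure \x lebesgue_measure)%E D (fun z => complex.Re (h z))
   +i* Rintegral (lebesgue_measure \x lebesgue_measure)%E D
         (fun z => complex.Im (h z)))%C.

(* Petersson product (up to normalization): the union of the translates of
   the domain by s is a fundamental domain for Gamma0(N), and the invariant
   measure is dx dy / y^2. *)
Definition petersson (k : nat) (s : seq 'M[int]_2) (f g : C -> C) : C :=
  \sum_(d <- s) complex_integral fundamental_domain (fun z =>
    let t := (z.1 +i* z.2)%C in
    slash k d f t * (slash k d g t)^* * (z.2 ^+ (k - 2))%:C%C).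

(* [f] is orthogonal to the oldforms t |-> g (d t), where g is a cusp form of
   level M, M a proper divisor of N, and d divides N / M. *)
Definition in_new_space (k N : nat) (e : int -> C) (f : C -> C) :=
  forall (M d : nat) (e' : int -> C) (g : C -> C),
    (0 < d)%N -> (M < N)%N -> (M * d %| N)%N ->
    dirichlet M e' -> (forall x, coprimez x N -> e' x = e x) ->
    cusp_form k M e' g ->
    forall s, coset_reps N s -> petersson k s f (fun t => g (d%:R * t)) = 0.

Definition newform (k N : nat) (e : int -> C) (f : C -> C) (a : nat -> C) :=
  [/\ cusp_form k N e f, fourier_coefficients f a, a 1%N = 1,
      forall l, prime l -> exists b, forall t, upper_half t ->
        hecke k e l f t = b * f t
    & in_new_space k N e f].

Definition coefficient_field (a : nat -> C) : set C := gen_field (range a).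

End ModularForms.

Section Representations.

(* [i], restricted to the is_subfield [E] of [C], is a completion of [E] at its
   finite prime [P]. *)
Definition completion_at (C : fieldType) (E P : set C)
    (K : fieldType) (v : discrete_valuation K) (i : C -> K) :=
  [/\ [/\ i 1 = 1, forall x y, E x -> E y -> i (x + y) = i x + i y
        & forall x y, E x -> E y -> i (x * y) = i x * i y],
      forall x, integers E x -> vge v (i x) 0,
      forall x, integers E x -> P x <-> vge v (i x) 1,
      forall (z : K) (n : int), exists2 x, E x & vge v (z - i x) n
    & vcomplete v].

Variables (K : fieldType) (v : discrete_valuation K).

Definition galois_rep (rho : absGal -> 'M[K]_2) :=
  [/\ rho gal_id = 1%:M,
      forall s t, rho (gal_comp s t) = rho s *m rho t
    & forall (s : absGal) (n : int), exists r : seq algC,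
        forall t : absGal, {in r, t =1 s} ->
        forall j j', vge v (rho t j j' - rho s j j') n].

(* The Galois representation on V_f = K^2 attached to the eigenform with
   Fourier coefficients a: unramified outside pN, with
   X^2 - a_l X + e(l) l^(k-1) as characteristic polynomial of an arithmetic
   Frobenius at l. *)
Definition deligne_rep (R : realType) (p k N : nat) (e : int -> R[i])
    (a : nat -> R[i]) (i : R[i] -> K) (rho : absGal -> 'M[K]_2) :=
  galois_rep rho /\
  forall (l : nat) P, prime l -> ~~ (l %| p * N)%N ->
    finite_prime setT P -> P l%:R ->
    (forall s, inertia P s -> rho s = 1%:M) /\
    (forall s, frobenius P l s ->
       char_poly (rho s) =
         'X^2 - (i (a l))%:P * 'X + (i (e l * l%:R ^+ k.-1))%:P).

Definition stable_lattice (rho : absGal -> 'M[K]_2) (B : 'M[K]_2) :=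
  B \in unitmx /\
  forall s x, x \in lattice v B -> rho s *m x \in lattice v B.

(* The action of Gal(algC/Q) on A_f = V_f / T_f. *)
Definition quotVT_act (rho : absGal -> 'M[K]_2) (B : 'M[K]_2) (s : absGal)
    (x : quotVT v B) : quotVT v B :=
  toVT v B (rho s *m fromVT x).

End Representations.

(* Main.v *)
(* Write L for the Z_p-extension, h for a topological generator of Gal(Loo/L)
   and gamma for a lift of one of Gal(L/F).  Let phi be a character of R(A/L).
   A class of R(A/L) which dies in R(A/Loo) lives on <h>, with values in the
   points of A fixed by Gal(Loo), and gamma acts on it through the matrix of
   its inverse on V_f; by Cayley-Hamilton it is killed by
   mu = gamma^2 - r1 gamma + r2.  So mu phi factors through the image of R(A/L)
   in R(A/Loo) and, since R/Z is divisible, extends to a character psi of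
   R(A/Loo).
   The kernel of O[[G]] -> O[[Gal(L/F)]] is generated by h - 1, whose powers
   have zero intersection, and O[[Gal(L/F)]] is a domain, so this kernel is a
   prime of height at most 1.  By pseudo-nullity some u outside of it kills psi;
   if u' is its image in O[[Gal(L/F)]] then u' mu is nonzero and kills phi.
   Division by h - 1 is done by hand: if D b = a for the difference operator D
   of h, then b integrates against a the function counting the visits of a class
   by the powers of h, which is a p-adic limit of finite sums.  The same
   division in O[[Gal(L/F)]], with gamma for h, gives that it is a domain, by
   comparing the first nonzero coefficients in powers of gamma - 1. *)

From Pilot Require (* Undoes the shadowing of [Defs.gal_id] by [galois.gal_id]. *)
Import Defs.
From HB Require Import structures.
From mathcomp Require Import all_boot all_order all_algebra all_field.
From mathcomp Require Import all_classical all_reals all_analysis.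
From mathcomp Require Import complex cyclic ring.
Import Defs.

Set Implicit Arguments.
Unset Strict Implicit.
Unset Printing Implicit Defensive.

Import Order.TTheory GRing.Theory Num.Theory.

Local Open Scope classical_set_scope.
Local Open Scope ring_scope.

(** The obstacle is that restriction from R(A/L) to R(A/Loo) need not be injective, so that phi
    itself need not come from a character of R(A/Loo); passing to mu phi removes this obstruction.
    It is harmless because mu is nonzero: gamma^2, gamma and 1 have coordinates 2, 1 and 0 modulo p
    in Gal(L/F), distinct since p is odd, so the coefficient 1 of gamma^2 survives. The coefficients
    r1 and r2 are a trace and a determinant, integral because the lattice is stable. Elements of
    O[[G]] are treated as O-valued measures, given by compatible coefficients at the finite levels,
    and never as power series. If t = h^n t0 with n a natural number, the quotient of t - t0 by h -
    1 is the geometric sum of the h^i t0 for i < n. For n in Z_p such a sum is only determined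
    modulo powers of p at each finite level, and this is where the completeness of O enters.
    Cohomology classes are handled through cocycles, without forming quotient groups. *)

(** * The group law on the absolute Galois group *)

Lemma absGal_ext (s t : absGal) : s =1 t -> s = t.
Proof.
case: s => s [[sa] [sm]]; case: t => t [[ta] [tm]] /= /funext e.
case: _ / e ta tm => ta tm.
by rewrite (Prop_irrelevance ta sa) (Prop_irrelevance tm sm).
Qed.

Fact gal_compA : associative gal_comp.
Proof. by move=> s t u; apply: absGal_ext. Qed.

Fact gal_comp1l : left_id gal_id gal_comp.
Proof. by move=> s; apply: absGal_ext. Qed.

Fact gal_comp1r : right_id gal_id gal_comp.
Proof. by move=> s; apply: absGal_ext. Qed.

Fact gal_compV : left_inverse gal_id gal_inv gal_comp.
Proof. by move=> s; apply: absGal_ext => x /=; rewrite algC_autK. Qed.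

Fact gal_compVr : right_inverse gal_id gal_inv gal_comp.
Proof. by move=> s; apply: absGal_ext => x /=; rewrite algC_invautK. Qed.

HB.instance Definition _ := isGroup.Build absGal
  gal_compA gal_comp1l gal_comp1r gal_compV gal_compVr.

(** * Finite extensions inside [algC] *)

Section FiniteExtensions.
Implicit Types (E F L : set algC) (s t : seq algC).

Section Subfield.
Variables (F : set algC) (sfF : is_subfield F).

Lemma subfield1 : F 1. Proof. by case: sfF. Qed.
Lemma subfieldB x y : F x -> F y -> F (x - y). Proof. by case: sfF => _ + _; apply. Qed.
Lemma subfield_div x y : F x -> F y -> F (x / y). Proof. by case: sfF => _ _; apply. Qed.

Lemma subfield0 : F 0.
Proof. by have := subfieldB subfield1 subfield1; rewrite subrr. Qed.

Lemma subfieldN x : F x -> F (- x).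
Proof. by move=> Fx; rewrite -sub0r; apply: subfieldB => //; apply: subfield0. Qed.

Lemma subfieldD x y : F x -> F y -> F (x + y).
Proof. by move=> Fx Fy; rewrite -[y]opprK; apply/subfieldB/subfieldN. Qed.

Lemma subfieldV x : F x -> F x^-1.
Proof. by move=> Fx; rewrite -div1r; apply: subfield_div => //; apply: subfield1. Qed.

Lemma subfieldM x y : F x -> F y -> F (x * y).
Proof. by move=> Fx Fy; rewrite -[y]invrK; apply/subfield_div/subfieldV. Qed.

Lemma subfield_nat n : F n%:R.
Proof.
elim: n => [|n IHn]; first exact: subfield0.
by rewrite -natr1; apply: subfieldD => //; apply: subfield1.
Qed.

Lemma subfield_rat (q : rat) : F (ratr q).
Proof.
have subfield_int (n : int) : F n%:~R.
  by case: n => n; [|apply: subfieldN]; apply: subfield_nat.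
exact: subfield_div.
Qed.

Lemma subfield_sum (I : Type) (r : seq I) (P : pred I) (f : I -> algC) :
  (forall i, P i -> F (f i)) -> F (\sum_(i <- r | P i) f i).
Proof. by apply: big_ind; [apply: subfield0|apply: subfieldD]. Qed.

(** Same shape as the spanning clause of [finite_ext], which thus becomes an inclusion in
    [Fspan F s]. *)
Definition Fspan s : set algC :=
  [set x | exists2 a : nat -> algC, (forall i, F (a i))
     & x = \sum_(i < size s) a i * s`_i].

Lemma Fspan0 s : Fspan s 0.
Proof.
exists (fun=> 0) => [_|]; first exact: subfield0.
by rewrite big1 // => i _; rewrite mul0r.
Qed.

Lemma FspanD s x y : Fspan s x -> Fspan s y -> Fspan s (x + y).
Proof.
move=> [a Fa ->] [b Fb ->]; exists (fun i => a i + b i) => [i|].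
  exact: subfieldD.
by rewrite -big_split; apply: eq_bigr => i _; rewrite mulrDl.
Qed.

Lemma FspanZ s c x : F c -> Fspan s x -> Fspan s (c * x).
Proof.
move=> Fc [a Fa ->]; exists (fun i => c * a i) => [i|]; first exact: subfieldM.
by rewrite mulr_sumr; apply: eq_bigr => i _; rewrite mulrA.
Qed.

Lemma FspanN s x : Fspan s x -> Fspan s (- x).
Proof.
by move=> Fx; rewrite -mulN1r; apply: FspanZ => //; apply/subfieldN/subfield1.
Qed.

Lemma Fspan_sum s (I : Type) (r : seq I) (P : pred I) (f : I -> algC) :
  (forall i, P i -> Fspan s (f i)) -> Fspan s (\sum_(i <- r | P i) f i).
Proof. by apply: big_ind; [apply: Fspan0|apply: FspanD]. Qed.

Lemma Fspan_mem s x : x \in s -> Fspan s x.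
Proof.
move=> /(nthP 0)[j js <-]; exists (fun i => (i == j)%:R) => [i|].
  exact: subfield_nat.
rewrite (bigD1 (Ordinal js)) //= eqxx mul1r big1 ?addr0 // => i.
by rewrite -val_eqE /= => /negPf->; rewrite mul0r.
Qed.

Lemma Fspan_trans s t :
  (forall x, x \in s -> Fspan t x) -> Fspan s `<=` Fspan t.
Proof.
move=> st _ [a Fa ->]; apply: Fspan_sum => i _; apply: FspanZ => //.
exact/st/mem_nth.
Qed.

Lemma FspanM s t x y :
  Fspan s x -> Fspan t y -> Fspan [seq u * w | u <- s, w <- t] (x * y).
Proof.
move=> [a Fa ->] [b Fb ->]; rewrite mulr_suml; apply: Fspan_sum => i _.
rewrite mulr_sumr; apply: Fspan_sum => j _; rewrite mulrACA.
apply: FspanZ; first exact: subfieldM.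
by apply/Fspan_mem/allpairsP; exists (s`_i, t`_j); split; rewrite ?mem_nth.
Qed.

Lemma Fspan_cons x s y :
  Fspan (x :: s) y -> exists2 a, F a & Fspan s (y - a * x).
Proof.
move=> [a Fa ->]; exists (a 0) => //; exists (fun i => a i.+1) => //.
by rewrite big_ord_recl /= addrC addKr.
Qed.

(* The spanning family in [finite_ext] need not lie in the extension. *)
Lemma Fspan_inner E s :
  (forall x y, E x -> E y -> E (x - y)) ->
  (forall c x, F c -> E x -> E (c * x)) -> E `<=` Fspan s ->
  exists s', (forall x, x \in s' -> E x) /\ E `<=` Fspan s'.
Proof.
elim: s E => [|x s IHs] E EB EZ Es; first by exists [::].
have [] := IHs (E `&` Fspan s).
- by move=> y z [Ey sy] [Ez sz]; split; [apply: EB|apply/FspanD/FspanN].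
- by move=> c y Fc [Ey sy]; split; [apply: EZ|apply: FspanZ].
- by move=> y [].
move=> s' [s'E Es']; have [Es0|] := pselect (E `<=` Fspan s).
  by exists s'; split=> [y /s'E[]|y Ey]; last by apply: Es'; split=> //; apply: Es0.
(* Here [e] is a pivot: its coefficient at [x] is nonzero, so subtracting a multiple of [e] moves
   any element of [E] into the span of [s]. *)
move=> /existsNP[e /not_implyP[Ee nse]].
exists (e :: s'); split=> [y|y Ey].
  by rewrite inE => /orP[/eqP->//|/s'E[]].
have [a Fa sa] := Fspan_cons (Es e Ee); have [b Fb sb] := Fspan_cons (Es y Ey).
have a0 : a != 0.
  by apply: contra_notN nse => /eqP a0; move: sa; rewrite a0 mul0r subr0.
have Fba : F (b / a) by apply: subfield_div.
suff /Es' sy' : (E `&` Fspan s) (y - b / a * e).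
  rewrite -(subrK (b / a * e) y); apply: FspanD.
    apply: Fspan_trans sy' => z zs'; apply: Fspan_mem.
    by rewrite inE zs' orbT.
  by apply: FspanZ => //; apply: Fspan_mem; rewrite inE eqxx.
split; first by apply: EB => //; apply: EZ.
have -> : y - b / a * e = (y - b * x) - (b / a) * (e - a * x).
  by rewrite mulrBr mulrA divfK // opprB addrA subrK.
by apply: FspanD => //; apply/FspanN/FspanZ.
Qed.

End Subfield.

Lemma minCpoly_expn (x : algC) :
  exists p : {poly rat}, (0 < (size p).-1)%N /\
    x ^+ (size p).-1 = - \sum_(i < (size p).-1) ratr p`_i * x ^+ i :> algC.
Proof.
have [p [px pm _]] := minCpolyP x; exists p.
have p1 : (0 < (size p).-1)%N.
  have := size_minCpoly x.
  by rewrite px size_map_poly; case: (size p) => // n.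
split=> //; have := root_minCpoly x; rewrite px /root horner_coef size_map_poly.
move: (lead_coefE p) p1; case: (size p) => [|n] //= lp p1.
rewrite big_ord_recr /= coef_map /= -lp (monicP pm) rmorph1 mul1r addr_eq0.
move=> /eqP/esym/eqP; rewrite eqr_oppLR => /eqP ->; congr (- _).
by apply: eq_bigr => i _; rewrite coef_map.
Qed.

(** Write the minimal polynomial of z as q X + c. Minimality forces c to be nonzero, and then 1/z =
    - q(z)/c. *)
Lemma invr_poly_rat (z : algC) : z != 0 ->
  exists q : {poly rat}, z^-1 = (map_poly ratr q).[z].
Proof.
move=> z0; have [p [_ pm rp]] := minCpolyP z.
pose q := drop_poly 1 p; have pE : p = q * 'X + (p`_0)%:P.
  rewrite -[LHS](poly_take_drop 1 p) addrC expr1; congr (_ + _).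
  by apply/polyP => i; rewrite coef_take_poly coefC; case: i => [|i].
have pz : (map_poly ratr q).[z] * z + ratr p`_0 = 0.
  have /rootP := etrans (rp p) (dvdpp p).
  by rewrite {1}pE rmorphD rmorphM /= map_polyX map_polyC !hornerE.
have p0 : p`_0 != 0.
  apply/eqP => p0; move: pz; rewrite p0 rmorph0 addr0 => /eqP.
  rewrite mulf_eq0 (negPf z0) orbF -[_ == 0]/(root _ _) rp.
  move: pE; rewrite p0 addr0 => pE; have pn0 := monic_neq0 pm.
  have q0 : q != 0 by apply: contraNneq pn0 => q0; rewrite pE q0 mul0r.
  by move=> /(dvdp_leq q0); rewrite [in X in (X <= _)%N]pE size_mulX // ltnn.
exists (- (p`_0)^-1 *: q); rewrite map_polyZ hornerZ rmorphN fmorphV.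
move/eqP: pz; rewrite addr_eq0 => /eqP qz.
apply: (mulIf z0); rewrite mulVf // -mulrA qz mulrNN mulVf //.
by rewrite fmorph_eq0.
Qed.

(** Elements of [algC] are algebraic over Q, so an inverse is a rational polynomial in the element
    and closure under products suffices. *)
Lemma subfield_of_closed (K E : set algC) : is_subfield K -> K `<=` E ->
  (forall x y, E x -> E y -> E (x - y)) ->
  (forall x y, E x -> E y -> E (x * y)) -> is_subfield E.
Proof.
move=> sfK KE EB EM; have E1 : E 1 by apply/KE/(subfield1 sfK).
have E0 : E 0 by apply/KE/(subfield0 sfK).
have ED x y : E x -> E y -> E (x + y).
  by move=> Ex Ey; rewrite -[y]opprK; apply: (EB) => //; rewrite -sub0r; apply: EB.
split=> // x y Ex Ey; apply: (EM) => //.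
have [->|y0] := eqVneq y 0; first by rewrite invr0.
have [q ->] := invr_poly_rat y0; rewrite horner_coef.
apply: (big_ind E E0 ED) => i _; apply: (EM).
  by rewrite coef_map; apply/KE/(subfield_rat sfK).
by elim: (nat_of_ord i) => [|n IHn]; rewrite ?expr0 // exprS; apply: EM.
Qed.

Lemma Fspan_powers_subfield F x d : is_subfield F -> (0 < d)%N ->
  let s := [seq x ^+ i | i <- iota 0 d] in
  Fspan F s (x ^+ d) -> is_subfield (Fspan F s) /\ F `<=` Fspan F s.
Proof.
move=> sfF d0 s xd.
have sM i : (i < d)%N -> Fspan F s (x ^+ i).
  by move=> id; apply/Fspan_mem/mapP => //; exists i; rewrite ?mem_iota.
have xM y : Fspan F s y -> Fspan F s (x * y).
  move=> [a Fa ->]; rewrite mulr_sumr; apply: Fspan_sum => // -[i /= is_] _.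
  rewrite mulrCA; apply: FspanZ => //.
  rewrite size_map size_iota in is_; rewrite (nth_map 0%N) ?size_iota //.
  rewrite nth_iota // add0n -exprS.
  by have [->//|ii] := eqVneq i.+1 d; apply: sM; rewrite ltn_neqAle ii.
have F_s : F `<=` Fspan F s.
  by move=> a Fa; rewrite -[a]mulr1 -(expr0 x); apply: FspanZ => //; apply: sM.
split=> //; apply: (subfield_of_closed sfF) => //.
  by move=> y z sy sz; apply: FspanD => //; apply: FspanN.
move=> y z [a Fa ->] sz; rewrite mulr_suml; apply: Fspan_sum => // -[i /= is_] _.
rewrite -mulrA; apply: FspanZ => //.
rewrite size_map size_iota in is_; rewrite (nth_map 0%N) ?size_iota //.
rewrite nth_iota // add0n; elim: i {is_} => [|i IHi]; first by rewrite mul1r.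
by rewrite exprS -mulrA; apply: xM.
Qed.

Lemma finite_ext_refl F : is_subfield F -> finite_ext F F.
Proof.
move=> sfF; split=> //; exists [:: 1] => x Fx; exists (fun=> x) => //.
by rewrite big_ord1 mulr1.
Qed.

Lemma finite_ext_adjoin F E L x : finite_ext F E -> is_subfield L ->
  E `<=` L -> L x ->
  exists E', [/\ finite_ext F E', E `<=` E', E' x & E' `<=` L].
Proof.
move=> [sfF sfE FE [s Es]] sfL EL Lx.
(* The degree of [x] over Q is used instead of its degree over [E]: the powers of [x] only have to
   span, not to be independent. *)
have [p [p0 xp]] := minCpoly_expn x; set d := (size p).-1 in p0 xp.
pose t := [seq x ^+ i | i <- iota 0 d].
have tM i : (i < d)%N -> Fspan E t (x ^+ i).
  by move=> id; apply/Fspan_mem/mapP => //; exists i; rewrite ?mem_iota.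
have xd : Fspan E t (x ^+ d).
  rewrite xp; apply: FspanN => //; apply: Fspan_sum => // i _.
  by apply: FspanZ; [|apply: subfield_rat|apply: tM].
have [sfE' EE'] := Fspan_powers_subfield sfE p0 xd.
exists (Fspan E t); split=> //.
- split=> //; first exact: subset_trans EE'.
  exists [seq u * w | u <- s, w <- t] => y [a Ea ->].
  apply: (Fspan_sum sfF) => i _; apply: FspanM => //; first exact/Es.
  exact/Fspan_mem/mem_nth.
- have [d1|d1] := ltnP 1 d; first by rewrite -(expr1 x); apply: tM.
  by rewrite -(expr1 x); move: xd; rewrite (_ : d = 1%N) //;
    apply/eqP; rewrite eqn_leq d1.
- move=> _ [a Ea ->]; apply: subfield_sum => // -[i /= it] _.
  apply: subfieldM => //; first exact: EL.
  rewrite size_map size_iota in it; rewrite (nth_map 0%N) ?size_iota // nth_iota //.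
  elim: (0 + i)%N => [|n IHn]; first exact: subfield1.
  by rewrite exprS; apply: subfieldM.
Qed.

Lemma finite_ext_adjoin_seq F E L s : finite_ext F E -> is_subfield L ->
  E `<=` L -> (forall x, x \in s -> L x) ->
  exists E', [/\ finite_ext F E', E `<=` E', (forall x, x \in s -> E' x) & E' `<=` L].
Proof.
move=> FE sfL; elim: s E FE => [|x s IHs] E FE EL sL;
  first by exists E; split=> // x; rewrite in_nil.
have [|E' [FE' EE' E'x E'L]] := finite_ext_adjoin FE sfL EL (x := x).
  by apply: sL; rewrite inE eqxx.
have [|E2 [FE2 E'E2 sE2 E2L]] := IHs E' FE' E'L.
  by move=> y ys; apply: sL; rewrite inE ys orbT.
exists E2; split=> // [|y]; first exact: subset_trans E'E2.
by rewrite inE => /orP[/eqP->|/sE2//]; apply: E'E2.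
Qed.

Lemma finite_ext_basis F E : finite_ext F E ->
  exists s, (forall x, x \in s -> E x) /\ E `<=` Fspan F s.
Proof.
move=> [sfF sfE FE [s Es]]; apply: (Fspan_inner sfF) Es.
  exact: subfieldB.
by move=> c x Fc Ex; apply: subfieldM => //; apply: FE.
Qed.

Lemma finite_ext_compositum F E1 E2 L : is_subfield L ->
  finite_ext F E1 -> finite_ext F E2 -> E1 `<=` L -> E2 `<=` L ->
  exists E, [/\ finite_ext F E, E1 `<=` E, E2 `<=` E & E `<=` L].
Proof.
move=> sfL FE1 FE2 E1L E2L; have [s [sE2 E2s]] := finite_ext_basis FE2.
have [|E [FE E1E sE EL]] := finite_ext_adjoin_seq FE1 sfL E1L (s := s).
  by move=> x /sE2/E2L.
exists E; split=> // x /E2s[a Fa ->]; case: FE => _ sfE F_E _.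
by apply: subfield_sum => // i _; apply: subfieldM; [|apply: F_E|apply/sE/mem_nth].
Qed.

End FiniteExtensions.

(** * Characters with values in the p-adic integers *)

Lemma modn_inv_cancel (m a u x y : nat) : (a * u = 1 %[mod m] ->
  a * x = a * y %[mod m] -> x = y %[mod m])%N.
Proof.
move=> au axy; rewrite -(mul1n x) -(mul1n y) -modnMml -[in RHS]modnMml -au.
by rewrite !modnMml ![(a * u)%N]mulnC -!mulnA -modnMmr axy modnMmr.
Qed.

Section PadicIntegers.
Variables (p : nat) (p_prime : prime p).
Implicit Types z w : padic_int p.

Lemma residue_modn z m n : (m <= n)%N -> (z n %% p ^ m)%N = z m.
Proof.
move=> /subnKC <-; elim: (n - m)%N => [|j IHj].
  by rewrite addn0 [z m]residueP modn_mod.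
rewrite addnS -IHj [z (m + j)%N]residueP modn_dvdm //.
by rewrite dvdn_exp2l // leq_addr.
Qed.

Lemma residue_small z n : (z n < p ^ n)%N.
Proof. by rewrite residueP ltn_mod expn_gt0 prime_gt0. Qed.

Lemma padic_unit_coprime z n : ~~ (p %| z 1)%N -> coprime (z n) (p ^ n).
Proof.
move=> pz1; case: n => [|n]; first by rewrite expn0 coprimen1.
rewrite coprimeXr // coprime_sym prime_coprime //.
apply: contraNN pz1 => /eqP pz; have := @residue_modn z 1 n.+1 isT.
by rewrite expn1 pz => <-; apply: dvdn0.
Qed.

(** By Euler's theorem z^(phi(p^n) - 1) is an inverse of z modulo p^n. Uniqueness of the quotient
    modulo p^n makes the residues coherent. *)
Lemma padic_unit_div z w : ~~ (p %| z 1)%N ->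
  exists q : padic_int p, forall n, (z n * q n = w n %[mod p ^ n])%N.
Proof.
move=> pz1; have zco n := padic_unit_coprime n pz1.
pose u n := (z n ^ (totient (p ^ n)).-1)%N.
have zu n : (z n * u n = 1 %[mod p ^ n])%N.
  rewrite -expnS prednK ?totient_gt0 ?expn_gt0 ?prime_gt0 //.
  exact: Euler_exp_totient.
pose q n := (w n * u n %% p ^ n)%N.
have zq n : (z n * q n = w n %[mod p ^ n])%N.
  by rewrite modnMmr mulnCA -modnMmr zu modnMmr muln1.
suff qP n : q n = (q n.+1 %% p ^ n)%N by exists (PadicInt qP).
have dv : (p ^ n %| p ^ n.+1)%N by rewrite dvdn_exp2l.
have zq' : (z n * q n.+1 = w n %[mod p ^ n])%N.
  rewrite [z n]residueP [w n]residueP modn_mod modnMml.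
  by have := congr1 (modn^~ (p ^ n)%N) (zq n.+1); rewrite !modn_dvdm.
apply: etrans (_ : q n %% p ^ n = _)%N; first by rewrite modn_mod.
by apply: (modn_inv_cancel (zu n)); rewrite zq zq'.
Qed.

Lemma padic_nat_div z a u : z a = 0%N -> coprime p u ->
  exists w : padic_int p, forall n, (p ^ a * u * w n = z n %[mod p ^ n])%N.
Proof.
move=> za pu; have zdiv n : (p ^ a %| z (n + a))%N.
  by rewrite /dvdn residue_modn ?za // leq_addl.
(* Dividing by [p ^ a] costs [a] digits, hence the shifted index. *)
pose y n := (z (n + a) %/ p ^ a)%N.
have pa0 : (0 < p ^ a)%N by rewrite expn_gt0 prime_gt0.
have yP n : y n = (y n.+1 %% p ^ n)%N.
  apply/eqP; rewrite /y -(eqn_pmul2r pa0) divnK // muln_modl divnK //.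
  by rewrite -expnD residue_modn // addSn.
have cP n : (u %% p ^ n = u %% p ^ n.+1 %% p ^ n)%N.
  by rewrite modn_dvdm // dvdn_exp2l.
have [|w wP] := @padic_unit_div (PadicInt cP) (PadicInt yP).
  by rewrite /= /dvdn expn1 modn_mod -/(dvdn p u) -prime_coprime.
exists w => n; have /= := wP n; rewrite modnMml => wn.
rewrite -mulnA -modnMmr wn modnMmr /y mulnC divnK //.
by rewrite residue_modn ?leq_addr // modn_small ?residue_small.
Qed.

End PadicIntegers.

Section GalOver.
Implicit Types (s t : absGal) (E F L : set algC).

Lemma galMx s t x : (s * t)%g x = s (t x). Proof. by []. Qed.
Lemma galVK s x : (s^-1)%g (s x) = x. Proof. exact: algC_autK. Qed.
Lemma galKV s x : s ((s^-1)%g x) = x. Proof. exact: algC_invautK. Qed.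

Lemma gal_over1 E : gal_over E 1%g. Proof. by []. Qed.

Lemma gal_overM E s t : gal_over E s -> gal_over E t -> gal_over E (s * t)%g.
Proof. by move=> Es Et x Ex; rewrite galMx Et // Es. Qed.

Lemma gal_overV E s : gal_over E s -> gal_over E (s^-1)%g.
Proof. by move=> Es x Ex; rewrite -{1}(Es x Ex) galVK. Qed.

Lemma gal_overX E s n : gal_over E s -> gal_over E (s ^+ n)%g.
Proof.
move=> Es; elim: n => [|n IHn]; first by rewrite expg0; apply: gal_over1.
by rewrite expgS; apply: gal_overM.
Qed.

Lemma gal_overS E F : E `<=` F -> gal_over F `<=` gal_over E.
Proof. by move=> EF s Fs x /EF/Fs. Qed.

(* Pigeonhole on the conjugates of [x]. *)
Lemma gal_orbit_finite x : exists2 n, (0 < n)%N & forall s, (s ^+ n)%g x = x.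
Proof.
have [rs rsE] := closed_field_poly_normal (minCpoly x).
have orb s : s x \in rs.
  move: (root_minCpoly (s x)); rewrite minCpoly_aut rsE rootZ ?root_prod_XsubC //.
  by rewrite lead_coef_eq0 minCpoly_eq0.
(* The period of [x] under [s] is at most the number of conjugates, so the factorial is a multiple
   of it for every [s] at once. *)
exists ((size rs)`!)%N => [|s]; first exact: fact_gt0.
pose orbit := [seq (s ^+ i)%g x | i <- iota 0 (size rs).+1].
have /(uniqPn 0)[i [j [ij]]] : ~~ uniq orbit.
  apply: contraTN (ltnSn (size rs)) => u; rewrite -leqNgt.
  have -> : (size rs).+1 = size orbit by rewrite size_map size_iota.
  by apply: uniq_leq_size => // _ /mapP[i _ ->]; apply: orb.
rewrite size_map size_iota => js.
rewrite !(nth_map 0%N) ?size_iota // ?nth_iota ?(ltn_trans ij) // !add0n.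
rewrite -(subnKC (ltnW ij)) expgnDr galMx => /fmorph_inj/esym fix_x.
have : (j - i %| (size rs)`!)%N.
  by rewrite dvdn_fact // subn_gt0 ij (leq_trans (leq_subr _ _)).
move=> /dvdnP[m ->]; rewrite mulnC expgnA; elim: m => [|m IHm] //.
by rewrite expgS galMx IHm.
Qed.

End GalOver.

(** The condition on the witness in [Zp_extension], named so that a chosen [k] can be carried
    along. *)
Definition Zp_character p d F L (k : absGal -> 'I_d -> padic_int p) :=
  [/\ forall s t i n, gal_over F s -> gal_over F t ->
        k (gal_comp s t) i n = ((k s i n + k t i n) %% p ^ n)%N,
      forall i n, krull_continuous L (gal_over F) (fun s => k s i n),
      forall z : 'I_d -> padic_int p,
        exists2 s, gal_over F s & forall i n, k s i n = z i n
    & forall s, gal_over F s ->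
        (forall i n, k s i n = 0%N) <-> gal_over L s].

Section ZpCharacter.
Variables (p d : nat) (p_prime : prime p) (F L : set algC).
Variables (sfF : is_subfield F) (sfL : is_subfield L) (FL : F `<=` L).
Variables (k : absGal -> 'I_d -> padic_int p) (kP : Zp_character F L k).
Implicit Types (s t : absGal) (E : set algC).
Local Notation G := (gal_over F).

Lemma ZpM s t i n : G s -> G t -> k (s * t)%g i n = ((k s i n + k t i n) %% p ^ n)%N.
Proof. by case: kP => + _ _ _; apply. Qed.

Lemma Zp_ker s : G s -> (forall i n, k s i n = 0%N) <-> gal_over L s.
Proof. by case: kP => _ _ _; apply. Qed.

Lemma Zp_eq0 s i n : gal_over L s -> k s i n = 0%N.
Proof. by move=> Ls; have /Zp_ker[_] := gal_overS FL Ls; apply. Qed.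

Lemma Zp_id i n : k 1%g i n = 0%N. Proof. exact: Zp_eq0. Qed.

Lemma ZpX s i n m : G s -> k (s ^+ m)%g i n = (m * k s i n %% p ^ n)%N.
Proof.
move=> Gs; elim: m => [|m IHm]; first by rewrite expg0 Zp_id mul0n mod0n.
by rewrite expgS ZpM ?IHm ?modnDmr ?mulSn //; apply: gal_overX.
Qed.

Lemma ZpV s i n : G s -> ((k s i n + k (s^-1)%g i n) %% p ^ n = 0)%N.
Proof. by move=> Gs; rewrite -ZpM ?mulgV ?Zp_id //; apply: gal_overV. Qed.

Lemma Zp_inj s t x : G s -> G t -> (forall i n, k s i n = k t i n) ->
  L x -> s x = t x.
Proof.
move=> Gs Gt st Lx; have Gt' := gal_overV Gt.
suff /(_ x Lx) : gal_over L (t^-1 * s)%g.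
  by rewrite galMx => /(congr1 t); rewrite galKV.
apply/Zp_ker; first exact: gal_overM.
by move=> i n; rewrite ZpM // addnC st ZpV.
Qed.

Lemma Zp_comm s t x : G s -> G t -> L x -> s (t x) = t (s x).
Proof.
move=> Gs Gt; apply: (@Zp_inj (s * t)%g (t * s)%g); try exact: gal_overM.
by move=> i n; rewrite !ZpM // addnC.
Qed.

(** This gives continuity of the inverse of [k] without a compactness argument. Some n makes every
    n-th power fix x. With p^m the p-part of n, an element whose coordinates vanish modulo p^m is
    divisible by n in Z_p^d, so it coincides on L with an n-th power. *)
Lemma Zp_open_point x : L x ->
  exists m, forall s, G s -> (forall i, k s i m = 0%N) -> s x = x.
Proof.
move=> Lx; have [n n0 fix_x] := gal_orbit_finite x.
exists (logn p n) => s Gs ks; have [u pu nE] := pfactor_coprime p_prime n0.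
have /all_sig[w wP] i : {w : padic_int p |
    forall j, (p ^ logn p n * u * w j = k s i j %[mod p ^ j])%N}.
  by apply: cid; apply: padic_nat_div.
have [t Gt tw] : exists2 t, G t & forall i j, k t i j = w i j.
  by case: kP => _ _ + _; apply.
rewrite (@Zp_inj s (t ^+ n)%g) //; first exact: gal_overX.
move=> i j; rewrite ZpX // tw nE mulnC [(u * _)%N]mulnC mulnC wP.
by rewrite modn_small // residue_small.
Qed.

Lemma Zp_open E : finite_ext F E -> E `<=` L ->
  exists m, forall s, G s -> (forall i, k s i m = 0%N) -> gal_over E s.
Proof.
move=> /finite_ext_basis[r [rE Er]] EL.
have rP x : x \in r -> exists m, forall s, G s -> (forall i, k s i m = 0%N) -> s x = x.
  by move=> /rE/EL/Zp_open_point.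
have k0S m n s i : (m <= n)%N -> k s i n = 0%N -> k s i m = 0%N.
  by move=> mn kn; rewrite -(residue_modn _ mn) kn mod0n.
suff [m mP] : exists m, forall s, G s -> (forall i, k s i m = 0%N) ->
    {in r, forall x, s x = x}.
  exists m => s Gs ks y /Er[a Fa ->]; rewrite rmorph_sum; apply: eq_bigr => i _.
  by rewrite /= rmorphM /= (Gs _ (Fa i)) (mP s Gs ks) ?mem_nth.
elim: r rP {rE Er} => [|x r IHr] rP; first by exists 0%N.
have [|m1 m1P] := rP x; first by rewrite inE eqxx.
have [|m2 m2P] := IHr; first by move=> y yr; apply: rP; rewrite inE yr orbT.
exists (maxn m1 m2) => s Gs ks y; rewrite inE => /orP[/eqP->|yr].
  by apply: m1P => // i; apply: k0S (ks i); apply: leq_maxl.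
by apply: m2P => // i; apply: k0S (ks i); apply: leq_maxr.
Qed.

Lemma Zp_continuous m : exists E, [/\ finite_ext F E, E `<=` L &
  forall s, gal_over E s -> forall i, k s i m = 0%N].
Proof.
have [_ kC _ _] := kP.
have /all_sig[r rP] i : {r : seq algC | (forall x, x \in r -> L x) /\
    forall t, G t -> {in r, t =1 id} -> k t i m = 0%N}.
  apply: cid; have [r [rL rP]] := kC i m 1%g (@gal_over1 F).
  by exists r; split=> // t Gt tr; rewrite rP ?Zp_id.
have [|E [FE _ rE EL]] := finite_ext_adjoin_seq (finite_ext_refl sfF) sfL FL
    (s := flatten [seq r i | i <- enum 'I_d]).
  by move=> x /flatten_mapP[i _]; have [+ _] := rP i; apply.
exists E; split=> // s Es i; have [_ ->//] := rP i.
  by case: FE => _ _ + _; move=> /gal_overS; apply.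
by move=> x xr; apply/Es/rE/flatten_mapP; exists i; rewrite ?mem_enum.
Qed.

End ZpCharacter.

(** * Sums over the classes of Gal(E/F) *)

Section ClassSums.
Variables (F L : set algC).
Hypothesis abelL : forall s t x, gal_over F s -> gal_over F t -> L x ->
  s (t x) = t (s x).
Hypothesis finE : forall E : finite_sub F L, finite_set (gal_reps E).
Local Notation G := (gal_over F).
Local Notation I := (finite_sub F L).
Implicit Types (E : I) (s t u : absGal).

Lemma finite_sub_base E : F `<=` sval E.
Proof. by case: E => E [[]]. Qed.

Lemma finite_sub_top E : sval E `<=` L.
Proof. by case: E => E []. Qed.

Lemma agree_refl E s : agree E s s. Proof. by []. Qed.

Lemma agree_sym E s t : agree E s t -> agree E t s.
Proof. by move=> st x Ex; rewrite st. Qed.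

Lemma agree_trans E t s u : agree E s t -> agree E t u -> agree E s u.
Proof. by move=> st tu x Ex; rewrite st ?tu. Qed.

Lemma agreeS E E' s t : sval E `<=` sval E' -> agree E' s t -> agree E s t.
Proof. by move=> EE' st x /EE'/st. Qed.

Lemma agreeMl E u s t : agree E s t -> agree E (u * s)%g (u * t)%g.
Proof. by move=> st x Ex; rewrite !galMx st. Qed.

Lemma agree_comm E s t : G s -> G t -> agree E (s * t)%g (t * s)%g.
Proof. by move=> Gs Gt x /finite_sub_top Lx; apply: abelL. Qed.

Lemma agreeMr E u s t : G u -> G s -> G t ->
  agree E s t -> agree E (s * u)%g (t * u)%g.
Proof.
move=> Gu Gs Gt st; apply: agree_trans (agree_comm Gs Gu) _.
exact: agree_trans (agreeMl _ st) (agree_comm Gu Gt).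
Qed.

Lemma agreeMlE E u s t : agree E (u * s)%g t <-> agree E s (u^-1 * t)%g.
Proof.
split=> [/(agreeMl u^-1)%g|/(agreeMl u)]; first by rewrite mulKg.
by rewrite mulVKg.
Qed.

Lemma agreeV E s t : G s -> G t -> agree E s t -> agree E (s^-1)%g (t^-1)%g.
Proof.
move=> Gs Gt /(agreeMl (s^-1)%g); rewrite mulVg => st.
have := agreeMr (gal_overV Gt) (@gal_over1 F) (gal_overM (gal_overV Gs) Gt) st.
by rewrite mul1g mulgK => /agree_sym.
Qed.

Lemma agree_gal_over E s t : G s -> agree E s t <-> gal_over (sval E) (s^-1 * t)%g.
Proof.
move=> Gs; split=> st x Ex; first by rewrite galMx -st // galVK.
by rewrite -[RHS](galKV s) -(galMx (s^-1)%g) st.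
Qed.

Definition gal_rep E s : absGal := xget gal_id [set t | G t /\ agree E s t].

Lemma gal_repP E s : G s -> G (gal_rep E s) /\ agree E s (gal_rep E s).
Proof. by move=> Gs; apply: (@xgetPex _ gal_id [set t | G t /\ agree E s t]); exists s. Qed.

Lemma gal_rep_eq E s t : agree E s t -> gal_rep E s = gal_rep E t.
Proof.
move=> st; congr xget; apply/seteqP; split=> u [Gu su]; split=> //.
  exact: agree_trans (agree_sym st) su.
exact: agree_trans st su.
Qed.

Definition gal_seq E : seq absGal := finmap.enum_fset (fset_set (gal_reps E)).

Lemma gal_seq_uniq E : uniq (gal_seq E).
Proof. exact: finmap.fset_uniq. Qed.

Lemma mem_gal_seq E s : reflect (gal_reps E s) (s \in gal_seq E).
Proof. by rewrite in_fset_set //; apply: asboolP. Qed.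

Lemma gal_seqG E s : s \in gal_seq E -> G s.
Proof. by move=> /mem_gal_seq[t Gt <-]; case: (gal_repP E Gt). Qed.

Lemma gal_rep_seq E s : G s -> gal_rep E s \in gal_seq E.
Proof. by move=> Gs; apply/mem_gal_seq; exists s. Qed.

Lemma gal_rep_id E s : s \in gal_seq E -> gal_rep E s = s.
Proof.
move=> /mem_gal_seq[t Gt <-]; rewrite -/(gal_rep E t).
by apply/esym/gal_rep_eq; have [] := gal_repP E Gt.
Qed.

Lemma gal_seq_agree E s t : s \in gal_seq E -> G t ->
  `[< agree E s t >] = (s == gal_rep E t).
Proof.
move=> sE Gt; apply/asboolP/eqP => [st|->].
  by rewrite -(gal_rep_id sE); apply: gal_rep_eq.
by have [_ /agree_sym] := gal_repP E Gt.
Qed.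

Section Sums.
Variable V : nmodType.
Implicit Types f g : absGal -> V.

Definition class_fun E f := forall s t, G s -> G t -> agree E s t -> f s = f t.

Lemma fsum_gal_reps E f : \sum_(t \in gal_reps E) f t = \sum_(t <- gal_seq E) f t.
Proof. exact: fsbig_finite. Qed.

Lemma fsum_gal_reps_agree E E' s f :
  \sum_(t \in gal_reps E' `&` agree E s) f t =
  \sum_(t <- gal_seq E' | `[< agree E s t >]) f t.
Proof.
by rewrite fsbig_mkcondr fsum_gal_reps [RHS]big_mkcond.
Qed.

Lemma eq_gal_sum E (P : pred absGal) f g : (forall s, G s -> f s = g s) ->
  \sum_(t <- gal_seq E | P t) f t = \sum_(t <- gal_seq E | P t) g t.
Proof.
move=> fg; rewrite big_seq_cond [RHS]big_seq_cond.
by apply: eq_bigr => s /andP[/gal_seqG/fg].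
Qed.

Lemma gal_sum_pick E s f : class_fun E f -> G s ->
  \sum_(t <- gal_seq E | `[< agree E t s >]) f t = f s.
Proof.
move=> cf Gs; rewrite big_seq_cond.
rewrite (eq_bigl (fun t => (t \in gal_seq E) && (t == gal_rep E s))) => [|t]; last first.
  by case: (boolP (t \in _)) => //= tE; apply: gal_seq_agree.
rewrite -big_seq_cond -big_filter filter_pred1_uniq ?gal_seq_uniq ?gal_rep_seq //.
rewrite big_seq1; have [Gr /agree_sym sr] := gal_repP E Gs; exact: cf.
Qed.

Lemma gal_sum_fiber E E' f :
  \sum_(t <- gal_seq E') f t =
  \sum_(s <- gal_seq E) \sum_(t <- gal_seq E' | `[< agree E s t >]) f t.
Proof.
rewrite (exchange_big_dep xpredT) //= big_seq [RHS]big_seq; apply: eq_bigr => t tE'.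
have := @gal_sum_pick E t (fun=> f t) (fun _ _ _ _ _ => erefl) (gal_seqG tE').
by move=> {1}<-.
Qed.

(** Translation by u permutes the classes but not the chosen representatives, which is why f has to
    be constant on classes. *)
Lemma gal_sumM E u f : G u -> class_fun E f ->
  \sum_(t <- gal_seq E) f (u * t)%g = \sum_(t <- gal_seq E) f t.
Proof.
move=> Gu cf.
have -> : \sum_(t <- gal_seq E) f (u * t)%g =
    \sum_(t <- [seq gal_rep E (u * t)%g | t <- gal_seq E]) f t.
  rewrite big_map; apply: eq_gal_sum => t Gt.
  have Gut := gal_overM Gu Gt.
  by have [Gr utr] := gal_repP E Gut; apply: cf.
apply/perm_big/uniq_perm; rewrite ?gal_seq_uniq //.
  rewrite map_inj_in_uniq ?gal_seq_uniq // => s t sE tE.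
  have [Gs Gt] := (gal_seqG sE, gal_seqG tE).
  have [_ sr] := gal_repP E (gal_overM Gu Gs).
  have [_ tr] := gal_repP E (gal_overM Gu Gt).
  move=> e; rewrite e in sr; have := agree_trans sr (agree_sym tr).
  move=> /(agreeMl (u^-1)%g); rewrite !mulKg => /gal_rep_eq.
  by rewrite !gal_rep_id.
move=> t; apply/mapP/idP => [[s /gal_seqG Gs ->]|tE].
  exact/gal_rep_seq/gal_overM.
have Gt := gal_seqG tE; have Gut := gal_overM (gal_overV Gu) Gt.
exists (gal_rep E (u^-1 * t)%g); first exact: gal_rep_seq.
have [_ r] := gal_repP E Gut; rewrite -[LHS](gal_rep_id tE).
by apply: gal_rep_eq; rewrite -{1}(mulVKg u t); apply: agreeMl.
Qed.

End Sums.
End ClassSums.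

(** * Iwasawa algebras *)

Section IwasawaAlgebra.
Variables (O : comNzRingType) (F L : set algC).
Hypothesis abelL : forall s t x, gal_over F s -> gal_over F t -> L x ->
  s (t x) = t (s x).
Hypothesis finE : forall E : finite_sub F L, finite_set (gal_reps E).
Local Notation G := (gal_over F).
Local Notation I := (finite_sub F L).
Local Notation iw := (@iwasawa_algebra O F L).
Implicit Types (E : I) (s t u g h : absGal) (x y : I -> absGal -> O).

Lemma iw_out x E s : iw x -> ~ G s -> x E s = 0.
Proof. by case=> + _ _; apply. Qed.

Lemma iw_class x E : iw x -> class_fun E (x E).
Proof. by case=> _ + _; apply. Qed.

Lemma iw_compat x E E' s : iw x -> sval E `<=` sval E' -> G s ->
  x E s = \sum_(t <- gal_seq E' | `[< agree E s t >]) x E' t.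
Proof.
by case=> _ _ + EE' Gs; rewrite -fsum_gal_reps_agree //; apply.
Qed.

Lemma iw_intro x : (forall E s, ~ G s -> x E s = 0) ->
  (forall E, class_fun E (x E)) ->
  (forall E E' s, sval E `<=` sval E' -> G s ->
    x E s = \sum_(t <- gal_seq E' | `[< agree E s t >]) x E' t) -> iw x.
Proof.
move=> xo xc xE; split=> // E E' s EE' Gs.
by rewrite (fsum_gal_reps_agree finE); apply: xE.
Qed.

Lemma iw_ext x y : iw x -> iw y -> (forall E s, G s -> x E s = y E s) -> x = y.
Proof.
move=> ix iy xy; apply/funext => E; apply/funext => s.
by have [/xy//|Gs] := pselect (G s); rewrite !iw_out.
Qed.

(** An element of the Iwasawa algebra is a measure on Gal(L/F); the integral of a step function of
    level E may be computed at any finer level. *)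
Lemma iw_int x E E' f : iw x -> sval E `<=` sval E' -> class_fun E f ->
  \sum_(t <- gal_seq E') x E' t * f t = \sum_(t <- gal_seq E) x E t * f t.
Proof.
move=> ix EE' cf; rewrite (gal_sum_fiber finE E); apply: eq_gal_sum => // s Gs.
rewrite (iw_compat ix EE' Gs) mulr_suml big_seq_cond [RHS]big_seq_cond.
by apply: eq_bigr => t /andP[/(gal_seqG finE) Gt /asboolP/cf->] //; apply: Gt.
Qed.

Lemma iw_sub x y : iw x -> iw y -> iw (x - y).
Proof.
move=> ix iy; apply: iw_intro => [E s Gs|E s t Gs Gt st|E E' s EE' Gs].
- by rewrite !fctE !iw_out // subrr.
- by rewrite !fctE (iw_class ix Gs Gt st) (iw_class iy Gs Gt st).
- by rewrite !fctE (iw_compat ix EE' Gs) (iw_compat iy EE' Gs) -sumrB.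
Qed.

Lemma iw0 : iw 0.
Proof.
apply: iw_intro => // E E' s _ _.
by rewrite big1.
Qed.

Lemma iw_scale (c : O) x : iw x -> iw (fun E s => c * x E s).
Proof.
move=> ix; apply: iw_intro => [E s Gs|E s t Gs Gt st|E E' s EE' Gs].
- by rewrite iw_out // mulr0.
- by rewrite (iw_class ix Gs Gt st).
- by rewrite (iw_compat ix EE' Gs) mulr_sumr.
Qed.

(** The group element g inside O[[Gal(L/F)]], that is, the Dirac measure at g. *)
Definition iw_delta g : I -> absGal -> O :=
  fun E s => (`[< G s /\ agree E s g >])%:R.

Lemma iw_deltaE g E s : G s -> iw_delta g E s = (`[< agree E s g >])%:R.
Proof. by move=> Gs; congr (nat_of_bool _)%:R; apply: asbool_equiv_eq; split=> [[]|]. Qed.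

Lemma class_fun_agree E E' g : sval E `<=` sval E' ->
  class_fun E' (fun s => (`[< agree E s g >])%:R : O).
Proof.
move=> EE' s t Gs Gt /(agreeS EE') st; congr (nat_of_bool _)%:R.
apply: asbool_equiv_eq; split; apply: agree_trans => //.
exact: agree_sym.
Qed.

Lemma iw_delta_iw g : G g -> iw (iw_delta g).
Proof.
move=> Gg; apply: iw_intro => [E s Gs|E s t Gs Gt st|E E' s EE' Gs].
- by rewrite /iw_delta asboolF // => -[].
- rewrite !iw_deltaE //; exact: class_fun_agree st.
- rewrite iw_deltaE //; have := @class_fun_agree E E' s EE'.
  move=> /(gal_sum_pick finE) /(_ Gg).
  have -> : `[< agree E g s >] = `[< agree E s g >].
    by apply: asbool_equiv_eq; split=> /agree_sym.
  move=> <-; rewrite [LHS]big_mkcond [RHS]big_mkcond; apply: eq_gal_sum => // t Gt.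
  rewrite iw_deltaE //.
  have -> : `[< agree E t s >] = `[< agree E s t >].
    by apply: asbool_equiv_eq; split=> /agree_sym.
  by case: `[< agree E' t g >]; case: `[< agree E s t >].
Qed.

Lemma iw_one_delta : @iwasawa_one O F L = iw_delta 1%g.
Proof.
apply/funext => E; apply/funext => s.
by rewrite /iwasawa_one /iw_delta -[1%g]/gal_id; case: `[< _ >].
Qed.

Lemma iw_mulE x y E s : G s ->
  iwasawa_mul x y E s = \sum_(t <- gal_seq E) x E t * y E (t^-1 * s)%g.
Proof. by move=> Gs; rewrite /iwasawa_mul asboolT // fsum_gal_reps. Qed.

Lemma class_fun_div y E s : iw y -> G s -> class_fun E (fun t => y E (t^-1 * s)%g).
Proof.
move=> iy Gs t t' Gt Gt' tt'; apply: (iw_class iy).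
- exact/gal_overM/Gs/gal_overV.
- exact/gal_overM/Gs/gal_overV.
- by apply: (agreeMr abelL) => //; [exact: gal_overV|exact: gal_overV|apply: agreeV].
Qed.

Lemma iw_mul x y : iw x -> iw y -> iw (iwasawa_mul x y).
Proof.
move=> ix iy; apply: iw_intro => [E s Gs|E s t Gs Gt st|E E' s EE' Gs].
- by rewrite /iwasawa_mul asboolF.
- rewrite !iw_mulE //; apply: eq_gal_sum => // u Gu; congr (_ * _).
  by apply: (iw_class iy); [exact/gal_overM/Gs/gal_overV|
    exact/gal_overM/Gt/gal_overV|exact: agreeMl].
(* The first factor is integrated at the finer level, then the second is expanded over the fibre of
   t^-1 s, which translation by t turns into the fibre of s. *)
rewrite iw_mulE // -(iw_int ix EE' (class_fun_div iy Gs)).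
pose f t s' := x E' t * y E' (t^-1 * s')%g.
transitivity (\sum_(t <- gal_seq E') \sum_(s' <- gal_seq E' | `[< agree E s s' >]) f t s').
  apply: eq_gal_sum => // t Gt; rewrite -mulr_sumr; congr (_ * _).
  have Gts : G (t^-1 * s)%g by apply/gal_overM/Gs/gal_overV.
  rewrite (iw_compat iy EE' Gts) big_mkcond [RHS]big_mkcond.
  rewrite -[RHS](gal_sumM finE Gt) => [|u v Gu Gv uv].
    apply: eq_gal_sum => // u Gu; rewrite mulKg.
    suff -> : `[< agree E (t^-1 * s)%g u >] = `[< agree E s (t * u)%g >] by [].
    by apply: asbool_equiv_eq; rewrite agreeMlE invgK.
  have -> : `[< agree E s u >] = `[< agree E s v >].
    apply: asbool_equiv_eq; move/(agreeS EE') in uv.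
    by split=> /agree_trans; apply=> //; apply: agree_sym.
  case: ifP => // _; apply: (iw_class iy); last exact: agreeMl.
    exact/gal_overM/Gu/gal_overV.
  exact/gal_overM/Gv/gal_overV.
rewrite exchange_big /=; apply: eq_gal_sum => // s' Gs'.
by rewrite iw_mulE.
Qed.

Lemma iw_mulBr x y z : iwasawa_mul x (y - z) = iwasawa_mul x y - iwasawa_mul x z.
Proof.
apply/funext => E; apply/funext => s; rewrite !fctE.
have [Gs|Gs] := pselect (G s); last by rewrite /iwasawa_mul asboolF // subr0.
by rewrite !iw_mulE // -sumrB; apply: eq_bigr => t _; rewrite mulrBr.
Qed.

Definition iw_shift g x : I -> absGal -> O := fun E s => x E (g^-1 * s)%g.

Lemma gal_over_mull g s : G g -> G (g^-1 * s)%g -> G s.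
Proof. by move=> Gg Ggs; rewrite -(mulVKg g s); apply: gal_overM. Qed.

Lemma iw_shift_iw g x : G g -> iw x -> iw (iw_shift g x).
Proof.
move=> Gg ix; have Ggs s (Gs : G s) := gal_overM (gal_overV Gg) Gs.
apply: iw_intro => [E s Gs|E s t Gs Gt st|E E' s EE' Gs].
- by rewrite /iw_shift iw_out // => /(gal_over_mull Gg).
- by apply: (iw_class ix); [exact: Ggs|exact: Ggs|exact: agreeMl].
rewrite /iw_shift (iw_compat ix EE') ?[LHS]big_mkcond ?[RHS]big_mkcond; last exact: Ggs.
rewrite -[RHS](gal_sumM finE Gg) => [|u v Gu Gv uv].
  apply: eq_gal_sum => // u Gu; rewrite mulKg.
  suff -> : `[< agree E (g^-1 * s)%g u >] = `[< agree E s (g * u)%g >] by [].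
  by apply: asbool_equiv_eq; rewrite agreeMlE invgK.
have -> : `[< agree E s u >] = `[< agree E s v >].
  apply: asbool_equiv_eq; move/(agreeS EE') in uv.
  by split=> /agree_trans; apply=> //; apply: agree_sym.
case: ifP => // _; apply: (iw_class ix); last exact: agreeMl.
  exact: Ggs.
exact: Ggs.
Qed.

Lemma iw_mul_delta g x : G g -> iw x -> iwasawa_mul x (iw_delta g) = iw_shift g x.
Proof.
move=> Gg ix; have id := iw_delta_iw Gg.
apply: iw_ext => [||E s Gs]; [exact: iw_mul|exact: iw_shift_iw|].
have Ggs := gal_overM (gal_overV Gg) Gs.
rewrite iw_mulE // /iw_shift -(gal_sum_pick finE (iw_class ix) Ggs) [RHS]big_mkcond.
apply: eq_gal_sum => // t Gt; rewrite iw_deltaE; last exact/gal_overM/Gs/gal_overV.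
have -> : `[< agree E (t^-1 * s)%g g >] = `[< agree E t (g^-1 * s)%g >].
  apply: asbool_equiv_eq; rewrite agreeMlE invgK; split=> [st|/(agreeMl g)].
    apply: agree_sym; rewrite agreeMlE invgK; apply: agree_trans st _.
    exact: (agree_comm abelL).
  rewrite mulVKg => gt; apply: agree_sym; apply: agree_trans gt.
  exact: (agree_comm abelL).
by case: ifP; rewrite ?mulr1 ?mulr0.
Qed.

(** Multiplication by h - 1 (see [iw_diff_mul]), in a form that acts separately at each level. *)
Definition iw_diff h x := iw_shift h x - x.

Lemma iw_diffE h x E s : iw_diff h x E s = x E (h^-1 * s)%g - x E s.
Proof. by []. Qed.

Lemma iw_diff_iw h x : G h -> iw x -> iw (iw_diff h x).
Proof. by move=> Gh ix; apply: iw_sub => //; apply: iw_shift_iw. Qed.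

Lemma iw_diff_mul h x : G h -> iw x ->
  iw_diff h x = iwasawa_mul x (iw_delta h - @iwasawa_one O F L).
Proof.
move=> Gh ix; rewrite iw_mulBr iw_one_delta !iw_mul_delta //.
rewrite /iw_diff; congr (_ - _); apply/funext => E; apply/funext => s.
by rewrite /iw_shift invg1 mul1g.
Qed.

Lemma iw_mul_diffl h x y : G h -> iw x -> iw y ->
  iwasawa_mul (iw_diff h x) y = iw_diff h (iwasawa_mul x y).
Proof.
move=> Gh ix iy; have iD := iw_diff_iw Gh ix; have iM := iw_mul ix iy.
apply: iw_ext => [||E s Gs]; [exact: iw_mul|exact: iw_diff_iw|].
have Ghs := gal_overM (gal_overV Gh) Gs.
rewrite iw_diffE !iw_mulE //; under eq_bigr do rewrite iw_diffE mulrBl.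
rewrite sumrB; congr (_ - _); rewrite -(gal_sumM finE Gh).
  by apply: eq_gal_sum => // t Gt; rewrite mulKg invgM mulgA.
move=> u v Gu Gv uv; congr (_ * _); last exact: class_fun_div uv.
by apply: (iw_class ix) (agreeMl _ uv); apply: gal_overM (gal_overV Gh) _.
Qed.

Lemma iw_mul_diffr h x y : G h -> iw x -> iw y ->
  iwasawa_mul x (iw_diff h y) = iw_diff h (iwasawa_mul x y).
Proof.
move=> Gh ix iy; have iD := iw_diff_iw Gh iy; have iM := iw_mul ix iy.
apply: iw_ext => [||E s Gs]; [exact: iw_mul|exact: iw_diff_iw|].
have Gh' := gal_overV Gh; have Ghs := gal_overM Gh' Gs.
rewrite iw_diffE !iw_mulE // -sumrB; apply: eq_gal_sum => // t Gt.
rewrite iw_diffE mulrBr; congr (_ * _ - _); have Gt' := gal_overV Gt.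
rewrite !mulgA; apply: (iw_class iy); try by do 2?apply: gal_overM.
by apply: (agreeMr abelL) => //; try exact: gal_overM; apply: (agree_comm abelL).
Qed.

End IwasawaAlgebra.

(** * Division by h - 1 in an Iwasawa algebra *)

(** Modelled on the elements of valuation at least n in a complete valuation ring. Multiplication by
    p raises the index by at least one, which leaves room for ramification. *)
Record adic_filtration (p : nat) (O : comNzRingType) := AdicFiltration {
  fil :> nat -> set O;
  fil_all : forall x, fil 0 x;
  filB : forall n x y, fil n x -> fil n y -> fil n (x - y);
  filM : forall n x y, fil n y -> fil n (x * y);
  filS : forall n x, fil n.+1 x -> fil n x;
  fil_p : forall n x, fil n x -> fil n.+1 (p%:R * x);
  fil_sep : forall x, (forall n, fil n x) -> x = 0;
  fil_complete : forall u : nat -> O, (forall n, fil n (u n.+1 - u n)) ->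
    exists l, forall n, fil n (u n - l) }.

Section AdicLimits.
Variables (p : nat) (O : comNzRingType) (J : adic_filtration p O).
Implicit Types (u w : nat -> O).

Lemma fil0 n : J n 0.
Proof.
elim: n => [|n /fil_p]; first exact: fil_all.
by rewrite mulr0.
Qed.

Lemma filN n x : J n x -> J n (- x).
Proof. by move=> Jx; rewrite -sub0r; apply: filB => //; apply: fil0. Qed.

Lemma filD n x y : J n x -> J n y -> J n (x + y).
Proof. by move=> Jx Jy; rewrite -[y]opprK; apply/filB/filN. Qed.

Lemma fil_le m n x : (m <= n)%N -> J n x -> J m x.
Proof.
move=> /subnKC <-; elim: (n - m)%N => [|i IHi]; first by rewrite addn0.
by rewrite addnS => /filS.
Qed.

Lemma fil_pX m n x : J n x -> J (m + n)%N ((p ^ m)%:R * x).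
Proof.
move=> Jx; elim: m => [|m IHm]; first by rewrite expn0 mul1r.
by rewrite expnS natrM -mulrA; apply: fil_p.
Qed.

Lemma fil_natX m n : J m (p ^ m * n)%:R.
Proof. by rewrite natrM -[m in J m]addn0; apply/fil_pX/fil_all. Qed.

Lemma fil_sum n (I : Type) (r : seq I) (P : pred I) (f : I -> O) :
  (forall i, P i -> J n (f i)) -> J n (\sum_(i <- r | P i) f i).
Proof. by apply: big_ind; [apply: fil0|move=> *; apply: filD]. Qed.

Definition adic_lim u l := forall n, exists m0, forall m, (m0 <= m)%N -> J n (u m - l).

Lemma adic_lim_cauchy u N : (forall m, (N <= m)%N -> J (m - N)%N (u m.+1 - u m)) ->
  exists l, adic_lim u l.
Proof.
move=> uC; have [n|l lP] := fil_complete (a := J) (u := fun n => u (n + N)%N).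
  by have := uC (n + N)%N (leq_addl _ _); rewrite addnK addSn.
exists l => n; exists (n + N)%N => m nm.
have Nm : (N <= m)%N by apply: leq_trans nm; apply: leq_addl.
by have := lP (m - N)%N; rewrite subnK //; apply: fil_le; rewrite leq_subRL // addnC.
Qed.

Lemma adic_lim_unique u l l' : adic_lim u l -> adic_lim u l' -> l = l'.
Proof.
move=> ul ul'; apply/eqP; rewrite -subr_eq0; apply/eqP/(fil_sep (a := J)) => n.
have [m1 m1P] := ul n; have [m2 m2P] := ul' n; pose m := maxn m1 m2.
rewrite (_ : l - l' = (u m - l') - (u m - l)); last by rewrite opprB [RHS]addrC addrA subrK.
by apply: filB; [apply/m2P/leq_maxr|apply/m1P/leq_maxl].
Qed.

Lemma adic_lim_near u w l : (exists m0, forall m, (m0 <= m)%N -> u m = w m) ->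
  adic_lim u l -> adic_lim w l.
Proof.
move=> [m0 uw] ul n; have [m1 m1P] := ul n; exists (maxn m0 m1) => m.
by rewrite geq_max => /andP[/uw <- /m1P].
Qed.

Lemma adic_lim_cst l : adic_lim (fun=> l) l.
Proof. by move=> n; exists 0%N => m _; rewrite subrr; apply: fil0. Qed.

Lemma adic_limB u w l l' : adic_lim u l -> adic_lim w l' ->
  adic_lim (fun m => u m - w m) (l - l').
Proof.
move=> ul wl n; have [m1 m1P] := ul n; have [m2 m2P] := wl n.
exists (maxn m1 m2) => m; rewrite geq_max => /andP[/m1P um /m2P wm].
by rewrite opprB [l' - l]addrC addrACA [- w m + _]addrC -[l' - w m]opprB; apply: filB.
Qed.

Lemma adic_limD u w l l' : adic_lim u l -> adic_lim w l' ->
  adic_lim (fun m => u m + w m) (l + l').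
Proof.
move=> ul wl n; have [m1 m1P] := ul n; have [m2 m2P] := wl n.
exists (maxn m1 m2) => m; rewrite geq_max => /andP[/m1P um /m2P wm].
by rewrite opprD addrACA; apply: filD.
Qed.

Lemma adic_lim_sum (I : Type) (r : seq I) (P : pred I) (f : I -> nat -> O) g :
  (forall i, P i -> adic_lim (f i) (g i)) ->
  adic_lim (fun m => \sum_(i <- r | P i) f i m) (\sum_(i <- r | P i) g i).
Proof.
move=> fg; elim: r => [|i r IHr].
  by rewrite big_nil; apply: adic_lim_near (adic_lim_cst 0); exists 0%N => m; rewrite big_nil.
rewrite big_cons; case: ifP => Pi.
  by apply: adic_lim_near (adic_limD (fg i Pi) IHr); exists 0%N => m; rewrite big_cons Pi.
by apply: adic_lim_near IHr; exists 0%N => m; rewrite big_cons Pi.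
Qed.

End AdicLimits.

Lemma sum_periodic (Q : nat -> nat) r a : (forall i, Q (i + r)%N = Q i) ->
  (\sum_(i < a * r) Q i = a * \sum_(i < r) Q i)%N.
Proof.
move=> Qr; elim: a => [|a IHa]; first by rewrite mul0n big_ord0.
rewrite !mulSn addnC -IHa -(big_mkord xpredT) (big_cat_nat (n := a * r)%N) ?leq_addr //=.
rewrite big_mkord addnC; congr (_ + _)%N.
rewrite -{1}[(a * r)%N]add0n -addnC -addnC big_addn addKn big_mkord.
apply: eq_bigr => i _; elim: a {IHa} => [|a IHa]; first by rewrite addn0.
by rewrite mulSn addnCA addnC Qr.
Qed.

Section PolyAction.
Variables (O : comNzRingType) (h : absGal) (f : absGal -> O).
Implicit Types (q r : {poly O}) (s : absGal).

(* The value at [s] of [f] acted on by [q], where 'X acts as the shift by [h]. *)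
Definition shift_eval (q : {poly O}) s := \sum_(i < size q) q`_i * f (h ^- i * s)%g.

Lemma shift_evalE n (q : {poly O}) s : (size q <= n)%N -> shift_eval q s = \sum_(i < n) q`_i * f (h ^- i * s)%g.
Proof.
move=> qn; rewrite /shift_eval (big_ord_widen n (fun i => q`_i * f (h ^- i * s)%g)) // big_mkcond.
apply: eq_bigr => i _; case: ltnP => // qi.
by rewrite nth_default ?mul0r.
Qed.

Lemma shift_evalD q r s : shift_eval (q + r) s = shift_eval q s + shift_eval r s.
Proof.
pose n := maxn (size q) (size r).
rewrite !(shift_evalE (n := n)) ?leq_maxl ?leq_maxr ?size_polyD // -big_split.
by apply: eq_bigr => i _; rewrite coefD mulrDl.
Qed.

Lemma shift_evalZ c q s : shift_eval (c *: q) s = c * shift_eval q s.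
Proof.
rewrite (shift_evalE (n := size q)) ?size_scale_leq // mulr_sumr.
by apply: eq_bigr => i _; rewrite coefZ mulrA.
Qed.

Lemma shift_evalB q r s : shift_eval (q - r) s = shift_eval q s - shift_eval r s.
Proof. by rewrite -scaleN1r shift_evalD shift_evalZ mulN1r. Qed.

Lemma shift_evalXM q s : shift_eval ('X * q) s = shift_eval q (h^-1 * s)%g.
Proof.
rewrite (shift_evalE (n := (size q).+1)); last first.
  by rewrite mulrC; apply: leq_trans (size_polyMleq _ _) _; rewrite size_polyX addn2.
rewrite big_ord_recl coefXM mul0r add0r; apply: eq_bigr => i _.
by rewrite coefXM -[nat_of_ord (lift ord0 i)]/i.+1 expgS invgM -mulgA.
Qed.

Lemma shift_evalXnM n q s : shift_eval ('X^n * q) s = shift_eval q (h ^- n * s)%g.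
Proof.
elim: n s => [|n IHn] s; first by rewrite expg0 invg1 !mul1g mul1r.
by rewrite exprS -mulrA shift_evalXM IHn expgS invgM -mulgA.
Qed.

End PolyAction.

(** From i C(p^n, i) = p^n C(p^n - 1, i - 1): if the binomial were prime to p, then p^n would divide
    i. *)
Lemma prime_dvd_binX p n i : prime p -> (0 < i < p ^ n)%N -> (p %| 'C(p ^ n, i))%N.
Proof.
case: i => // i p_prime ip; apply: contraLR (ip) => pC.
rewrite /= -leqNgt; apply: dvdn_leq => //.
rewrite -(@Gauss_dvdl _ _ 'C(p ^ n, i.+1)) ?coprimeXl ?prime_coprime //.
by rewrite -mul_bin_diag dvdn_mulr.
Qed.

Lemma frobenius_XsubC1 (O : comNzRingType) p n : prime p -> odd p ->
  exists r : {poly O}, ('X - 1) ^+ (p ^ n) = 'X^(p ^ n) - 1 + p%:R *: r.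
Proof.
move=> p_prime p_odd; have pn0 : (0 < p ^ n)%N by rewrite expn_gt0 prime_gt0.
pose m := (p ^ n).-1; have mE : (p ^ n)%N = m.+1 by rewrite /m prednK.
pose c i : nat := ('C(p ^ n, i) %/ p)%N.
exists (\sum_(i < m) ((-1) ^+ i.+1 * 'X^(m - i)) *+ c i.+1).
rewrite exprBn mE big_ord_recl big_ord_recr /= -mE.
rewrite !expr0 mulr1 mul1r subn0 bin0 mulr1n expr1n mulr1 /bump /= add1n -mE.
rewrite -signr_odd oddX p_odd orbT expr1 subnn expr0 mulr1 binn mulr1n.
rewrite [X in _ + X]addrC addrA; congr (_ + _); rewrite scaler_sumr.
apply: eq_bigr => i _; have im := ltn_ord i.
have /divnK pc : (p %| 'C(p ^ n, i.+1))%N.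
  by apply: prime_dvd_binX => //; rewrite mE /= ltnS.
rewrite add1n expr1n mulr1 -[in LHS]pc mulrnA [in (p ^ n - _)%N]mE subSS.
by rewrite -scaler_nat.
Qed.

(** * Division by h - 1, for a topological generator h of Gal(L/M) *)

Section Tower.
Variables (p : nat) (p_prime : prime p) (O : comNzRingType).
Variables (J : adic_filtration p O) (F M L : set algC).
Hypothesis abelL : forall s t x, gal_over F s -> gal_over F t -> L x ->
  s (t x) = t (s x).
Hypothesis finE : forall E : finite_sub F L, finite_set (gal_reps E).
Hypothesis dirL : forall E1 E2 : finite_sub F L, exists E : finite_sub F L,
  sval E1 `<=` sval E /\ sval E2 `<=` sval E.
Local Notation G := (gal_over F).
Local Notation I := (finite_sub F L).
Local Notation iw := (@iwasawa_algebra O F L).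
(** [kap] is a p-adic coordinate on Gal(L/F) taking the value 1 at [h]. The hypothesis [h_fiber]
    says that [h] generates Gal(L/M) topologically, the exponent being read off by [kap]. The
    section serves twice: for the Z_p-extension inside the Z_p^2-extension, and for F inside the
    Z_p-extension. *)
Variables (h : absGal) (Gh : G h) (kap : absGal -> nat -> nat).
Hypothesis kap_lt : forall s n, (kap s n < p ^ n)%N.
Hypothesis kapS : forall s n, kap s n = (kap s n.+1 %% p ^ n)%N.
Hypothesis kapM : forall s t n, G s -> G t ->
  kap (s * t)%g n = ((kap s n + kap t n) %% p ^ n)%N.
Hypothesis kap_h : forall n, kap h n = (1 %% p ^ n)%N.
Hypothesis kap_open : forall n, exists E : I,
  forall s, gal_over (sval E) s -> kap s n = 0%N.
Hypothesis h_torsion : forall E : I, exists n, agree E (h ^+ (p ^ n))%g 1%g.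
Hypothesis h_fiber : forall E : I, exists n, forall m, (n <= m)%N ->
  exists2 E1 : I, sval E1 `<=` M &
    forall s, gal_over (sval E1) s -> agree E s (h ^+ kap s m)%g.
Implicit Types (E : I) (s t u g b : absGal) (x y a : I -> absGal -> O).

Lemma tower_baseG t n : G t -> G (h ^- n * t)%g.
Proof. by move=> Gt; apply/gal_overM/Gt/gal_overV/gal_overX. Qed.

Lemma agreeX1 E g n : agree E g 1%g -> agree E (g ^+ n)%g 1%g.
Proof.
move=> g1; elim: n => [|n IHn]; first by rewrite expg0; apply: agree_refl.
by rewrite expgS; apply: agree_trans (agreeMl g IHn) _; rewrite mulg1.
Qed.

Lemma agree1M E g t : G g -> G t -> agree E g 1%g -> agree E (g * t)%g t.
Proof. by move=> Gg Gt /(agreeMr abelL Gt Gg (@gal_over1 F)); rewrite mul1g. Qed.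

(** The coordinate modulo p^m factors through Gal(E/F). *)
Definition level m E := forall s, gal_over (sval E) s -> kap s m = 0%N.

Lemma level_kap m E s t : level m E -> G s -> G t -> agree E s t -> kap s m = kap t m.
Proof.
move=> lE Gs Gt /(agree_gal_over _ _ Gs) st; rewrite -[t in RHS](mulVKg s) kapM //.
  by rewrite (lE _ st) addn0 modn_small.
exact/gal_overM/Gt/gal_overV.
Qed.

Lemma levelS m E E' : sval E `<=` sval E' -> level m E -> level m E'.
Proof. by move=> EE' lE s /(gal_overS EE')/lE. Qed.

Lemma level_pred m E : level m.+1 E -> level m E.
Proof. by move=> lE s /lE ks; rewrite kapS ks mod0n. Qed.

Lemma level_above m E : exists E', sval E `<=` sval E' /\ level m E'.
Proof.
have [E0 lE0] := kap_open m; have [E' [E0E' EE']] := dirL E0 E.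
by exists E'; split=> //; apply: levelS lE0.
Qed.

Definition hits E s m t i := `[< agree E (h ^+ i * (h ^- kap t m * t))%g s >].

(** With n = [kap t m] and t0 = h^-n t, this is the coefficient at s of 1 + h + ... + h^(n-1)
    applied to t0, the quotient of t - t0 by h - 1. *)
Definition hit_count E s m t := (\sum_(i < kap t m) hits E s m t i)%N.

Lemma hits_kap E s m t : hits E s m t (kap t m) = `[< agree E t s >].
Proof. by rewrite /hits mulVKg. Qed.

Lemma agree_period E s b n i j : G b -> agree E (h ^+ (p ^ n))%g 1%g ->
  `[< agree E (h ^+ (i + j * p ^ n) * b)%g s >] = `[< agree E (h ^+ i * b)%g s >].
Proof.
move=> Gb hn; rewrite expgnDr -mulgA; have Gh' : G (h ^+ (j * p ^ n))%g by apply: gal_overX.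
have hb : agree E (h ^+ i * (h ^+ (j * p ^ n) * b))%g (h ^+ i * b)%g.
  by apply/agreeMl/agree1M => //; rewrite mulnC expgnA; apply: agreeX1.
apply: asbool_equiv_eq; split; apply: agree_trans => //.
exact: agree_sym.
Qed.

Lemma hits_period E s m t n i j : G t -> agree E (h ^+ (p ^ n))%g 1%g ->
  hits E s m t (i + j * p ^ n)%N = hits E s m t i.
Proof. by move=> Gt; apply/agree_period/tower_baseG. Qed.

Lemma hit_count_class E E' s m : sval E `<=` sval E' -> level m E' ->
  class_fun E' (hit_count E s m).
Proof.
move=> EE' lE t t' Gt Gt' tt'; rewrite /hit_count -(level_kap lE Gt Gt' tt').
apply: eq_bigr => i _; congr nat_of_bool; rewrite /hits -(level_kap lE Gt Gt' tt').
apply: asbool_equiv_eq; have {}tt' := agreeMl (h ^+ i * h ^- kap t m)%g (agreeS EE' tt').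
by rewrite -!mulgA in tt'; split; apply: agree_trans; rewrite // => x Ex; rewrite tt'.
Qed.

(* Passing from [m] to [m.+1] prolongs the range of the count by a multiple of
   [p ^ m], hence by a multiple of the period. *)
Lemma hit_count_next E s m n t : G t -> agree E (h ^+ (p ^ n))%g 1%g -> (n <= m)%N ->
  exists w, hit_count E s m.+1 t = (hit_count E s m t + p ^ (m - n) * w)%N.
Proof.
move=> Gt hn nm; pose y := kap t m; pose j := (kap t m.+1 %/ p ^ m)%N.
have yE : kap t m.+1 = (y + j * p ^ (m - n) * p ^ n)%N.
  by rewrite -mulnA -expnD subnK // /y (kapS t m) addnC -divn_eq.
have hE i : hits E s m.+1 t i = hits E s m t i.
  have Gb := tower_baseG (kap t m.+1) Gt.
  rewrite /hits -(agree_period s i (j * p ^ (m - n)) Gb hn) yE.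
  by rewrite expgnDr [in (_ ^- (_ + _))%g]expgnDr invgM -!mulgA mulVKg.
exists (j * \sum_(i < p ^ n) hits E s m t (i + y))%N.
rewrite /hit_count yE -(big_mkord xpredT (fun i => nat_of_bool (hits E s m.+1 t i))).
rewrite (big_cat_nat (n := y)) ?leq_addr //= big_mkord.
rewrite (eq_bigr (fun i : 'I_y => nat_of_bool (hits E s m t i))) => [|i _]; last by rewrite hE.
congr (_ + _)%N; rewrite -{1}[y]add0n big_addn addKn big_mkord mulnCA mulnA.
rewrite -(@sum_periodic (fun i => nat_of_bool (hits E s m t (i + y)))).
  by apply: eq_bigr => i _; rewrite hE.
by move=> i; rewrite addnAC -[(p ^ n)%N in LHS]mul1n hits_period.
Qed.

(** Replacing t by h t prolongs the orbit by one step, except when the coordinate wraps around from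
    p^m - 1 to 0. Then p^(m-n) full periods disappear, which is the error term. *)
Lemma hit_count_mul E s m n t : G t -> agree E (h ^+ (p ^ n))%g 1%g -> (n <= m)%N ->
  exists w, (hit_count E s m t + `[< agree E t s >] =
             hit_count E s m (h * t)%g + p ^ (m - n) * w)%N.
Proof.
move=> Gt hn nm; pose y := kap t m.
have -> : (hit_count E s m t + `[< agree E t s >] = \sum_(i < y.+1) hits E s m t i)%N.
  by rewrite big_ord_recr /= hits_kap.
have khE : kap (h * t)%g m = (y.+1 %% p ^ m)%N by rewrite kapM // kap_h modnDml.
have := kap_lt t m; rewrite -/y leq_eqVlt => /orP[/eqP ym|ym].
  exists (\sum_(i < p ^ n) hits E s m t i)%N.
  rewrite /hit_count khE ym modnn big_ord0 add0n.
  rewrite -(@sum_periodic (fun i => nat_of_bool (hits E s m t i))).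
    by rewrite -expnD subnK.
  by move=> i; rewrite -[(p ^ n)%N in LHS]mul1n hits_period.
exists 0%N; rewrite muln0 addn0 /hit_count khE modn_small //.
apply: eq_bigr => i _; rewrite /hits khE modn_small // expgS invgM.
by rewrite -/y -!mulgA mulKg.
Qed.

(** The telescoping of the geometric sum: h - 1 sends the count to the difference of the Dirac
    measures at t and at its base point h^-n t. *)
Lemma hit_count_shift E s m t :
  (hit_count E (h^-1 * s)%g m t + `[< agree E (h ^- kap t m * t)%g s >] =
   hit_count E s m t + `[< agree E t s >])%N.
Proof.
transitivity (\sum_(i < (kap t m).+1) hits E s m t i)%N; last first.
  by rewrite big_ord_recr /= hits_kap.
rewrite big_ord_recl addnC /= {1}/hits expg0 mul1g; congr (_ + _)%N.
apply: eq_bigr => i _; congr nat_of_bool; apply: asbool_equiv_eq.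
by apply: iff_sym; rewrite -[bump 0 i]/i.+1 expgS -mulgA; apply: agreeMlE.
Qed.

Lemma agree_fiber E E' g s : sval E `<=` sval E' -> G g -> G s ->
  (\sum_(s' <- gal_seq E' | `[< agree E s s' >]) `[< agree E' g s' >] =
   `[< agree E g s >])%N.
Proof.
move=> EE' Gg Gs; pose f s' : nat := `[< agree E s s' >].
have cf : class_fun E' f.
  move=> u v Gu Gv uv; congr nat_of_bool; apply: asbool_equiv_eq.
  move/(agreeS EE') in uv; split=> /agree_trans; apply=> //; exact: agree_sym.
have := gal_sum_pick finE cf Gg; rewrite /f.
have <- : `[< agree E g s >] = `[< agree E s g >].
  by apply: asbool_equiv_eq; split=> /agree_sym.
move=> <-; rewrite big_mkcond [RHS]big_mkcond; apply: eq_bigr => s' _.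
have -> : `[< agree E' s' g >] = `[< agree E' g s' >].
  by apply: asbool_equiv_eq; split=> /agree_sym.
by case: `[< agree E' g s' >]; case: `[< agree E s s' >].
Qed.

Lemma hit_count_fiber E E' s m t : sval E `<=` sval E' -> G t -> G s ->
  (\sum_(s' <- gal_seq E' | `[< agree E s s' >]) hit_count E' s' m t =
   hit_count E s m t)%N.
Proof.
move=> EE' Gt Gs; rewrite /hit_count exchange_big /=; apply: eq_bigr => i _.
apply: agree_fiber => //; apply: gal_overM (gal_overX _ Gh) _.
exact: tower_baseG.
Qed.

(* The antiderivative of [a] is the limit of these sums, in which the
   continuous function counting the hits is replaced by a step function. *)
Definition approx a E s m E' : O :=
  \sum_(t <- gal_seq E') a E' t * (hit_count E s m t)%:R.

Lemma approx_level a E s m E1 E2 : iw a -> sval E `<=` sval E1 ->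
  sval E `<=` sval E2 -> level m E1 -> level m E2 ->
  approx a E s m E1 = approx a E s m E2.
Proof.
move=> ia EE1 EE2 l1 l2; have [E3 [E13 E23]] := dirL E1 E2.
have cl E' : sval E `<=` sval E' -> level m E' ->
    class_fun E' (fun t => (hit_count E s m t)%:R : O).
  by move=> EE' l u v Gu Gv uv; congr _%:R; apply: hit_count_class uv.
by rewrite /approx -(iw_int finE ia E13 (cl _ EE1 l1)) -(iw_int finE ia E23 (cl _ EE2 l2)).
Qed.

Lemma hit_sum a E s E' : iw a -> sval E `<=` sval E' -> G s ->
  \sum_(t <- gal_seq E') a E' t * (`[< agree E t s >])%:R = a E s.
Proof.
move=> ia EE' Gs; have cf : class_fun E (fun t => (`[< agree E t s >])%:R : O).
  exact: class_fun_agree.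
rewrite (iw_int finE ia EE' cf) -[RHS](gal_sum_pick finE (iw_class ia) Gs) [RHS]big_mkcond.
by apply: eq_bigr => t _; case: `[< _ >]; rewrite ?mulr1 ?mulr0.
Qed.

(** On E the base point of t depends only on the image of t in Gal(E1/F): two such t differ by an
    element close to a power of h, which the base point forgets. Exponents may be reduced modulo p^m
    since h^(p^n) is trivial on E. *)
Lemma tower_class E E1 s m n :
  (forall s, gal_over (sval E1) s -> agree E s (h ^+ kap s m)%g) ->
  agree E (h ^+ (p ^ n))%g 1%g -> (n <= m)%N ->
  class_fun E1 (fun t => (`[< agree E (h ^- kap t m * t)%g s >])%:R : O).
Proof.
move=> E1P hn nm v w Gv Gw vw; congr (nat_of_bool _)%:R.
suff vwE : agree E (h ^- kap v m * v)%g (h ^- kap w m * w)%g.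
  by apply: asbool_equiv_eq; split; apply: agree_trans; rewrite // => x Ex; rewrite vwE.
pose c := (v^-1 * w)%g; have Gc : G c by apply/gal_overM/Gw/gal_overV.
have {}vw : gal_over (sval E1) c by apply/agree_gal_over.
have wE : w = (v * c)%g by rewrite mulVKg.
have kw : kap w m = ((kap c m + kap v m) %% p ^ m)%N by rewrite wE kapM // addnC.
have GX i : G (h ^+ i)%g by apply: gal_overX.
have hX : agree E (h ^+ (kap c m + kap v m))%g (h ^+ kap w m)%g.
  rewrite (divn_eq (kap c m + kap v m) (p ^ m)) -kw expgnDr; apply: agree1M => //.
  rewrite mulnC -(subnKC nm) expnD -mulnA expgnA; exact: agreeX1.
apply: agree_sym; apply/agreeMlE; rewrite invgK.
apply: agree_trans (_ : agree E (h ^+ kap c m * v)%g _).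
  rewrite wE; apply: agree_trans (agreeMl v (E1P _ vw)) _.
  exact: (agree_comm abelL).
have Gb : G (h ^- kap v m * v)%g by apply: tower_baseG.
have := agreeMr abelL Gb (GX _) (GX _) hX.
by rewrite expgnDr -mulgA mulVKg.
Qed.

Section Antiderivative.
Variables (a : I -> absGal -> O) (ia : iw a).
Hypothesis aM : forall E s, sval E `<=` M -> a E s = 0.

Definition above m E := projT1 (cid (level_above m E)).

Lemma aboveP m E : sval E `<=` sval (above m E) /\ level m (above m E).
Proof. exact: projT2 (cid (level_above m E)). Qed.

Lemma approx_cauchy E s : exists l, adic_lim J (fun m => approx a E s m (above m E)) l.
Proof.
have [n hn] := h_torsion E; apply: (@adic_lim_cauchy _ _ J _ n) => m nm.
have [EE' lE'] := aboveP m.+1 E; have [EE1 l1] := aboveP m E.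
rewrite (approx_level _ ia EE1 EE' l1 (level_pred lE')) -sumrB big_seq.
apply: fil_sum => t /(gal_seqG finE) Gt; rewrite -mulrBr; apply: filM.
have [w ->] := hit_count_next s Gt hn nm.
by rewrite natrD addrC addKr; apply: fil_natX.
Qed.

Definition prim E s : O :=
  if `[< G s >] then projT1 (cid (approx_cauchy E s)) else 0.

Lemma primP E s (E' : nat -> I) :
  (forall m, sval E `<=` sval (E' m) /\ level m (E' m)) -> G s ->
  adic_lim J (fun m => approx a E s m (E' m)) (prim E s).
Proof.
move=> E'P Gs; rewrite /prim asboolT //; case: (cid _) => l /=.
apply: adic_lim_near; exists 0%N => m _.
by have [EE' l'] := E'P m; have [EE1 l1] := aboveP m E; apply: approx_level.
Qed.

Lemma prim_iw : iw prim.
Proof.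
apply: (iw_intro finE) => [E s Gs|E s t Gs Gt st|E E' s EE' Gs].
- by rewrite /prim asboolF.
- apply: adic_lim_unique (primP (fun m => aboveP m E) Gs) _.
  apply: adic_lim_near (primP (fun m => aboveP m E) Gt); exists 0%N => m _.
  apply: eq_bigr => u _; congr (_ * _%:R); apply: eq_bigr => i _; congr nat_of_bool.
  by apply: asbool_equiv_eq; split=> /agree_trans; apply=> //; apply: agree_sym.
have E'P m : sval E `<=` sval (above m E') /\ level m (above m E').
  by have [E'E1 l1] := aboveP m E'; split=> //; apply: subset_trans E'E1.
apply: adic_lim_unique (primP E'P Gs) _; rewrite big_seq_cond.
have := @adic_lim_sum _ _ J _ (gal_seq E')
  (fun t => (t \in gal_seq E') && `[< agree E s t >])
  (fun t m => approx a E' t m (above m E')) (fun t => prim E' t).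
move=> /(_ (fun t tP => primP (fun m => aboveP m E') (gal_seqG finE (proj1 (andP tP))))).
apply: adic_lim_near; exists 0%N => m _; rewrite -big_seq_cond /approx exchange_big /=.
apply: eq_gal_sum => // t Gt.
by rewrite -(hit_count_fiber m EE' Gt Gs) natr_sum mulr_sumr.
Qed.

(** By [hit_count_shift] the difference is a minus the integral of a function of the base point. By
    [tower_class] that integral can be computed at a level inside M, where a vanishes. *)
Lemma prim_diff : iw_diff h prim = a.
Proof.
have Gh' := gal_overV Gh.
apply: (iw_ext (iw_diff_iw finE Gh prim_iw) ia) => E s Gs; rewrite iw_diffE.
have ab := fun m => aboveP m E.
have := adic_limB (primP ab (gal_overM Gh' Gs)) (primP ab Gs).
move=> /adic_lim_unique; apply; apply: adic_lim_near (adic_lim_cst _ (a E s)).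
have [n nP] := h_fiber E; have [n' hn'] := h_torsion E.
exists (maxn n n') => m; rewrite geq_max => /andP[/nP[E1 E1M E1P] n'm].
have [EE' lE'] := ab m; rewrite -sumrB.
apply/esym; rewrite -[RHS](hit_sum ia EE' Gs).
rewrite -[RHS]subr0; pose f t : O := (`[< agree E (h ^- kap t m * t)%g s >])%:R.
have f0 : \sum_(t <- gal_seq (above m E)) a (above m E) t * f t = 0.
  have [E2 [E12 E'2]] := dirL E1 (above m E).
  have cE' : class_fun (above m E) f.
    move=> u v Gu Gv uv; rewrite /f (level_kap lE' Gu Gv uv); congr (nat_of_bool _)%:R.
    have {}uv := agreeMl (h ^- kap v m)%g (agreeS EE' uv).
    by apply: asbool_equiv_eq; split; apply: agree_trans; rewrite // => x Ex; rewrite uv.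
  rewrite -(iw_int finE ia E'2 cE') (iw_int finE ia E12); last first.
    exact: tower_class E1P hn' n'm.
  by rewrite big1 // => t _; rewrite aM // mul0r.
rewrite -[X in _ = _ - X]f0 -sumrB; apply: eq_gal_sum => // t Gt; rewrite -!mulrBr; congr (_ * _).
have := hit_count_shift E s m t => /(congr1 (fun n => n%:R : O)).
rewrite /= !natrD => hc; apply/eqP.
by rewrite subr_eq addrAC eq_sym subr_eq addrC -hc.
Qed.

End Antiderivative.
(** Summation by parts moves the difference operator onto the hit count, whose increment is the
    indicator of s up to a multiple of p^j. So a(s) lies in every step of the filtration. *)
Lemma iw_diff_inj a : iw a -> iw_diff h a = 0 -> a = 0.
Proof.
move=> ia Da0; apply: (iw_ext ia (iw0 O finE)) => E s Gs.
apply: (fil_sep (a := J)) => j; have [n hn] := h_torsion E.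
(* Of the n + j digits, n are lost to the period p^n of [h] on [E]. *)
have [E' [EE' lE']] := level_above (n + j)%N E.
have cf : class_fun E' (fun t => a E' (h^-1 * t)%g * (hit_count E s (n + j) t)%:R).
  move=> u v Gu Gv uv; congr (_ * _%:R); last exact: hit_count_class uv.
  by apply: (iw_class ia) (agreeMl _ uv); apply/gal_overM => //; apply: gal_overV.
have : \sum_(t <- gal_seq E') iw_diff h a E' t * (hit_count E s (n + j) t)%:R = 0.
  by rewrite Da0 big1 // => t _; rewrite mul0r.
under eq_bigr do rewrite iw_diffE mulrBl.
rewrite sumrB -(gal_sumM finE Gh cf) -sumrB => e.
rewrite -(hit_sum ia EE' Gs) -[X in J j X]subr0 -[X in _ - X]e -sumrB big_seq.
apply: fil_sum => t /(gal_seqG finE) Gt; rewrite mulKg -!mulrBr; apply: filM.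
have [w /(congr1 (fun n => n%:R : O))] := hit_count_mul s Gt hn (leq_addr j n).
rewrite addKn /= !natrD => hc.
have -> : (`[< agree E t s >])%:R - ((hit_count E s (n + j) (h * t)%g)%:R -
    (hit_count E s (n + j) t)%:R) = (p ^ j * w)%:R :> O.
  by apply/eqP; rewrite opprB addrA subr_eq addrC hc addrC.
exact: fil_natX.
Qed.

Lemma iw_antiderivative a : iw a -> (forall E s, sval E `<=` M -> a E s = 0) ->
  exists2 b, iw b & a = iw_diff h b.
Proof.
by move=> ia aM; exists (prim ia); [apply: prim_iw|rewrite prim_diff].
Qed.

Lemma iter_iw_diff_iw n a : iw a -> iw (iter n (iw_diff h) a).
Proof. by move=> ia; elim: n => //= n; apply: iw_diff_iw. Qed.

Lemma iter_iw_diff_shift_eval n a E s :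
  iter n (iw_diff h) a E s = shift_eval h (a E) (('X - 1) ^+ n) s.
Proof.
elim: n s => [|n IHn] s.
  by rewrite expr0 /shift_eval size_poly1 big_ord1 coef1 mul1r expg0 invg1 mul1g.
by rewrite iterS iw_diffE !IHn exprS mulrBl mul1r shift_evalB shift_evalXM.
Qed.

(** On a function invariant under h^(p^n) the polynomial X^(p^n) - 1 acts as zero, so (X - 1)^(p^n)
    acts as a multiple of p, and its j-th power gains j steps of the filtration. *)
Lemma shift_eval_fil E b s j q (f : absGal -> O) n : odd p ->
  (forall t, G t -> f (h ^- (p ^ n) * t)%g = f t) -> G s ->
  J j (shift_eval h f ((('X - 1) ^+ (p ^ n)) ^+ j * q) s).
Proof.
move=> p_odd fper Gs; have [r rE] := frobenius_XsubC1 O n p_prime p_odd.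
elim: j q => [|j IHj] q; first exact: fil_all.
rewrite exprSr -mulrA [X in _ * (X * q)]rE mulrDl mulrBl mul1r.
rewrite mulrDr shift_evalD; have -> : shift_eval h f ((('X - 1) ^+ (p ^ n)) ^+ j * ('X^(p ^ n) * q - q)) s = 0.
  rewrite mulrBr mulrCA shift_evalB shift_evalXnM; apply/eqP; rewrite subr_eq0; apply/eqP.
  apply: eq_bigr => i _; congr (_ * _).
  rewrite mulgA -invgM -expgnDr addnC expgnDr invgM -mulgA fper //.
  exact: tower_baseG.
by rewrite add0r -scalerAl -scalerAr shift_evalZ; apply/fil_p/IHj.
Qed.

Lemma iw_diff_sep a : odd p ->
  (forall n, exists2 b, iw b & a = iter n (iw_diff h) b) -> a = 0.
Proof.
move=> p_odd aD; have ia : iw a by have [b ib ->] := aD 0%N.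
apply: (iw_ext ia (iw0 O finE)) => E s Gs; apply: (fil_sep (a := J)) => j.
have [n hn] := h_torsion E; have [b ib ->] := aD (p ^ n * j)%N.
rewrite iter_iw_diff_shift_eval exprM -[_ ^+ j]mulr1; apply: shift_eval_fil => // t Gt.
have Gn : G (h ^- (p ^ n))%g by apply/gal_overV/gal_overX.
apply: (iw_class ib) => //; first exact: gal_overM.
apply: agree1M => //; have := agreeMl (h ^- (p ^ n))%g hn.
by rewrite mulVg mulg1 => /agree_sym.
Qed.

Section Domain.
Hypothesis p_odd : odd p.
Hypothesis domO : forall c d : O, c * d = 0 -> c = 0 \/ d = 0.
Hypothesis MF : M `<=` F.
Variables (E0 : I) (E0F : sval E0 = F).

(** The value at [E0] is the augmentation, as Gal(E0/F) is trivial. While it vanishes one more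
    factor h - 1 can be extracted, and by [iw_diff_sep] this cannot go on forever. *)
Lemma iw_leading a : iw a -> a <> 0 ->
  exists n a', [/\ iw a', a = iter n (iw_diff h) a' & a' E0 1%g <> 0].
Proof.
move=> ia a0; apply: contrapT => none; apply: a0; apply: iw_diff_sep => //.
elim=> [|n [b ib ab]]; first by exists a.
have b0 : b E0 1%g = 0 by apply: contrapT => b0; apply: none; exists n, b.
have bM E s : sval E `<=` M -> b E s = 0.
  move=> EM; have [Gs|Gs] := pselect (G s); last exact: iw_out.
  have EE0 : sval E `<=` sval E0 by rewrite E0F; apply: subset_trans MF.
  rewrite (iw_compat finE ib EE0 Gs) big_seq_cond big1 // => t /andP[/(gal_seqG finE) Gt _].
  by rewrite -b0; apply: (iw_class ib) => //; rewrite /agree E0F.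
have [b' ib' bb'] := iw_antiderivative ib bM.
by exists b' => //; rewrite ab bb' iterSr.
Qed.

Lemma iter_iw_diff_inj n a : iw a -> iter n (iw_diff h) a = 0 -> a = 0.
Proof.
elim: n a => // n IHn a ia; rewrite iterSr => /IHn Da.
by apply: iw_diff_inj => //; apply: Da; apply: iw_diff_iw.
Qed.

Lemma iw_mul_eq0 x y : iw x -> iw y -> iwasawa_mul x y = 0 -> x = 0 \/ y = 0.
Proof.
move=> ix iy xy0; apply: contrapT => /not_orP[/(iw_leading ix)[i [x' [ix' xE x'0]]]].
move=> /(iw_leading iy)[j [y' [iy' yE y'0]]].
have mulD : iwasawa_mul x y = iter (i + j) (iw_diff h) (iwasawa_mul x' y').
  rewrite xE yE iterD; elim: i {xE} => [|i IHi] /=.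
    by elim: j {yE} => //= j <-; rewrite (iw_mul_diffr abelL) //; apply: iter_iw_diff_iw.
  rewrite -IHi iw_mul_diffl //; first exact: iter_iw_diff_iw.
  exact: iter_iw_diff_iw.
move: xy0; rewrite mulD => /(iter_iw_diff_inj (iw_mul abelL finE ix' iy')).
move=> /(congr1 (fun z => z E0 1%g)); rewrite iw_mulE // => xy0.
suff /domO[] : x' E0 1%g * y' E0 1%g = 0 by [].
(* The convolution over the trivial group Gal(E0/F) is a single product, so the augmentation is
   multiplicative. *)
have cf : class_fun E0 (fun t => x' E0 t * y' E0 (t^-1 * 1)%g).
  move=> u v Gu Gv uv; congr (_ * _); first exact: (iw_class ix').
  exact: (class_fun_div abelL iy' (@gal_over1 F)) uv.
have := gal_sum_pick finE cf (@gal_over1 F); rewrite invg1 mulg1 => <-.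
rewrite -[RHS]xy0 big_mkcond; apply: eq_gal_sum => // t Gt.
by rewrite asboolT // /agree E0F.
Qed.

End Domain.
End Tower.

Definition padic_one p : padic_int p :=
  @PadicInt p (fun n => 1 %% p ^ n)%N
    (fun n => esym (modn_dvdm 1 (dvdn_exp2l p (leqnSn n)))).

Definition padic_zero p : padic_int p :=
  @PadicInt p (fun=> 0%N) (fun n => esym (mod0n _)).

Lemma finite_sub_directed F L : is_subfield L -> forall E1 E2 : finite_sub F L,
  exists E : finite_sub F L, sval E1 `<=` sval E /\ sval E2 `<=` sval E.
Proof.
move=> sfL [E1 [FE1 E1L]] [E2 [FE2 E2L]].
have [E [FE E1E E2E EL]] := finite_ext_compositum sfL FE1 FE2 E1L E2L.
by exists (exist _ E (conj FE EL)).
Qed.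

(** * The kernel of the projection to a Z_p-extension *)

Section ZpTower.
Variables (p d : nat) (p_prime : prime p) (F L : set algC).
Variables (sfF : is_subfield F) (sfL : is_subfield L) (FL : F `<=` L).
Variables (k : absGal -> 'I_d -> padic_int p) (kP : Zp_character F L k).
Local Notation G := (gal_over F).
Implicit Types (s t : absGal).

Lemma Zp_small s i n : (k s i n < p ^ n)%N.
Proof. exact: residue_small. Qed.

Lemma Zp_diff0 s t i n : G s -> G t -> k s i n = k t i n -> k (s^-1 * t)%g i n = 0%N.
Proof.
move=> Gs Gt st; have Gs' := gal_overV Gs.
by rewrite (ZpM kP) // addnC -st (ZpV FL kP).
Qed.

Lemma Zp_agree s t i n : G s -> G t -> (forall x, L x -> s x = t x) ->
  k s i n = k t i n.
Proof.
move=> Gs Gt st; have Gst : G (s^-1 * t)%g by apply/gal_overM/Gt/gal_overV.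
have Lst : gal_over L (s^-1 * t)%g by move=> x Lx; rewrite galMx -st // galVK.
rewrite -[t in RHS](mulVKg s) (ZpM kP) // (Zp_eq0 FL kP _ _ Lst) addn0.
by rewrite modn_small // Zp_small.
Qed.

Lemma Zp_open_agree (E : finite_sub F L) : exists m, forall n s t, (m <= n)%N ->
  G s -> G t -> (forall i, k s i n = k t i n) -> agree E s t.
Proof.
case: E => E [FE EL]; have [m mP] := Zp_open p_prime FL kP FE EL.
exists m => n s t mn Gs Gt st; apply/agree_gal_over => //.
apply: mP => [|i]; first exact/gal_overM/Gt/gal_overV.
by rewrite -(residue_modn _ mn) Zp_diff0 ?mod0n.
Qed.

Lemma Zp_finite_reps (E : finite_sub F L) : finite_set (gal_reps E).
Proof.
have [m mP] := Zp_open_agree E.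
pose f s := [ffun i => Ordinal (Zp_small s i m)].
suff fI : {in gal_reps E &, injective f}.
  by rewrite -(eq_finite_set (inj_card_eq fI)); apply: finite_finset.
move=> _ _ /set_mem[s Gs <-] /set_mem[t Gt <-] ff.
have [[Gr sr] [Gr' tr']] := (gal_repP E Gs, gal_repP E Gt).
rewrite -/(gal_rep E s) -/(gal_rep E t) in ff *; apply: gal_rep_eq.
apply: agree_trans sr _; apply: agree_trans (agree_sym tr').
apply: (mP m) => // i; have /ffunP/(_ i) := ff.
by rewrite !ffunE => -[].
Qed.

Lemma Zp_kap_open i n : exists E : finite_sub F L,
  forall s, gal_over (sval E) s -> k s i n = 0%N.
Proof.
have [E [FE EL EP]] := Zp_continuous sfF sfL FL kP n.
by exists (exist _ E (conj FE EL)) => s /EP.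
Qed.

Lemma Zp_torsion h (E : finite_sub F L) : G h -> exists n, agree E (h ^+ (p ^ n))%g 1%g.
Proof.
move=> Gh; have [m mP] := Zp_open_agree E; exists m.
apply: (mP m) => // [|i]; first exact: gal_overX.
by rewrite (ZpX FL kP) // (Zp_id FL kP) modnMr.
Qed.

Lemma Zp_root s n : G s -> (forall i, k s i n = 0%N) ->
  exists2 t, G t & forall x, L x -> s x = (t ^+ (p ^ n))%g x.
Proof.
move=> Gs ks.
have /all_sig[w wP] i : {w : padic_int p |
    forall j, (p ^ n * 1 * w j = k s i j %[mod p ^ j])%N}.
  by apply: cid; apply: padic_nat_div => //; apply: coprimen1.
have [t Gt tw] : exists2 t, G t & forall i j, k t i j = w i j.
  by case: kP => _ _ + _; apply.
exists t => // x; apply: (Zp_inj FL kP) => // [|i j]; first exact: gal_overX.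
by rewrite (ZpX FL kP) // tw -[(p ^ n)%N]muln1 wP modn_small ?Zp_small.
Qed.

End ZpTower.

Lemma ord2_other (i j l : 'I_2) : j != i -> l != i -> j = l.
Proof.
by move: i j l; do 3![case=> -[|[|//]] ?] => //= *; apply: val_inj.
Qed.

Section ZpSubextension.
Variables (p : nat) (p_prime : prime p) (F L L' : set algC).
Variables (FL : F `<=` L) (FL' : F `<=` L') (LL' : L `<=` L').
Variables (k : absGal -> 'I_1 -> padic_int p) (kP : Zp_character F L k).
Variables (k' : absGal -> 'I_2 -> padic_int p) (kP' : Zp_character F L' k').
Local Notation G := (gal_over F).
Implicit Types (s t : absGal).

(** An element whose coordinates [k'] vanish modulo p^n is a p^n-th power on L', hence on L. So [k]
    modulo p^n depends only on [k'] modulo p^n. *)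
Lemma Zp_sub_zero s n : G s -> (forall i, k' s i n = 0%N) -> k s ord0 n = 0%N.
Proof.
move=> Gs /(Zp_root p_prime FL' kP' Gs)[t Gt st].
rewrite (@Zp_agree _ _ p_prime _ _ FL _ kP s (t ^+ (p ^ n))%g) //; last first.
- by move=> x /LL'/st.
- exact: gal_overX.
by rewrite (ZpX FL kP) // modnMr.
Qed.

(* The kernel of [k] is topologically generated by an element on which some
   coordinate of [k'] is 1, and that coordinate completes [k] to coordinates on
   Gal(L'/F). *)
Lemma Zp_sub_coordinates : exists h j, [/\ gal_over L h, G h,
  forall n, k' h j n = (1 %% p ^ n)%N &
  forall s n, G s -> k s ord0 n = 0%N -> k' s j n = 0%N -> forall i, k' s i n = 0%N].
Proof.
have surj' (z : 'I_2 -> padic_int p) : exists2 s, G s & forall i n, k' s i n = z i n.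
  by case: kP' => _ _ + _; apply.
pose unit_at (i i' : 'I_2) := if i' == i then padic_one p else padic_zero p.
have /all_sig[e eP] i : {e | G e /\ forall i' n, k' e i' n = unit_at i i' n}.
  by apply: cid; have [s Gs sP] := surj' (unit_at i); exists s.
have e_diag i n : k' (e i) i n = (1 %% p ^ n)%N.
  by have [_ ->] := eP i; rewrite /unit_at eqxx.
have e_off i i' n : i' != i -> k' (e i) i' n = 0%N.
  by have [_ ->] := eP i; rewrite /unit_at => /negPf ->.
have Ge i : G (e i) by case: (eP i).
(* Modulo p^n, [k] is a linear form in the coordinates [k']; its coefficients are its values on the
   dual basis [e]. *)
have lin i i' : i' != i -> forall s n, G s -> k s ord0 n =
    ((k' s i n * k (e i) ord0 n + k' s i' n * k (e i') ord0 n) %% p ^ n)%N.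
  move=> ii' s n Gs; pose t := (e i ^+ k' s i n * e i' ^+ k' s i' n)%g.
  have Gt : G t by apply: gal_overM; apply: gal_overX.
  have st : k (s^-1 * t)%g ord0 n = 0%N.
    apply: Zp_sub_zero => [|i2]; first exact/gal_overM/Gt/gal_overV.
    apply: (Zp_diff0 FL' kP') => //.
    rewrite (ZpM kP') ?(ZpX FL' kP') //; try exact: gal_overX.
    rewrite modnDm; have [->|i2i] := eqVneq i2 i.
      by rewrite e_diag e_off 1?eq_sym // muln0 addn0 modnMmr muln1 modn_small ?Zp_small.
    rewrite (ord2_other i2i ii').
    by rewrite e_diag e_off // muln0 add0n modnMmr muln1 modn_small ?Zp_small.
  have Gst : G (s^-1 * t)%g by apply/gal_overM/Gt/gal_overV.
  transitivity (k t ord0 n).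
    rewrite -(mulVKg s t) (ZpM kP) // st addn0 modn_small //; exact: Zp_small.
  rewrite (ZpM kP) ?(ZpX FL kP) //; try exact: gal_overX.
  by rewrite modnDm.
(* Since [k] is onto Z_p, its two coefficients are not both divisible by p. *)
have [i ci] : exists i, ~~ (p %| k (e i) ord0 1)%N.
  apply: contrapT => /forallNP none; have {}none i : (p %| k (e i) ord0 1)%N.
    by apply/negPn/negP; apply: none.
  have [s Gs s1] : exists2 s, G s & forall i n, k s i n = padic_one p n.
    by case: kP => _ _ + _; apply.
  have := lin 0%R 1%R isT s 1%N Gs; rewrite s1 /= expn1 modn_small ?prime_gt1 //.
  by move/eqP; rewrite eq_sym (eqP (_ : p %| _)%N) // dvdn_add // dvdn_mull.
have [j ij] : exists j, j != i by exists (rev_ord i); case: i {ci} => -[|[|//]].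
(* Chosen so that the vector with entry z at i and 1 at j is killed by the linear form; [h] is the
   element with these coordinates. *)
have [z zP] := padic_unit_div p_prime (k (e j)^-1%g ord0) ci.
pose hc i' := if i' == i then z else padic_one p.
have [h Gh hP] := surj' hc.
have hi n : k' h i n = z n by rewrite hP /hc eqxx.
have hj n : k' h j n = (1 %% p ^ n)%N by rewrite hP /hc (negPf ij).
exists h, j; split=> //.
  apply/(Zp_ker kP) => // i' n; rewrite ord1 (lin i j ij) // hi hj.
  rewrite mulnC -modnDml zP modnDml -modnDmr modnMml mul1n modnDmr addnC.
  exact: (ZpV FL kP).
move=> s n Gs ks0 kj0 i'; have [->|ii'] := eqVneq i' i; last by rewrite (ord2_other ii' ij).
have := lin i j ij s n Gs; rewrite ks0 kj0 mul0n addn0 => /esym/eqP.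
rewrite -/(dvdn _ _) Gauss_dvdl; last by rewrite coprime_sym padic_unit_coprime.
by rewrite /dvdn modn_small ?Zp_small // => /eqP.
Qed.

End ZpSubextension.

(** * The Iwasawa algebra of a Z_p-extension is a domain *)

Section ZpDomain.
Variables (p : nat) (p_prime : prime p) (p_odd : odd p).
Variables (O : comNzRingType) (J : adic_filtration p O).
Hypothesis domO : forall c d : O, c * d = 0 -> c = 0 \/ d = 0.
Variables (F L : set algC).
Variables (sfF : is_subfield F) (sfL : is_subfield L) (FL : F `<=` L).
Variables (k : absGal -> 'I_1 -> padic_int p) (kP : Zp_character F L k).

Lemma Zp_generator : exists2 g, gal_over F g & forall n, k g ord0 n = (1 %% p ^ n)%N.
Proof.
case: kP => _ _ kS _; have [g Gg gP] := kS (fun=> padic_one p).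
by exists g => // n; rewrite gP.
Qed.

Lemma Zp_iwasawa_domain x y : @iwasawa_algebra O F L x -> iwasawa_algebra y ->
  iwasawa_mul x y = 0 -> x = 0 \/ y = 0.
Proof.
have [g Gg gP] := Zp_generator.
pose E0 : finite_sub F L := exist _ F (conj (finite_ext_refl sfF) FL).
apply: (@iw_mul_eq0 p p_prime O J F F L (fun s t x => @Zp_comm p 1 F L FL k kP s t x)
  (Zp_finite_reps p_prime FL kP) (finite_sub_directed sfL) g Gg
  (fun s => k s ord0) _ _ _ gP _ _ _ p_odd domO _ E0 erefl).
- by move=> s n; apply: residue_small.
- by move=> s n; rewrite -[LHS](residue_modn _ (leqnSn n)).
- by move=> s t n Gs Gt; rewrite (ZpM kP).
- exact: Zp_kap_open.
- by move=> E; apply: (Zp_torsion p_prime FL kP).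
- move=> E; have [n nP] := Zp_open_agree p_prime FL kP E; exists n => m nm.
  exists E0 => // s Gs; apply: (nP m) => //; first exact: gal_overX.
  move=> i; rewrite ord1 (ZpX FL kP) // gP modnMmr muln1 modn_small //.
  exact: residue_small.
- by [].
Qed.

End ZpDomain.

(** * The kernel as a prime ideal of height at most 1 *)

Section KernelIdeal.
Variables (p : nat) (p_prime : prime p) (p_odd : odd p).
Variables (O : comNzRingType) (J : adic_filtration p O).
Hypothesis domO : forall c d : O, c * d = 0 -> c = 0 \/ d = 0.
Variables (F L L' : set algC).
Variables (sfF : is_subfield F) (sfL : is_subfield L) (sfL' : is_subfield L').
Variables (FL : F `<=` L) (FL' : F `<=` L') (LL' : L `<=` L').
Variables (k : absGal -> 'I_1 -> padic_int p) (kP : Zp_character F L k).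
Variables (k' : absGal -> 'I_2 -> padic_int p) (kP' : Zp_character F L' k').
Local Notation G := (gal_over F).
Local Notation iw := (@iwasawa_algebra O F L).
Local Notation iw' := (@iwasawa_algebra O F L').
Let finE := Zp_finite_reps p_prime FL kP.
Let finE' := Zp_finite_reps p_prime FL' kP'.
Let abelL s t x := @Zp_comm p 1 F L FL k kP s t x.
Let abelL' s t x := @Zp_comm p 2 F L' FL' k' kP' s t x.

Definition widen_sub (E : finite_sub F L) : finite_sub F L' :=
  exist _ (sval E) (conj (proj1 (svalP E)) (subset_trans (proj2 (svalP E)) LL')).

Lemma widen_sub_surj (E : finite_sub F L') : sval E `<=` L ->
  exists E0, widen_sub E0 = E.
Proof.
case: E => E [FE EL'] /= EL; exists (exist _ E (conj FE EL)).
by rewrite /widen_sub /=; congr exist; apply: Prop_irrelevance.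
Qed.

Definition iw_proj (x : finite_sub F L' -> absGal -> O) : finite_sub F L -> absGal -> O :=
  fun E => x (widen_sub E).

Lemma iw_proj_iw x : iw' x -> iw (iw_proj x).
Proof.
move=> ix; apply: (iw_intro finE) => [E s Gs|E s t Gs Gt|E E' s EE' Gs].
- exact: (iw_out (widen_sub E) ix Gs).
- exact: (iw_class ix (E := widen_sub E)) Gs Gt.
- exact: (iw_compat finE' ix (E := widen_sub E) (E' := widen_sub E')).
Qed.

(** Convolution at level E sees only that level, and [gal_reps] only the underlying field, so both
    sides are convertible. *)
Lemma iw_proj_mul x y : iw_proj (iwasawa_mul x y) = iwasawa_mul (iw_proj x) (iw_proj y).
Proof. by []. Qed.

Lemma kernel_generator : exists h, [/\ gal_over L h, G h,
  forall E : finite_sub F L', exists2 E1 : finite_sub F L',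
    sval E1 `<=` L & forall s, gal_over (sval E1) s -> exists i, agree E s (h ^+ i)%g,
  forall a, iw' a -> iw_proj a = 0 -> exists2 b, iw' b & a = iw_diff h b &
  forall a, (forall n, exists2 b, iw' b & a = iter n (iw_diff h) b) -> a = 0].
Proof.
have [h [j [Lh Gh hj kk']]] :=
  Zp_sub_coordinates p_prime FL FL' LL' kP kP'.
have h_fiber (E : finite_sub F L') : exists n, forall m, (n <= m)%N ->
    exists2 E1 : finite_sub F L', sval E1 `<=` L &
    forall s, gal_over (sval E1) s -> agree E s (h ^+ k' s j m)%g.
  have [n nP] := Zp_open_agree p_prime FL' kP' E; exists n => m nm.
  have [E1 [FE1 E1L E1P]] := Zp_continuous sfF sfL FL kP m.
  exists (exist _ E1 (conj FE1 (subset_trans E1L LL'))) => //= s E1s.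
  have Gs : G s by apply: gal_overS E1s; case: FE1.
  have GX := gal_overX (k' s j m) Gh.
  have Gsh : G (s^-1 * h ^+ k' s j m)%g by apply/gal_overM/GX/gal_overV.
  have Gsh' : G ((h ^+ k' s j m)^-1 * s)%g by apply/gal_overM/Gs/gal_overV.
  (* Modulo p^m both elements have [k] equal to zero, by the choice of [E1], and the same j-th
     coordinate; [kk'] then makes all coordinates of [k'] agree. *)
  apply: (nP m) => // i; rewrite -[in LHS](mulVKg (h ^+ k' s j m)%g s) (ZpM kP') //.
  rewrite (kk' _ m Gsh') ?addn0 ?modn_small ?(residue_small p_prime) //.
    apply: (Zp_diff0 FL kP) => //.
    by rewrite (E1P _ E1s) (ZpX FL kP) // (Zp_eq0 FL kP _ _ Lh) muln0 mod0n.
  apply: (Zp_diff0 FL' kP') => //.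
  rewrite (ZpX FL' kP') // hj modnMmr muln1 modn_small //.
  exact: residue_small.
have h_tor := fun E => Zp_torsion p_prime FL' kP' E Gh.
exists h; split=> //.
- move=> E; have [n /(_ n (leqnn n))[E1 E1L E1P]] := h_fiber E.
  by exists E1 => // s /E1P; exists (k' s j n).
- move=> a ia pa; apply: (@iw_antiderivative p O J F L L' abelL' finE'
    (finite_sub_directed sfL') h Gh (fun s => k' s j) _ _ _ _ _ h_fiber) => //.
  + by move=> s n; apply: residue_small.
  + by move=> s n; rewrite -[LHS](residue_modn _ (leqnSn n)).
  + by move=> s t n Gs Gt; rewrite (ZpM kP').
  + exact: Zp_kap_open.
  + move=> E s /widen_sub_surj[E0 <-].
    by rewrite -[LHS]/(iw_proj a E0 s) pa.
- by move=> a; apply: (iw_diff_sep p_prime J abelL' finE' Gh).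
Qed.

Definition kernel_ideal : set (finite_sub F L' -> absGal -> O) :=
  [set x | iw' x /\ iw_proj x = 0].

Lemma kernel_prime :
  prime_ideal iw' (@iwasawa_one O F L') (@iwasawa_mul O F L') kernel_ideal.
Proof.
pose E0 : finite_sub F L := exist _ F (conj (finite_ext_refl sfF) FL).
split; split.
- by move=> x [].
- by split; first exact: iw0.
- move=> [_ /(congr1 (fun z => z E0 1%g))]; rewrite iw_one_delta /iw_proj.
  by rewrite iw_deltaE // asboolT // => /eqP; rewrite oner_eq0.
- move=> x y [ix x0] [iy y0]; split; first exact: iw_sub.
  by apply/funext => E; rewrite /iw_proj -[LHS]/(iw_proj x E - iw_proj y E) x0 y0 subrr.
- move=> x y ix [iy y0]; split; first exact: (iw_mul abelL').
  rewrite iw_proj_mul y0; apply: (iw_ext (L := L)) (iw0 O finE) _.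
    exact: (iw_mul abelL finE (iw_proj_iw ix) (iw0 O finE)).
  by move=> E s Gs; rewrite (iw_mulE finE) // big1 // => t _; rewrite mulr0.
- move=> x y ix iy [_]; rewrite iw_proj_mul => /(Zp_iwasawa_domain p_prime p_odd J domO
    sfF sfL FL kP (iw_proj_iw ix) (iw_proj_iw iy)) [x0|y0]; by [left|right].
Qed.

(* The kernel is generated by [h - 1], whose powers have zero intersection. *)
Lemma kernel_height :
  height_le1 iw' (@iwasawa_one O F L') (@iwasawa_mul O F L') kernel_ideal.
Proof.
move=> [P0 [P1 [[[_ P00 _] _] [[P1L P10 P11] [P1B P1M P1P]] [P01 nP10] [P1K nKP1]]]].
have [h [Lh Gh _ anti sep]] := kernel_generator.
pose xi := @iw_delta O F L' h - @iwasawa_one O F L'.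
have ixi : iw' xi by apply: iw_sub => //; rewrite ?iw_one_delta; apply: iw_delta_iw.
have nP1 : ~ P1 xi.
  move=> P1xi; apply: nKP1 => a [ia a0]; have [b ib ->] := anti a ia a0.
  by rewrite (iw_diff_mul abelL') //; apply: P1M.
apply: nP10 => a P1a; suff -> : a = 0 by [].
apply: sep => n; suff [b P1b ->] : exists2 b, P1 b & a = iter n (iw_diff h) b.
  by exists b => //; apply: P1L.
(* [P1] is prime and misses h - 1, so an element of [P1] divided by h - 1 is again in [P1]. Its
   elements are therefore infinitely divisible by h - 1, hence zero. *)
elim: n => [|n [b P1b ab]]; first by exists a.
have [ib b0] := P1K b P1b; have [c ic bc] := anti b ib b0.
exists c; last by rewrite ab bc iterSr.
have : P1 (iwasawa_mul c xi) by rewrite -(iw_diff_mul abelL') // -bc.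
by move=> /P1P[].
Qed.

End KernelIdeal.

(** * Fine Selmer groups *)

Section GaloisModule.
Variables (O : comNzRingType) (A : lmodType O) (act : absGal -> A -> A).
Hypothesis act1 : forall a, act 1%g a = a.
Hypothesis actM : forall s t a, act (s * t)%g a = act s (act t a).
Hypothesis actD : forall s a b, act s (a + b) = act s a + act s b.
Hypothesis actZ : forall s (r : O) a, act s (r *: a) = r *: act s a.
Implicit Types (s t u : absGal) (c d : absGal -> A) (H : set absGal) (r : O).

Lemma act0 s : act s 0 = 0.
Proof. by apply: (addrI (act s 0)); rewrite -actD !addr0. Qed.

Lemma actN s a : act s (- a) = - act s a.
Proof. by apply/eqP; rewrite -addr_eq0 -actD addNr act0. Qed.

Lemma actB s a b : act s (a - b) = act s a - act s b.
Proof. by rewrite actD actN. Qed.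

Lemma coboundary_sub H c d : coboundary_on act H c -> coboundary_on act H d ->
  coboundary_on act H (c - d).
Proof.
move=> [a ca] [b db]; exists (a - b) => s Hs.
by rewrite !fctE ca // db // actB !opprD !opprK addrACA.
Qed.

Lemma coboundary_scale H r c : coboundary_on act H c ->
  coboundary_on act H (fun s => r *: c s).
Proof. by move=> [a ca]; exists (r *: a) => s Hs; rewrite ca // actZ scalerBr. Qed.

Lemma coboundary0 H : coboundary_on act H 0.
Proof. by exists 0 => s _; rewrite act0 subrr. Qed.

Lemma coboundaryS H H' c : H `<=` H' -> coboundary_on act H' c -> coboundary_on act H c.
Proof. by move=> HH' [a ca]; exists a => s /HH'/ca. Qed.

(** The transform of c under s^-1 which occurs in [dual_scale]; as [twistM] shows, it is a right
    action. *)
Definition twist s c : absGal -> A := fun t => act (s^-1)%g (c (s * t * s^-1)%g).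

Lemma twistM s t c : twist s (twist t c) = twist (t * s)%g c.
Proof. by apply/funext => u; rewrite /twist invgM actM !mulgA. Qed.

Lemma twist_sub s c d : twist s (c - d) = twist s c - twist s d.
Proof. by apply/funext => u; rewrite /twist !fctE actB. Qed.

Lemma twist_scale s r c : twist s (fun t => r *: c t) = (fun t => r *: twist s c t).
Proof. by apply/funext => u; rewrite /twist actZ. Qed.

Section Cocycles.
Variables (F : set algC) (S : set (set algC)) (L : set algC).
Hypothesis FL : F `<=` L.
Hypothesis abelL : forall s t x, gal_over F s -> gal_over F t -> L x ->
  s (t x) = t (s x).
Local Notation G := (gal_over F).
Local Notation Z := (fine_cocycle act F S).
Implicit Types (E P : set algC).

Lemma cocycle1 E c : cocycle act F S E c -> c 1%g = 0.
Proof.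
move=> [_ /(_ 1%g 1%g (@gal_over1 E) (@gal_over1 E))].
rewrite -[gal_comp _ _]/(1%g * 1%g : absGal)%g mulg1 act1 => /eqP.
by rewrite -subr_eq0 opprD addNKr oppr_eq0 => /eqP.
Qed.

Lemma krull_continuous2 (X : set algC) H (T1 T2 T3 : Type) (f : T1 -> T2 -> T3)
    (c1 : absGal -> T1) (c2 : absGal -> T2) : krull_continuous X H c1 ->
  krull_continuous X H c2 -> krull_continuous X H (fun s => f (c1 s) (c2 s)).
Proof.
move=> k1 k2 s Hs; have [r1 [X1 r1P]] := k1 s Hs; have [r2 [X2 r2P]] := k2 s Hs.
exists (r1 ++ r2); split=> [x|t Ht ts].
  by rewrite mem_cat => /orP[/X1|/X2].
by congr f; [apply: r1P|apply: r2P] => // x xr; apply: ts; rewrite mem_cat xr ?orbT.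
Qed.

Lemma fine_cocycleB E c d : Z E c -> Z E d -> Z E (c - d).
Proof.
move=> [[kc cc] Pc wc] [[kd cd] Pd wd]; split.
- split; first exact: (krull_continuous2 (fun a b => a - b) kc kd).
  by move=> s t Es Et; rewrite !fctE cc // cd // actB !opprD addrACA.
- by move=> P fP SP; apply: coboundary_sub; [apply: Pc|apply: Pd].
- by move=> w; apply: coboundary_sub.
Qed.

Lemma fine_cocycleZ E r c : Z E c -> Z E (fun s => r *: c s).
Proof.
move=> [[kc cc] Pc wc]; split.
- split; first exact: (krull_continuous2 (fun a _ => r *: a) kc kc).
  by move=> s t Es Et; rewrite cc // scalerDr actZ.
- by move=> P fP SP; apply: coboundary_scale; apply: Pc.
- by move=> w; apply: coboundary_scale.
Qed.

Lemma fine_cocycle0 E : Z E 0.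
Proof.
split.
- split; last by move=> s t _ _; rewrite -[RHS]/(0 + act s 0) act0 addr0.
  by move=> s _; exists [::]; split.
- by move=> P _ _; apply: coboundary0.
- by move=> w; apply: coboundary0.
Qed.

Lemma fine_cocycleN E c : Z E c -> Z E (- c).
Proof. by rewrite -sub0r => Zc; apply: fine_cocycleB => //; apply: fine_cocycle0. Qed.

Lemma fine_cocycleD E c d : Z E c -> Z E d -> Z E (c + d).
Proof. by move=> Zc Zd; rewrite -[d]opprK; apply/fine_cocycleB/fine_cocycleN. Qed.

Lemma fine_cocycle_sum E (I : eqType) (q : seq I) (f : I -> absGal -> A) :
  (forall i, i \in q -> Z E (f i)) -> Z E (fun u => \sum_(i <- q) f i u).
Proof.
elim: q => [|i q IHq] Zf.
  rewrite (_ : (fun _ => _) = 0); first exact: fine_cocycle0.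
  by apply/funext => u; rewrite big_nil.
rewrite (_ : (fun _ => _) = f i + (fun u => \sum_(i <- q) f i u)); last first.
  by apply/funext => u; rewrite big_cons.
apply: fine_cocycleD; first by apply: Zf; rewrite mem_head.
by apply: IHq => j jq; apply: Zf; rewrite inE jq orbT.
Qed.

Lemma fine_cocycle_res E E' c : E `<=` E' -> Z E c -> Z E' c.
Proof.
move=> EE' [[kc cc] Pc wc]; have EE := gal_overS EE'; split.
- split; last by move=> s t /EE Es /EE Et; apply: cc.
  move=> s /EE Es; have [r [rX rP]] := kc s Es.
  by exists r; split=> // t /EE; apply: rP.
- move=> P fP SP; apply: coboundaryS (Pc P fP SP).
  by apply: setSI.
- by move=> w; apply: coboundaryS (wc w); apply: setSI.
Qed.

Lemma gal_conj E s t : F `<=` E -> E `<=` L -> G s -> gal_over E t ->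
  gal_over E (s * t * s^-1)%g /\ forall x, L x -> (s * t * s^-1)%g x = t x.
Proof.
move=> FE EL Gs Et; have Gt := gal_overS FE Et.
have conjL x : L x -> (s * t * s^-1)%g x = t x.
  by move=> Lx; rewrite !galMx -(abelL (gal_overV Gs) Gt Lx) galKV.
by split=> // x Ex; rewrite conjL ?Et //; apply: EL.
Qed.

Lemma integers_gal s x : integers setT x -> integers setT (s x).
Proof.
move=> [_ [q qm qx]]; split=> //; exists q => //.
move: qx; rewrite /root -(fmorph_eq0 s) -horner_map /= -map_poly_comp.
congr ((_).[_] == 0); apply: eq_map_poly => n /=; exact: rmorph_int.
Qed.

Definition gal_prime s P : set algC := [set x | P (s x)].

Lemma finite_prime_gal s P : finite_prime setT P -> finite_prime setT (gal_prime s P).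
Proof.
move=> [[PO P1 [x Px x0]] [PB PM PP]]; split; split.
- by move=> y /PO/(integers_gal (s^-1)%g); rewrite galVK.
- by rewrite /gal_prime /= rmorph1.
- by exists ((s^-1)%g x); rewrite /gal_prime /= ?galKV ?fmorph_eq0.
- by move=> y z; rewrite /gal_prime /= rmorphB; apply: PB.
- by move=> y z /(integers_gal s) Oy; rewrite /gal_prime /= rmorphM; apply: PM.
- move=> y z /(integers_gal s) Oy /(integers_gal s) Oz.
  by rewrite /gal_prime /= rmorphM; apply: PP.
Qed.

Lemma gal_primeF s P : G s -> gal_prime s P `&` F = P `&` F.
Proof.
move=> Gs; apply/seteqP; split=> x [Px Fx]; split=> //; move: Px;
  by rewrite /gal_prime /= Gs.
Qed.

(** If x lies in E then s x lies in s E, and inertia at P acts on s E as inertia at s^-1 P acts on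
    E. These two primes induce the same prime of F. *)
Lemma max_unramified_gal s x : G s -> max_unramified F S x -> max_unramified F S (s x).
Proof.
move=> Gs [E [sfE FE uE Ex]]; exists [set y | E ((s^-1)%g y)]; split.
- split=> [|y z Ey Ez|y z Ey Ez] /=; rewrite ?rmorph1 ?rmorphB ?fmorph_div.
  + exact: subfield1.
  + exact: subfieldB.
  + exact: subfield_div.
- by move=> y Fy /=; rewrite (gal_overV Gs) //; apply: FE.
- move=> P fP SP t [tP Gt] y /= Ey.
  have : gal_over E (s^-1 * t * s)%g.
    apply: uE (finite_prime_gal s fP) _ _ _; first by rewrite gal_primeF.
    split; last by apply: gal_overM => //; apply: gal_overM => //; apply: gal_overV.
    move=> z Oz; suff : P (s ((s^-1 * t * s)%g z - z)) by [].
    by rewrite rmorphB !galMx galKV; apply/tP/integers_gal.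
  by move=> /(_ _ Ey); rewrite !galMx galKV => /(congr1 s); rewrite !galKV.
- by rewrite /= galVK.
Qed.

Lemma twist_coboundary H s c : coboundary_on act H c ->
  coboundary_on act [set t | H (s * t * s^-1)%g] (twist s c).
Proof.
move=> [a ca]; exists (act (s^-1)%g a) => t Ht.
by rewrite /twist ca // actB -!actM !mulgA mulVg mul1g.
Qed.

(** Conjugation by s carries the decomposition group of P to that of s P, so the local condition at
    P for the twist is the one at s P for c. Infinite places are moved likewise. *)
Lemma fine_cocycle_twist E s c : F `<=` E -> E `<=` L -> G s -> Z E c -> Z E (twist s c).
Proof.
move=> FE EL Gs [[kc cc] Pc wc].
have conjE t (Et : gal_over E t) := proj1 (gal_conj FE EL Gs Et); split.
- split; last first.
    move=> t u Et Eu; rewrite /twist -[gal_comp t u]/(t * u)%g.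
    have -> : (s * (t * u) * s^-1 = gal_comp (s * t * s^-1) (s * u * s^-1))%g.
      by rewrite -[RHS]/((s * t * s^-1) * (s * u * s^-1))%g !mulgA mulgVK.
    rewrite cc; [|exact: conjE..]; rewrite actD; congr (_ + _).
    by rewrite -!actM !mulgA mulVg mul1g.
  move=> t Et; have [r [rX rP]] := kc _ (conjE t Et).
  exists [seq (s^-1)%g x | x <- r]; split.
    move=> _ /mapP[x /rX Xx ->]; apply: max_unramified_gal => //.
    exact: gal_overV.
  move=> u Eu ut; rewrite /twist (rP _ (conjE u Eu)) // => x xr.
  by rewrite !galMx ut // map_f.
- move=> P fP SP; have Gs' := gal_overV Gs.
  have := Pc _ (finite_prime_gal (s^-1)%g fP); rewrite gal_primeF // => /(_ SP).
  move=> /(twist_coboundary s); apply: coboundaryS => t [Et tP]; split.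
    exact: conjE.
  move=> x; rewrite -[gal_prime _ _ ((s * t * s^-1)%g x)]/(P ((s^-1)%g ((s * t * s^-1)%g x))).
  by rewrite !galMx galVK; apply: tP.
- move=> w; have := wc (w * s^-1)%g; move=> /(twist_coboundary s).
  apply: coboundaryS => t [Et tw]; split; first exact: conjE.
  by move=> x; rewrite !galMx galVK; apply: tw.
Qed.

(** Expanding c(u t u^-1) by the cocycle relation leaves the coboundary of c(u^-1). This is why the
    class of [twist s c] depends only on s in Gal(E/F). *)
Lemma twist_inner E u c : cocycle act F S E c -> gal_over E u ->
  coboundary_on act (gal_over E) (twist u c - c).
Proof.
move=> cE Eu; have c1 := cocycle1 cE; case: cE => _ cc.
have Eu' := gal_overV Eu; exists (c (u^-1)%g) => t Et.
rewrite !fctE /twist (cc (u * t)%g (u^-1)%g) ?(cc u t) //; last exact: gal_overM.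
rewrite !actD -!actM !mulgA mulVg !mul1g act1.
have -> : act (u^-1)%g (c u) = - c (u^-1)%g.
  apply/eqP; rewrite -addr_eq0 addrC; apply/eqP.
  by rewrite -(cc (u^-1)%g u) // -[gal_comp _ _]/(u^-1 * u)%g mulVg.
by rewrite addrAC addrK addrC.
Qed.

(** * The action of the Iwasawa algebra on the dual fine Selmer group *)

Section Dual.
Variable R : realType.
Hypothesis finE : forall E : finite_sub F L, finite_set (gal_reps E).
Local Notation I := (finite_sub F L).
Local Notation Y := (@dual_fine_selmer R O A act F S L).
Local Notation iw := (@iwasawa_algebra O F L).
Local Notation scaleY := (@dual_scale R O A act F S L).
Variables (phi : I -> (absGal -> A) -> circle R) (Yphi : Y phi).

Lemma dualD (E : I) c d : Z (sval E) c -> Z (sval E) d ->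
  phi E (c + d) = phi E c + phi E d.
Proof. by case: Yphi => _ + _ _; apply. Qed.

Lemma dual0 (E : I) : phi E 0 = 0.
Proof.
have Z0 := fine_cocycle0 (sval E); apply: (addrI (phi E 0)).
by rewrite -dualD // !addr0.
Qed.

Lemma dualB (E : I) c d : Z (sval E) c -> Z (sval E) d ->
  phi E (c - d) = phi E c - phi E d.
Proof.
move=> Zc Zd; apply: (addIr (phi E d)); rewrite -dualD ?subrK //.
exact: fine_cocycleB.
Qed.

Lemma dual_sum (E : I) (T : eqType) (q : seq T) (f : T -> absGal -> A) :
  (forall i, i \in q -> Z (sval E) (f i)) ->
  phi E (fun u => \sum_(i <- q) f i u) = \sum_(i <- q) phi E (f i).
Proof.
elim: q => [|i q IHq] Zf.
  rewrite big_nil -(dual0 E); congr (phi E _).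
  by apply/funext => u; rewrite big_nil.
have Zq j : j \in q -> Z (sval E) (f j) by move=> jq; apply: Zf; rewrite inE jq orbT.
rewrite big_cons -(IHq Zq) -dualD; [|by apply: Zf; rewrite mem_head|exact: fine_cocycle_sum].
by congr (phi E _); apply/funext => u; rewrite big_cons.
Qed.

Lemma dual_cobound (E : I) c d : Z (sval E) c -> Z (sval E) d ->
  coboundary_on act (gal_over (sval E)) (c - d) -> phi E c = phi E d.
Proof. by case: Yphi => _ _ + _; apply. Qed.

Lemma dual_res (E E' : I) c : sval E `<=` sval E' -> Z (sval E) c ->
  phi E c = phi E' c.
Proof. by case: Yphi => _ _ _; apply. Qed.

Lemma dual_out (E : I) c : ~ Z (sval E) c -> phi E c = 0.
Proof. by case: Yphi => + _ _ _; apply. Qed.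

Lemma fine_cocycle_twist_sub (E : I) s c : G s -> Z (sval E) c -> Z (sval E) (twist s c).
Proof. by apply: fine_cocycle_twist; [apply: finite_sub_base|apply: finite_sub_top]. Qed.

Lemma twist_agree (E : I) s t c : G s -> G t -> agree E s t -> Z (sval E) c ->
  coboundary_on act (gal_over (sval E)) (twist s c - twist t c).
Proof.
move=> Gs Gt st Zc; have Zt := fine_cocycle_twist_sub Gt Zc.
have Eu : gal_over (sval E) (t^-1 * s)%g.
  by apply/agree_gal_over => //; apply: agree_sym.
have cE : cocycle act F S (sval E) (twist t c) by case: Zt.
have := twist_inner cE Eu.
by rewrite twistM mulVKg.
Qed.

Lemma dual_twist_class (E : I) r c : Z (sval E) c ->
  class_fun E (fun s => phi E (fun u => r *: twist s c u)).
Proof.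
move=> Zc s t Gs Gt st.
have [Zs Zt] := (fine_cocycle_twist_sub Gs Zc, fine_cocycle_twist_sub Gt Zc).
apply: dual_cobound; [exact: fine_cocycleZ|exact: fine_cocycleZ|].
rewrite (_ : _ - _ = fun u => r *: (twist s c - twist t c) u).
  exact/coboundary_scale/twist_agree.
by apply/funext => u; rewrite !fctE scalerBr.
Qed.

Lemma dual_scalerB (E : I) r1 r2 c : Z (sval E) c ->
  phi E (fun u => (r1 - r2) *: c u) =
  phi E (fun u => r1 *: c u) - phi E (fun u => r2 *: c u).
Proof.
move=> Zc; rewrite -dualB; [|exact: fine_cocycleZ..].
by congr (phi E _); apply/funext => u; rewrite !fctE scalerBl.
Qed.

Lemma dual_scaler_sum (E : I) (T : Type) (q : seq T) (P : pred T) (f : T -> O) c :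
  Z (sval E) c ->
  phi E (fun u => (\sum_(i <- q | P i) f i) *: c u) =
  \sum_(i <- q | P i) phi E (fun u => f i *: c u).
Proof.
move=> Zc; apply: (big_morph (fun r => phi E (fun u => r *: c u))) => [r1 r2|] /=.
  apply: etrans (dualD (fine_cocycleZ r1 Zc) (fine_cocycleZ r2 Zc)).
  by congr (phi E _); apply/funext => u; rewrite !fctE scalerDl.
by rewrite -(dual0 E); congr (phi E _); apply/funext => u; rewrite scale0r.
Qed.

Lemma dual_scaleE x (E : I) c : Z (sval E) c ->
  scaleY x phi E c = \sum_(s <- gal_seq E) phi E (fun u => x E s *: twist s c u).
Proof.
move=> Zc; rewrite /dual_scale asboolT // -dual_sum; last first.
  by move=> s /(gal_seqG finE) Gs; apply/fine_cocycleZ/fine_cocycle_twist_sub.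
by congr (phi E _); apply/funext => u; rewrite fsum_gal_reps.
Qed.

Lemma dual_scale_out x (E : I) c : ~ Z (sval E) c -> scaleY x phi E c = 0.
Proof. by move=> nZ; rewrite /dual_scale asboolF. Qed.

Lemma twist_add s c d : twist s (c + d) = twist s c + twist s d.
Proof. by apply/funext => u; rewrite /twist !fctE actD. Qed.

Lemma dual_scale_dual x : iw x -> Y (scaleY x phi).
Proof.
move=> ix; split=> [E c|E c d Zc Zd|E c d Zc Zd [a cd]|E E' c EE' Zc].
- exact: dual_scale_out.
- have Zcd := fine_cocycleD Zc Zd; rewrite !dual_scaleE // -big_split.
  apply: eq_gal_sum => // s Gs.
  rewrite /= -dualD; [|exact/fine_cocycleZ/fine_cocycle_twist_sub..]; congr (phi E _).
  by apply/funext => u; rewrite twist_add !fctE scalerDr.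
- rewrite !dual_scaleE //; apply: eq_gal_sum => // s Gs.
  apply: dual_cobound; [exact/fine_cocycleZ/fine_cocycle_twist_sub..|].
  rewrite (_ : _ - _ = fun u => x E s *: twist s (c - d) u); last first.
    by apply/funext => u; rewrite twist_sub !fctE scalerBr.
  apply: coboundary_scale.
  have /(twist_coboundary s) : coboundary_on act (gal_over (sval E)) (c - d) by exists a.
  apply: coboundaryS => t Et.
  by have [] := gal_conj (finite_sub_base E) (@finite_sub_top _ _ E) Gs Et.
have Zc' := fine_cocycle_res EE' Zc.
rewrite !dual_scaleE // [RHS](gal_sum_fiber finE E); apply: eq_gal_sum => // s Gs.
have Zs := fine_cocycle_twist_sub Gs Zc; have Zs' := fine_cocycle_res EE' Zs.
rewrite (dual_res EE') ?(iw_compat finE ix EE' Gs) ?dual_scaler_sum //; last exact: fine_cocycleZ.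
rewrite big_seq_cond [RHS]big_seq_cond.
apply: eq_bigr => t /andP[/(gal_seqG finE) Gt /asboolP st].
have Zt := fine_cocycle_twist_sub Gt Zc; have Zt' := fine_cocycle_res EE' Zt.
apply: dual_cobound; [exact: fine_cocycleZ..|].
rewrite (_ : _ - _ = fun u => x E' t *: (twist s c - twist t c) u); last first.
  by apply/funext => u; rewrite !fctE scalerBr.
apply: coboundary_scale; apply: coboundaryS (twist_agree Gs Gt st Zc).
exact: gal_overS.
Qed.

Lemma dual_scale_one : scaleY (@iwasawa_one O F L) phi = phi.
Proof.
apply/funext => E; apply/funext => c; have [Zc|nZ] := pselect (Z (sval E) c); last first.
  by rewrite dual_scale_out // dual_out.
rewrite dual_scaleE // iw_one_delta.
have pick := gal_sum_pick finE (dual_twist_class 1 Zc) (@gal_over1 F).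
transitivity (phi E (fun u => 1 *: twist 1%g c u)); last first.
  congr (phi E _); apply/funext => u.
  by rewrite scale1r /twist invg1 act1 mul1g mulg1.
rewrite -pick [RHS]big_mkcond; apply: eq_gal_sum => // s Gs; rewrite iw_deltaE //.
case: `[< _ >] => //; rewrite -[RHS](dual0 E).
by congr (phi E _); apply/funext => u; rewrite scale0r.
Qed.

End Dual.

Lemma dual_scale_mul (R : realType) x y phi :
  (forall E : finite_sub F L, finite_set (gal_reps E)) ->
  @iwasawa_algebra O F L x -> @iwasawa_algebra O F L y ->
  @dual_fine_selmer R O A act F S L phi ->
  dual_scale act S (iwasawa_mul x y) phi = dual_scale act S x (dual_scale act S y phi).
Proof.
move=> finE ix iy Yphi; have Yy := dual_scale_dual finE Yphi iy.
apply/funext => E; apply/funext => c; have [Zc|nZ] := pselect (Z (sval E) c); last first.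
  by rewrite !dual_scale_out.
rewrite (dual_scaleE finE Yphi) // (dual_scaleE finE Yy) //.
pose f t s := phi E (fun u => (x E t * y E s) *: twist (t * s)%g c u).
transitivity (\sum_(t <- gal_seq E) \sum_(s <- gal_seq E) f t s).
  transitivity (\sum_(s <- gal_seq E) \sum_(t <- gal_seq E) f t (t^-1 * s)%g).
    apply: eq_gal_sum => // s Gs; rewrite (iw_mulE finE) // (dual_scaler_sum Yphi);
      last exact: fine_cocycle_twist_sub.
    by apply: eq_bigr => t _; rewrite /f mulVKg.
  rewrite exchange_big; apply: eq_gal_sum => // t Gt /=.
  rewrite -[RHS](gal_sumM finE (gal_overV Gt)) // => s s' Gs Gs' ss'.
  rewrite /f (iw_class iy Gs Gs' ss').
  apply: (dual_twist_class Yphi) => //; [exact: gal_overM..|exact: agreeMl].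
apply: eq_gal_sum => // t Gt; have Zt := fine_cocycle_twist_sub Gt Zc.
rewrite (dual_scaleE finE Yphi); last exact: fine_cocycleZ.
apply: eq_gal_sum => // s Gs; congr (phi E _); apply/funext => u.
by rewrite twist_scale twistM scalerA mulrC.
Qed.

(** The element g^2 - (r1 g - r2), bracketed as in the relation [quad_g] for the action of g^-1. *)
Definition iw_quadratic (L0 : set algC) (g : absGal) r1 r2 : finite_sub F L0 -> absGal -> O :=
  @iw_delta O F L0 (g * g)%g -
  ((fun (E : finite_sub F L0) s => r1 * iw_delta O g E s) -
   (fun (E : finite_sub F L0) s => r2 * iw_delta O 1%g E s)).

(** * Classes which die over the larger extension *)

Section CayleyHamilton.
Variables (R : realType) (L' : set algC) (LL' : L `<=` L').
Hypothesis abelL' : forall s t x, gal_over F s -> gal_over F t -> L' x ->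
  s (t x) = t (s x).
Hypothesis finE : forall E : finite_sub F L, finite_set (gal_reps E).
Hypothesis dirL : forall E1 E2 : finite_sub F L, exists E : finite_sub F L,
  sval E1 `<=` sval E /\ sval E2 `<=` sval E.
Hypothesis dirL' : forall E1 E2 : finite_sub F L', exists E : finite_sub F L',
  sval E1 `<=` sval E /\ sval E2 `<=` sval E.
Variables (h : absGal) (Lh : gal_over L h).
Hypothesis h_fiber : forall E : finite_sub F L', exists2 E1 : finite_sub F L',
  sval E1 `<=` L & forall s, gal_over (sval E1) s -> exists i, agree E s (h ^+ i)%g.
Variables (g : absGal) (Gg : G g) (r1 r2 : O).
Hypothesis quad_g : forall a,
  act (g^-1)%g (act (g^-1)%g a) - (r1 *: act (g^-1)%g a - r2 *: a) = 0.

Lemma iw_quadratic_iw : @iwasawa_algebra O F L (iw_quadratic g r1 r2).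
Proof.
have Gd u : G u -> @iwasawa_algebra O F L (iw_delta O u) by apply: iw_delta_iw.
apply: iw_sub => //; first exact/Gd/gal_overM.
by apply: iw_sub => //; apply: iw_scale => //; apply: Gd.
Qed.

Lemma dual_delta (phi : finite_sub F L -> (absGal -> A) -> circle R) (E : finite_sub F L) u r c :
  dual_fine_selmer act S phi -> Z (sval E) c -> G u ->
  \sum_(s <- gal_seq E) phi E (fun t => (r * iw_delta O u E s) *: twist s c t) =
  phi E (fun t => r *: twist u c t).
Proof.
move=> Yphi Zc Gu; rewrite -(gal_sum_pick finE (dual_twist_class Yphi r Zc) Gu).
rewrite [RHS]big_mkcond; apply: eq_gal_sum => // s Gs; rewrite iw_deltaE //.
case: `[< _ >]; first by rewrite mulr1.
rewrite mulr0 -[RHS](dual0 Yphi E).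
by congr (phi E _); apply/funext => t; rewrite scale0r.
Qed.

(* A class of R(A/L) which dies over L' is inflated from the pro-cyclic group
   generated by [h], so it is determined by the values of a cocycle at the
   powers of [h], on which Gal(L/F) acts through [act]. *)
Lemma quadratic_coboundary (E : finite_sub F L) (E' : finite_sub F L') c :
  cocycle act F S (sval E) c -> coboundary_on act (gal_over (sval E')) c ->
  exists E1 : finite_sub F L, sval E `<=` sval E1 /\
    coboundary_on act (gal_over (sval E1))
      (twist (g * g)%g c - ((fun u => r1 *: twist g c u) - (fun u => r2 *: twist 1%g c u))).
Proof.
move=> [_ cc] [a ca].
have [E2 [E'2 E2P]] := dirL' E' (widen_sub LL' E).
have [E3 E3L E3P] := h_fiber E2; have [E4 E4E3] := widen_sub_surj LL' E3L.
have [E1 [EE1 E41]] := dirL E E4; exists E1; split=> //.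
have K3 u : gal_over (sval E1) u -> gal_over (sval E3) u.
  by rewrite -E4E3; apply: gal_overS.
(* Cohomologous to [c] and zero on Gal(algC/E'). *)
pose c' u := c u - (act u a - a).
have c'M u w : gal_over (sval E) u -> gal_over (sval E) w ->
    c' (u * w)%g = c' u + act u (c' w).
  move=> Eu Ew; rewrite /c' -[(u * w)%g]/(gal_comp u w) cc //.
  rewrite -[act (gal_comp u w) a]/(act (u * w)%g a) actM !actB.
  by rewrite !opprB [RHS]addrACA; congr (_ + _); rewrite addrA subrK.
have Eh i : gal_over (sval E) (h ^+ i)%g.
  by apply: gal_overX; apply: gal_overS Lh; apply: finite_sub_top.
(* On [E2] both [u] and its conjugates, equal there by commutativity, agree with some h^i; since
   [c'] vanishes over [E2], all these values are c'(h^i). *)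
have c'conj u : gal_over (sval E1) u ->
    exists w, forall s, G s -> c' (s * u * s^-1)%g = w.
  move=> E1u; have Gu : G u by apply: gal_overS E1u; apply: finite_sub_base.
  have [i ui] := E3P u (K3 u E1u); exists (c' (h ^+ i)%g) => s Gs.
  pose v := (h ^- i * (s * u * s^-1))%g.
  have E2v : gal_over (sval E2) v.
    apply/agree_gal_over; first by apply: gal_overX; apply: gal_overS Lh; exact: FL.
    apply: agree_trans (agree_sym ui) _ => x /finite_sub_top L'x.
    by rewrite !galMx -(abelL' (gal_overV Gs) Gu L'x) galKV.
  have Ev : gal_over (sval E) v by apply: gal_overS E2v; exact: E2P.
  have E'v : gal_over (sval E') v by apply: gal_overS E2v.
  rewrite -(mulVKg (h ^+ i)%g (s * u * s^-1)%g) -/v c'M // [c' v]/c' ca // subrr.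
  by rewrite act0 addr0.
(* The quadratic relation kills the contribution of [w], so only the coboundary part, transformed by
   the same quadratic expression, remains. *)
exists (act ((g * g)^-1)%g a - (r1 *: act (g^-1)%g a - r2 *: act (1^-1)%g a)) => u E1u.
have [w wP] := c'conj u E1u.
have twE s : G s -> twist s c u =
    act (s^-1)%g w + (act u (act (s^-1)%g a) - act (s^-1)%g a).
  move=> Gs; rewrite -(wP s Gs) /c' /twist !actB -!actM !mulgA mulVg mul1g.
  by rewrite subrK.
have addrBD (x y z t : A) : (x + y) - (z + t) = (x - z) + (y - t).
  by rewrite opprD addrACA.
have subrBB (x y z t : A) : (x - y) - (z - t) = (x - z) - (y - t).
  by rewrite !opprD !opprK addrACA.
have key (p q z x x' y y' t t' : A) :
    p + (x' - x) - (r1 *: (q + (y' - y)) - r2 *: (z + (t' - t))) =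
    (p - (r1 *: q - r2 *: z)) +
    ((x' - (r1 *: y' - r2 *: t')) - (x - (r1 *: y - r2 *: t))).
  rewrite 2!(scalerDr _ _ (_ - _)) !scalerBr (addrBD (r1 *: q)) (addrBD p); congr (_ + _).
  by rewrite (subrBB (r1 *: y')) (subrBB x').
rewrite !fctE !twE //; last exact: gal_overM.
rewrite key !actB !actZ invgM actM invg1 act1 quad_g add0r.
by rewrite -!actM.
Qed.

Lemma dual_scale_quadratic (phi : finite_sub F L -> (absGal -> A) -> circle R)
    (E : finite_sub F L) (E' : finite_sub F L') c :
  dual_fine_selmer act S phi -> Z (sval E) c ->
  coboundary_on act (gal_over (sval E')) c ->
  dual_scale act S (iw_quadratic g r1 r2) phi E c = 0.
Proof.
move=> Yphi Zc cE'; have cocE : cocycle act F S (sval E) c by case: Zc.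
have [E1 [EE1 cE1]] := quadratic_coboundary cocE cE'.
have Zt u : G u -> Z (sval E) (twist u c) by move=> Gu; apply: fine_cocycle_twist_sub.
have Ggg := gal_overM Gg Gg; have G1 := @gal_over1 F.
have Zr u r (Gu : G u) := fine_cocycleZ r (Zt u Gu).
pose c2 := twist (g * g)%g c - ((fun u => r1 *: twist g c u) - (fun u => r2 *: twist 1%g c u)).
have Zc2 : Z (sval E) c2 by apply: fine_cocycleB; [exact: Zt|apply: fine_cocycleB; exact: Zr].
transitivity (phi E c2).
  rewrite (dual_scaleE finE) // /c2 (dualB Yphi) ?(dualB Yphi); try by [exact: Zt|exact: Zr].
    rewrite -(dual_delta r1 Yphi Zc Gg) -(dual_delta r2 Yphi Zc G1).
    have -> : phi E (twist (g * g)%g c) = phi E (fun u => 1 *: twist (g * g)%g c u).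
      by congr (phi E _); apply/funext => u; rewrite scale1r.
    rewrite -(dual_delta 1 Yphi Zc Ggg) -!sumrB; apply: eq_gal_sum => // s Gs.
    by rewrite mul1r -!(dual_scalerB Yphi) //; exact: Zt.
  by apply: fine_cocycleB; exact: Zr.
rewrite (dual_res Yphi EE1 Zc2) -(dual0 Yphi E1); apply: (dual_cobound Yphi).
- exact: fine_cocycle_res Zc2.
- exact: fine_cocycle0.
- by rewrite subr0.
Qed.

End CayleyHamilton.

End Cocycles.
End GaloisModule.

(** * Extension of characters *)

Lemma circle_divisible (R : realType) (x : circle R) n : (0 < n)%N ->
  exists y : circle R, y *+ n = x.
Proof.
move=> n0; exists (\pi_(circle R) (repr x / n%:R))%qT.
rewrite -[RHS](reprK x) -raddfMn; congr (\pi_(circle R) _)%qT.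
by rewrite -(mulr_natr (repr x / n%:R)) divfK // pnatr_eq0 -lt0n.
Qed.

Section DivisibleExtension.
Variables (M D : zmodType).
Hypothesis divD : forall (x : D) n, (0 < n)%N -> exists y, y *+ n = x.
Implicit Types (X Y : set (M * D)).

(** The graph of a homomorphism from a subgroup of M to D; for a subgroup of the product,
    single-valuedness reduces to the last clause. *)
Definition partial_morphism X := [/\ X (0, 0),
  forall a b, X a -> X b -> X (a - b) & forall d, X (0, d) -> d = 0].

Lemma partial_morphism_intmul X a (z : int) : partial_morphism X -> X a -> X (a *~ z).
Proof.
move=> [X0 XB _] Xa.
have XN b : X b -> X (- b) by rewrite -sub0r; apply: XB.
have Xn n : X (a *+ n).
  elim: n => [|n IHn]; first by rewrite mulr0n.
  by rewrite mulrSr -[a in _ + a]opprK; apply/XB/XN.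
by case: z => n; [apply: Xn|apply/XN/Xn].
Qed.

(* The multiples of [m] in the domain of [X] are those of the least positive
   one, [m *+ n], and [e] is chosen with [e *+ n] the value there. *)
Lemma partial_morphism_value X m : partial_morphism X ->
  exists e, forall z d, X (m *~ z, d) -> X (m *~ z, e *~ z).
Proof.
move=> pX; have [X0 XB X_fun] := pX.
pose dom n := `[< (0 < n)%N /\ exists d, X (m *+ n, d) >].
have [ex|none] := pselect (exists n, dom n); last first.
  exists 0 => z d Xzd; have [->|z0] := eqVneq z 0; first by rewrite !mulr0z.
  exfalso; apply: none; exists `|z|%N; apply/asboolP; rewrite absz_gt0; split=> //.
  have := partial_morphism_intmul (sgz z) pX Xzd.
  have -> : (m *~ z, d) *~ sgz z = (m *~ z *~ sgz z, d *~ sgz z).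
    by rewrite [LHS]surjective_pairing !raddfMz.
  by rewrite -mulrzA mulrC -abszEsg => ?; exists (d *~ sgz z).
case: (ex_minnP ex) => n /asboolP[n0 [d0 Xd0]] n_min.
have [e en] := divD d0 n0; exists e => z d Xzd.
have pairM (b : M) (c : D) y : (b, c) *~ y = (b *~ y, c *~ y).
  by rewrite [LHS]surjective_pairing !raddfMz.
pose q := (z %/ n)%Z; have Xq : X (m *+ n *~ q, d0 *~ q).
  by rewrite -pairM; apply: partial_morphism_intmul.
have [r0|r0] := eqVneq (z %% n)%Z 0.
  by rewrite (divz_eq z n) r0 addr0 mulrC !mulrzA -!pmulrn en.
exfalso; have nz : (n : int) != 0 by rewrite eqz_nat -lt0n.
have rE : (z %% n)%Z = `|(z %% n)%Z|%N by rewrite gez0_abs // modz_ge0.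
have rn : (`|(z %% n)%Z| < n)%N by rewrite -ltz_nat -rE ltz_pmod.
suff : dom `|(z %% n)%Z|%N by move=> /n_min; rewrite leqNgt rn.
apply/asboolP; rewrite absz_gt0; split=> //; exists (d - d0 *~ q).
have -> : m *+ `|(z %% n)%Z| = m *~ z - m *+ n *~ q.
  by rewrite [LHS]pmulrn -rE [LHS]mulrzBr [(_ * _)%R]mulrC [X in _ - X]mulrzA.
exact: XB Xzd Xq.
Qed.

(* Zorn's lemma on the graphs of partial extensions. *)
Lemma divisible_extension (N : set M) (f : M -> D) :
  N 0 -> (forall x y, N x -> N y -> N (x - y)) ->
  (forall x y, N x -> N y -> f (x - y) = f x - f y) ->
  exists g : M -> D, (forall x y, g (x + y) = g x + g y) /\ forall x, N x -> g x = f x.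
Proof.
move=> N0 NB fB; pose X0 : set (M * D) := [set (x, f x) | x in N].
have f0 : f 0 = 0 by rewrite -[in LHS](subrr 0) fB // subrr.
(* Only the part added to [X0] varies, so the union of the empty chain is good as well. *)
pose good Y := partial_morphism (X0 `|` Y).
have good0 : good set0.
  rewrite /good setU0; split=> [|_ _ [x Nx <-] [y Ny <-]|d [x Nx [x0 <-]]].
  - by exists 0; rewrite ?f0.
  - by exists (x - y); rewrite ?fB //; apply: NB.
  - by rewrite x0.
have [Q Qgood Qtot|Y [gY Ymax]] := @Zorn_bigcup _ good.
  pose U := \bigcup_(Y in Q) Y.
  have dirU a b : (X0 `|` U) a -> (X0 `|` U) b ->
      exists Y, [/\ good Y, Y `<=` U, (X0 `|` Y) a & (X0 `|` Y) b].
    have YU Y : Q Y -> Y `<=` U by move=> QY x Yx; exists Y.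
    move=> [Xa|[Y QY Ya]] [Xb|[Y' QY' Y'b]].
    - by exists set0; split=> //; left.
    - by exists Y'; split; [exact: Qgood|exact: YU|left|right].
    - by exists Y; split; [exact: Qgood|exact: YU|right|left].
    - have [YY'|Y'Y] := Qtot _ _ QY QY'.
        by exists Y'; split; [exact: Qgood|exact: YU|right; apply: YY'|right].
      by exists Y; split; [exact: Qgood|exact: YU|right|right; apply: Y'Y].
  split=> [|a b Ua Ub|d Ud].
  - by left; exists 0; rewrite ?f0.
  - have [Y [[_ YB _] YU Ya Yb]] := dirU a b Ua Ub.
    by case: (YB a b Ya Yb) => [|/YU]; [left|right].
  - have [Y [[_ _ Yf] _ Yd _]] := dirU _ _ Ud Ud.
    exact: Yf.
set X := X0 `|` Y in gY; have [XX0 XB Xf] := gY.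
have pairB (a b : M * D) : a - b = (a.1 - b.1, a.2 - b.2) by [].
have fun_X m d d' : X (m, d) -> X (m, d') -> d = d'.
  move=> Xd Xd'; apply/eqP; rewrite -subr_eq0; apply/eqP/Xf.
  by have := XB _ _ Xd Xd'; rewrite pairB /= subrr.
have total m : exists d, X (m, d).
  apply: contrapT => nd; have [e eP] := partial_morphism_value m gY.
  pose Y' : set (M * D) :=
    [set b | exists a z, X a /\ b = (a.1 + m *~ z, a.2 + e *~ z)].
  have XY' : X `<=` Y'.
    by move=> [x d] Xa; exists (x, d), 0; rewrite !mulr0z !addr0.
  have Y'm : Y' (m, e) by exists 0, 1; rewrite !mulr1z !add0r; split.
  apply: (Ymax Y').
    split=> [a Ya|Y'Y]; first by apply: XY'; right.
    by apply: nd; exists e; right; apply: Y'Y.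
  rewrite /good setUidr; last by move=> a X0a; apply: XY'; left.
  split=> [|_ _ [a [z [Xa ->]]] [b [z' [Xb ->]]]|d [[x c] [z [Xa /= [xz ->]]]]].
  - exact: XY'.
  - exists (a - b), (z - z'); split; first exact: XB.
    by rewrite !pairB /= !mulrzBr !opprD ![_ + (- _ - _)]addrACA.
  - have xE : x = m *~ (- z) by apply/eqP; rewrite mulrNz -addr_eq0 -xz.
    rewrite xE in Xa; rewrite (fun_X _ _ _ Xa (eP _ _ Xa)) mulrNz.
    by rewrite addNr.
pose g m := projT1 (cid (total m)); have gP m : X (m, g m) by apply: projT2 (cid (total m)).
exists g; split=> [x y|x Nx]; last first.
  by apply: fun_X (gP x) _; left; exists x.
apply/(addIr (- g y))/(fun_X x); last by rewrite addrK.
by have := XB _ _ (gP (x + y)) (gP y); rewrite pairB /= addrK.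
Qed.

End DivisibleExtension.

(** * From characters of R(A/L) to characters of R(A/Loo) *)

Section ExtendDual.
Variables (O : comNzRingType) (A : lmodType O) (act : absGal -> A -> A).
Hypothesis actD : forall s a b, act s (a + b) = act s a + act s b.
Variables (R : realType) (F : set algC) (S : set (set algC)) (L L' : set algC).
Variable LL' : L `<=` L'.
Hypothesis dirL : forall E1 E2 : finite_sub F L, exists E : finite_sub F L,
  sval E1 `<=` sval E /\ sval E2 `<=` sval E.
Hypothesis dirL' : forall E1 E2 : finite_sub F L', exists E : finite_sub F L',
  sval E1 `<=` sval E /\ sval E2 `<=` sval E.
Local Notation Z := (fine_cocycle act F S).
Variables (phi : finite_sub F L -> (absGal -> A) -> circle R).
Hypothesis Yphi : dual_fine_selmer act S phi.
Hypothesis phi_res : forall (E : finite_sub F L) (E' : finite_sub F L') c,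
  Z (sval E) c -> coboundary_on act (gal_over (sval E')) c -> phi E c = 0.
Implicit Types (c d : absGal -> A).

(** The graph of the character induced by phi on the image of R(A/L) in the limit over L', with
    cocycles taken modulo coboundaries over some finite level. It is single-valued thanks to
    [phi_res]. *)
Definition limit_value c x := exists (E : finite_sub F L) (E' : finite_sub F L') d,
  [/\ Z (sval E) d, coboundary_on act (gal_over (sval E')) (c - d) & x = phi E d].

Lemma limit_valueB c d x y : limit_value c x -> limit_value d y ->
  limit_value (c - d) (x - y).
Proof.
move=> [E1 [E1' [c1 [Zc1 cc1 ->]]]] [E2 [E2' [d2 [Zd2 dd2 ->]]]].
have [E [E1E E2E]] := dirL E1 E2; have [E' [E1E' E2E']] := dirL' E1' E2'.
have [Zc Zd] := (fine_cocycle_res E1E Zc1, fine_cocycle_res E2E Zd2).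
exists E, E', (c1 - d2); split; first exact: fine_cocycleB.
- rewrite opprD addrACA -opprD.
  by apply: coboundary_sub => //; [apply: coboundaryS cc1|
    apply: coboundaryS dd2]; apply: gal_overS.
- by rewrite (dualB actD Yphi) // (dual_res Yphi E1E) // (dual_res Yphi E2E).
Qed.

Lemma limit_value0 x : limit_value 0 x -> x = 0.
Proof.
move=> [E [E' [d [Zd cd ->]]]]; apply: (@phi_res E E' d Zd).
by rewrite -[d](subKr 0); apply: coboundary_sub => //; apply: coboundary0.
Qed.

Lemma limit_value_fine (E : finite_sub F L) c : Z (sval E) c -> limit_value c (phi E c).
Proof.
move=> Zc; exists E, (widen_sub LL' E), c; split=> //.
by rewrite subrr; apply: coboundary0.
Qed.

Lemma limit_value_coboundary (E0 : finite_sub F L) (E' : finite_sub F L') c :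
  coboundary_on act (gal_over (sval E')) c -> limit_value c 0.
Proof.
move=> cE'; exists E0, E', 0; split; [exact: (fine_cocycle0 actD)|by rewrite subr0|].
by rewrite (dual0 actD Yphi).
Qed.

(** The extension is made on the group of all functions with values in A, at all levels together.
    Coboundaries have limit value 0, so it respects classes, and it ignores the level, so it is
    compatible with restriction. *)
Lemma dual_extension (E0 : finite_sub F L) :
  exists2 psi : finite_sub F L' -> (absGal -> A) -> circle R,
  dual_fine_selmer act S psi &
  forall E c, Z (sval E) c -> psi (widen_sub LL' E) c = phi E c.
Proof.
pose N := [set c | exists x, limit_value c x].
pose f c := xget 0 [set x | limit_value c x].
have fP c x : limit_value c x -> f c = x.
  move=> cx; have cf : limit_value c (f c).
    by apply: (@xgetPex _ 0 [set x | limit_value c x]); exists x.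
  apply/eqP; rewrite -subr_eq0; apply/eqP/limit_value0.
  by have := limit_valueB cf cx; rewrite subrr.
have [||c d [x cx] [y dy]|g [gD gf]] := @divisible_extension _ _ (@circle_divisible R) N f.
- exists 0; apply: (limit_value_coboundary E0).
  exact: (coboundary0 actD (gal_over (sval (widen_sub LL' E0)))).
- by move=> c d [x cx] [y dy]; exists (x - y); apply: limit_valueB.
- by rewrite (fP _ _ cx) (fP _ _ dy) (fP _ _ (limit_valueB cx dy)).
have gval c x : limit_value c x -> g c = x by move=> cx; rewrite gf ?(fP _ _ cx) //; exists x.
exists (fun E c => if `[< Z (sval E) c >] then g c else 0) => [|E c Zc]; last first.
  by rewrite asboolT //; apply/gval/limit_value_fine.
split=> [E c|E c d Zc Zd|E c d Zc Zd cd|E E' c EE' Zc].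
- by move=> nZ; rewrite asboolF.
- by rewrite !asboolT //; apply: fine_cocycleD.
- rewrite !asboolT // -[c](subrK d) gD.
  by rewrite (gval _ _ (limit_value_coboundary E0 cd)) add0r.
- by rewrite !asboolT //; apply: fine_cocycle_res Zc.
Qed.

End ExtendDual.

(** * Torsion from pseudo-nullity, for a module with a quadratic relation *)

Section TorsionFromPseudoNull.
Variables (p : nat) (p_prime : prime p) (p_odd : odd p) (R : realType).
Variables (O : comNzRingType) (J : adic_filtration p O).
Hypothesis domO : forall c d : O, c * d = 0 -> c = 0 \/ d = 0.
Variables (A : lmodType O) (act : absGal -> A -> A).
Hypothesis act1 : forall a, act 1%g a = a.
Hypothesis actM : forall s t a, act (s * t)%g a = act s (act t a).
Hypothesis actD : forall s a b, act s (a + b) = act s a + act s b.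
Hypothesis actZ : forall s (r : O) a, act s (r *: a) = r *: act s a.
Hypothesis act_quadratic : forall s, exists r1 r2 : O, forall a,
  act s (act s a) - (r1 *: act s a - r2 *: a) = 0.
Variables (F : set algC) (S : set (set algC)) (L L' : set algC).
Hypotheses (L_Zp : Zp_extension p 1 F L) (L'_Zp : Zp_extension p 2 F L').
Hypothesis LL' : L `<=` L'.

Lemma torsion_of_pseudo_null :
  dual_pseudo_null R act F S L' -> dual_torsion R act F S L.
Proof.
have [[sfF sfL FL _] [k kP]] := L_Zp; have [[_ sfL' FL' _] [k' kP']] := L'_Zp.
have abelL s t x := @Zp_comm p 1 F L FL k kP s t x.
have abelL' s t x := @Zp_comm p 2 F L' FL' k' kP' s t x.
have finE := Zp_finite_reps p_prime FL kP; have finE' := Zp_finite_reps p_prime FL' kP'.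
have dirL := @finite_sub_directed F L sfL; have dirL' := @finite_sub_directed F L' sfL'.
set G := gal_over F; pose E0 : finite_sub F L := exist _ F (conj (finite_ext_refl sfF) FL).
have [h [Lh Gh h_fiber _ _]] := kernel_generator p_prime p_odd J sfF sfL sfL' FL FL' LL' kP kP'.
have [g Gg gP] := Zp_generator kP; have [r1 [r2 quad]] := act_quadratic (g^-1)%g.
pose mu := iw_quadratic (F := F) (L0 := L) g r1 r2.
have imu : iwasawa_algebra mu by apply: (iw_quadratic_iw finE Gg).
have mu0 : mu <> 0.
  (* A level which separates the coordinates 2, 1 and 0 modulo p of g^2, g and 1: there the
     coefficient of [mu] at g^2 is 1. *)
  have [E EP] := Zp_kap_open sfF sfL FL kP ord0 1.
  move=> /(congr1 (fun z => z E (g * g)%g)) /eqP; apply/negP.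
  have Ggg := gal_overM Gg Gg; rewrite /mu /iw_quadratic !fctE !iw_deltaE //.
  rewrite asboolT; last exact: agree_refl.
  have kE s t : G s -> G t -> agree E s t -> k s ord0 1 = k t ord0 1.
    move=> Gs Gt /(agree_gal_over _ _ Gs) /EP kst.
    rewrite -(mulVKg s t) (ZpM kP) ?kst ?addn0 ?modn_small ?Zp_small //.
    exact/gal_overM/Gt/gal_overV.
  have p2 : (2 < p)%N by rewrite odd_prime_gt2.
  have kg : k g ord0 1 = 1%N by rewrite gP expn1 modn_small // prime_gt1.
  have kgg : k (g * g)%g ord0 1 = 2%N.
    by rewrite (ZpM kP) // kg expn1 modn_small.
  rewrite asboolF => [|/(kE _ _ Ggg Gg)]; last by rewrite kg kgg.
  rewrite asboolF => [|/(kE _ _ Ggg (@gal_over1 F))]; last by rewrite kgg (Zp_id FL kP).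
  by rewrite !mulr0 subr0 subr0 oner_eq0.
move=> pn phi Yphi.
have kp := kernel_prime p_prime p_odd J domO sfF sfL FL FL' LL' kP kP'.
have kh := kernel_height p_prime p_odd J sfF sfL sfL' FL FL' (LL' := LL') kP kP'.
have Yphi' := dual_scale_dual act1 actM actD actZ abelL finE Yphi imu.
have [psi Ypsi psiE] := dual_extension actD LL' dirL dirL' Yphi'
   (fun E E' c => dual_scale_quadratic act1 actM actD actZ FL abelL LL' abelL' finE dirL dirL' Lh
     h_fiber Gg quad Yphi) E0.
have P1 : ~ kernel_ideal LL' (@iwasawa_one O F L') by case: kp => -[].
have i1 : iwasawa_algebra (@iwasawa_one O F L').
  by rewrite iw_one_delta; apply: (iw_delta_iw O finE').
(* The fraction psi/1 vanishes in the localization at the kernel, so some [u] outside the kernel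
   kills [psi]. *)
have [u [iu Pu]] := pn _ kp kh psi (@iwasawa_one O F L') Ypsi i1 P1.
have Y0 : @dual_fine_selmer R O A act F S L' 0.
  by split=> // *; rewrite !fctE ?addr0.
have one := dual_scale_one act1 actM actD actZ abelL' finE'.
rewrite (one _ _ _ Ypsi) (one _ _ _ Y0) subr0 => upsi0.
pose a := iw_proj LL' u; have ia : iwasawa_algebra a.
  exact: (iw_proj_iw p_prime FL FL' LL' kP kP').
have a0 : a <> 0 by move=> a0; apply: Pu.
exists (iwasawa_mul a mu); split.
- exact: (iw_mul abelL finE).
- apply/eqP => /(Zp_iwasawa_domain p_prime p_odd J domO sfF sfL FL kP ia imu) [].
    exact: a0.
  exact: mu0.
rewrite (dual_scale_mul act1 actM actD actZ abelL finE ia imu Yphi).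
apply/funext => E; apply/funext => c.
have [Zc|nZ] := pselect (fine_cocycle act F S (sval E) c); last exact: dual_scale_out.
rewrite (dual_scaleE actM actD actZ abelL finE Yphi') //.
(* At a level inside L, [u] acts through its projection [a], and [psi] restricts to mu phi. *)
have := congr1 (fun z => z (widen_sub LL' E) c) upsi0.
rewrite (dual_scaleE actM actD actZ abelL' finE' Ypsi) // => e.
rewrite -[RHS]e; apply: eq_gal_sum => // s Gs; rewrite psiE //.
apply: (fine_cocycleZ actZ); apply: (fine_cocycle_twist_sub actM actD abelL) => //.
Qed.

End TorsionFromPseudoNull.

(** * The representation attached to the newform *)

Section ValuationRing.
Variables (K : fieldType) (v : discrete_valuation K).
Implicit Types (x y : K) (m n : int).

Lemma vge0 n : vge v 0 n. Proof. by rewrite /vge eqxx. Qed.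

Lemma vge_le m n x : m <= n -> vge v x n -> vge v x m.
Proof. by move=> mn /orP[/eqP->|/(le_trans mn) xm]; rewrite ?vge0 // /vge xm orbT. Qed.

Lemma vgeM m n x y : vge v x m -> vge v y n -> vge v (x * y) (m + n).
Proof.
have [->|x0] := eqVneq x 0; first by rewrite mul0r !vge0.
have [->|y0] := eqVneq y 0; first by rewrite mulr0 !vge0.
by rewrite /vge (negPf x0) (negPf y0) mulf_eq0 (negPf x0) (negPf y0) /= dvalM //; apply: lerD.
Qed.

Lemma vgeD n x y : vge v x n -> vge v y n -> vge v (x + y) n.
Proof.
have [->|x0] := eqVneq x 0; first by rewrite add0r.
have [->|y0] := eqVneq y 0; first by rewrite addr0.
rewrite /vge; have [//|xy0] := eqVneq (x + y) 0; rewrite (negPf x0) (negPf y0) /=.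
by move=> xn yn; apply: le_trans (dvalD _ _ _ xy0) => //; rewrite le_min xn.
Qed.

Lemma vgeN n x : vge v x n -> vge v (- x) n.
Proof.
move=> xn; rewrite -mulN1r -[n]add0r; apply: vgeM => //.
by rewrite /vge dvalN1 lexx orbT.
Qed.

Lemma vgeB n x y : vge v x n -> vge v y n -> vge v (x - y) n.
Proof. by move=> xn yn; apply/vgeD/vgeN. Qed.

Lemma vge_sep x : (forall n, vge v x n) -> x = 0.
Proof. by move=> /(_ (v x + 1)); rewrite /vge gerDl orbF => /eqP. Qed.

Lemma vint_domain (c d : vint v) : c * d = 0 -> c = 0 \/ d = 0.
Proof.
move=> /(congr1 val); rewrite rmorphM => /eqP; rewrite mulf_eq0.
by case/orP=> /eqP e; [left|right]; apply: val_inj.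
Qed.

Lemma vint_complete (u : nat -> vint v) : vcomplete v ->
  (forall n : nat, vge v (val (u n.+1 - u n)) n) ->
  exists l : vint v, forall n : nat, vge v (val (u n - l)) n.
Proof.
move=> vc uC; pose w (i : nat) := val (u i).
have wC (n m : nat) : (n <= m)%N -> vge v (w m - w n) n.
  move=> /subnKC <-; elim: (m - n)%N => [|j IHj]; first by rewrite addn0 subrr vge0.
  rewrite addnS -(subrK (w (n + j)%N) (w _)) -addrA; apply: vgeD => //.
  by apply: vge_le (uC (n + j)%N); rewrite lez_nat leq_addr.
have [|l lP] := vc w.
  move=> n; pose m := `|n|%N; exists m => i j ni nj; apply: (@vge_le _ m%:Z).
    by rewrite /m abszE ler_norm.
  rewrite -(subrK (w m) (w i)) -addrA -[w m - _]opprB.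
  by apply: vgeB; apply: wC.
have lO : l \in vring v.
  have [m mP] := lP 0; have := mP m (leqnn m) => ml.
  have := vgeB (valP (u m) : vge v (w m) 0) ml.
  by rewrite opprB addrC subrK.
exists (exist _ l lO) => n; rewrite -[val _]/(w n - l).
have [m mP] := lP n; pose j := maxn m n.
rewrite -(subrK (w j) (w n)) -addrA -[w n - _]opprB; apply: vgeD.
  by apply/vgeN/wC/leq_maxr.
exact/mP/leq_maxl.
Qed.

Definition vint_filtration p (vc : vcomplete v) (vp : vge v p%:R 1) :
  adic_filtration p (vint v).
Proof.
refine (@AdicFiltration p (vint v) (fun i : nat => [set x | vge v (val x) i]) _ _ _ _ _ _ _).
- by move=> x; exact: (valP x).
- by move=> i x y; apply: vgeB.
- by move=> i x y yi; have := vgeM (valP x : vge v (val x) 0) yi; rewrite add0r.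
- by move=> i x; apply: vge_le; rewrite lez_nat.
- move=> i x xi; have pE : val (p%:R * x : vint v) = p%:R * val x by rewrite rmorphM rmorph_nat.
  suff : vge v (val (p%:R * x : vint v)) i.+1 by [].
  by rewrite pE -add1n PoszD; apply: vgeM.
- move=> x xn; apply: val_inj; apply: vge_sep => n.
  by apply: vge_le (xn `|n|%N); rewrite abszE ler_norm.
- by move=> u uC; apply: vint_complete.
Defined.

End ValuationRing.

Lemma mx22_quadratic (F : fieldType) (M : 'M[F]_2) :
  M *m M - (\tr M *: M - (\det M)%:M) = 0.
Proof.
have det2 : \det M = M 0 0 * M 1 1 - M 0 1 * M 1 0.
  rewrite (expand_det_row _ 0) !big_ord_recl big_ord0 addr0 /cofactor !det_mx11 !mxE /=.
  rewrite !expr0 expr1 mul1r mulN1r mulrN; congr (_ * M _ _ - M _ _ * M _ _); exact: val_inj.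
apply/matrixP => i j; rewrite !mxE det2 /mxtrace !big_ord_recl !big_ord0 !addr0.
have -> : lift ord0 ord0 = 1 :> 'I_2 by apply: val_inj.
have ord2P (l : 'I_2) : l = 0 \/ l = 1.
  by case: l => -[|[|//]] ?; [left|right]; apply: val_inj.
by case: (ord2P i) => ->; case: (ord2P j) => ->; rewrite /= ?mulr1n ?mulr0n; ring.
Qed.

(** * The Galois module V/T of a stable lattice *)

Section LatticeAction.
Variables (K : fieldType) (v : discrete_valuation K).
Variables (rho : absGal -> 'M[K]_2) (B : 'M[K]_2).
Hypothesis repr_rho : galois_rep v rho.
Hypothesis stableB : stable_lattice v rho B.
Local Notation act := (@quotVT_act K v rho B).

Lemma quotVT_actE s x : act s (toVT v B x) = toVT v B (rho s *m x).
Proof.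
apply: toVT_eq; rewrite -mulmxBr; case: stableB => _; apply.
exact: fromVT_toVT.
Qed.

Lemma quotVT_ind (T : quotVT v B -> Prop) : (forall x, T (toVT v B x)) -> forall a, T a.
Proof. by move=> Tx a; rewrite -(fromVTK a). Qed.

Lemma quotVT_act1 a : act 1%g a = a.
Proof.
elim/quotVT_ind: a => x; rewrite quotVT_actE.
by case: repr_rho => r1 _ _; rewrite -[1%g]/gal_id r1 mul1mx.
Qed.

Lemma quotVT_actM s t a : act (s * t)%g a = act s (act t a).
Proof.
elim/quotVT_ind: a => x; rewrite !quotVT_actE mulmxA.
by case: repr_rho => _ rM _; rewrite -rM.
Qed.

Lemma quotVT_actD s a b : act s (a + b) = act s a + act s b.
Proof.
elim/quotVT_ind: a => x; elim/quotVT_ind: b => y.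
by rewrite -toVTD !quotVT_actE mulmxDr toVTD.
Qed.

Lemma toVT_scale (r : vint v) x : r *: toVT v B x = toVT v B (val r *: x).
Proof. exact: quotVT_scaleE. Qed.

Lemma quotVT_actZ s (r : vint v) a : act s (r *: a) = r *: act s a.
Proof.
by elim/quotVT_ind: a => x; rewrite toVT_scale !quotVT_actE toVT_scale scalemxAr.
Qed.

(** This is the matrix of [rho s] in a basis of the stable lattice. Trace and determinant do not
    change under conjugation, so they are integral too. *)
Lemma conj_entry s i j : (invmx B *m rho s *m B) i j \in vring v.
Proof.
have [Bu st] := stableB.
have colB : col j B \in lattice v B.
  rewrite /in_mem /= /lattice colE mulmxA mulVmx // mul1mx.
  by apply/mxOverP => i' j'; rewrite !mxE; case: (_ && _); rewrite ?rpred1 ?rpred0.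
have := st s _ colB; rewrite /in_mem /= /lattice => /mxOverP /(_ i 0).
by rewrite colE !mulmxA -colE mxE.
Qed.

Lemma mxtrace_vring s : \tr (rho s) \in vring v.
Proof.
have [Bu _] := stableB; have -> : \tr (rho s) = \tr (invmx B *m rho s *m B).
  by rewrite mxtrace_mulC mulmxA mulmxV // mul1mx.
by rewrite /mxtrace rpred_sum // => i _; apply: conj_entry.
Qed.

Lemma det_vring s : \det (rho s) \in vring v.
Proof.
have [Bu _] := stableB; have -> : \det (rho s) = \det (invmx B *m rho s *m B).
  by rewrite !det_mulmx mulrAC -det_mulmx mulVmx // det1 mul1r.
rewrite /determinant rpred_sum // => t _; apply: rpredM; first by rewrite rpredX // rpredN rpred1.
by apply: rpred_prod => i _; apply: conj_entry.
Qed.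

Lemma quotVT_act_quadratic s : exists r1 r2 : vint v, forall a,
  act s (act s a) - (r1 *: act s a - r2 *: a) = 0.
Proof.
pose r1 : vint v := exist (fun x => x \in vring v) _ (mxtrace_vring s).
pose r2 : vint v := exist (fun x => x \in vring v) _ (det_vring s).
exists r1, r2; elim/quotVT_ind => x.
rewrite !quotVT_actE !toVT_scale -[val r1]/(\tr (rho s)) -[val r2]/(\det (rho s)).
have toVTB y z : toVT v B y - toVT v B z = toVT v B (y - z) by rewrite -raddfB.
rewrite !toVTB; apply: etrans (_ : toVT v B 0 = 0); last exact: raddf0.
congr toVT; have := mx22_quadratic (rho s) => /(congr1 (mulmx^~ x)).
by rewrite mul0mx mulmxBl mulmxBl -mulmxA -scalemxAl mul_scalar_mx.
Qed.

End LatticeAction.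

Lemma gen_field_nat (C : fieldType) (X : set C) n : gen_field X n%:R.
Proof.
move=> E [E1 EB _] _; have E0 : E 0 by rewrite -(subrr 1); apply: EB.
have EN1 : E (0 - 1) by apply: EB.
by elim: n => // n En; rewrite -natr1; have := EB _ _ En EN1; rewrite sub0r opprK.
Qed.

(** [i] is a ring morphism only on the generated subfield, so the induction keeps its terms
    there. *)
Lemma completion_nat (C : fieldType) (X P : set C) (K : fieldType)
    (v : discrete_valuation K) (i : C -> K) n :
  completion_at (gen_field X) P v i -> i n%:R = n%:R.
Proof.
move=> [[i1 iD _] _ _ _ _]; have F0 : gen_field X 0 := @gen_field_nat C X 0.
elim: n => [|n IHn].
  by apply: (addrI (i 0)); rewrite -iD // !addr0.
by rewrite -!natr1 iD ?IHn ?i1 //; [apply: gen_field_nat|apply: (@gen_field_nat C X 1)].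
Qed.

Theorem proposition4p3 (R : realType)
  (* an odd prime p and a normalized newform f = sum_n a_n q^n *)
  (p : nat) (p_prime : prime p) (p_odd : odd p)
  (k N : nat) (k_ge2 : (2 <= k)%N) (k_even : ~~ odd k) (N_gt0 : (0 < N)%N)
  (e : int -> R[i]) (e_char : dirichlet N e)
  (f : R[i] -> R[i]) (a : nat -> R[i]) (f_newform : newform k N e f a)
  (* K is the completion of K_f at a prime P above p *)
  (P : set R[i]) (P_prime : finite_prime (coefficient_field a) P)
  (P_p : P p%:R)
  (K : fieldType) (v : discrete_valuation K) (i : R[i] -> K)
  (K_completion : completion_at (coefficient_field a) P v i)
  (* V_f, T_f and A_f = quotVT v B *)
  (rho : absGal -> 'M[K]_2) (rho_f : deligne_rep v p k N e a i rho)
  (B : 'M[K]_2) (T_stable : stable_lattice v rho B)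
  (* the number field F, the finite set S and the Z_p^2-extension Loo *)
  (F : set algC) (F_nf : number_field F)
  (S : set (set algC)) (S_fin : finite_set S)
  (S_primes : S `<=` finite_prime F)
  (S_pN : forall Q, finite_prime F Q -> Q (p * N)%:R -> S Q)
  (Loo : set algC) (Loo_Zp2 : Zp_extension p 2 F Loo)
  (Fcyc : set algC) (Fcyc_cyc : cyclotomic_Zp_extension p F Fcyc)
  (Fcyc_Loo : Fcyc `<=` Loo) :
  dual_pseudo_null R (@quotVT_act K v rho B) F S Loo ->
  forall L : set algC, Zp_extension p 1 F L -> L `<=` Loo ->
    dual_torsion R (@quotVT_act K v rho B) F S L.
Proof.
move=> pn L L_Zp LLoo.
(* The prime lies above p, so the image of p in the completion has positive valuation. *)
have vp : vge v p%:R 1.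
  have [[PO _ _] _] := P_prime; have [_ _ iP _ _] := K_completion.
  by rewrite -(completion_nat p K_completion) -iP //; apply: PO.
have vc : vcomplete v by case: K_completion.
have repr_rho : galois_rep v rho by case: rho_f.
apply: (torsion_of_pseudo_null p_prime p_odd (vint_filtration vc vp) (@vint_domain K v)
  (quotVT_act1 repr_rho T_stable) (quotVT_actM repr_rho T_stable)
  (quotVT_actD T_stable) (quotVT_actZ T_stable) (quotVT_act_quadratic T_stable)
  L_Zp Loo_Zp2 LLoo pn).
Qed.
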